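(* Let $0\le\alpha<1$, let $p\ge1$ be a real number, and let $\mu:[0,\infty)\to[0,\infty)$ be a monotone increasing function. Let $f=h+\overline{g}\in\mathcal{P}_{\mathcal{H}}^{0}(\alpha)$ with $h(z)=z+\sum_{n=2}^{\infty}a_nz^n$ and $g(z)=\sum_{n=1}^{\infty}b_nz^n$. Then $$|f(z)|^p+\sum_{n=2}^{\infty}(|a_n|+|b_n|)|z|^n+\mu\left(\frac{S_{|z|}}{\pi}\right)\le d(f(0),\partial f(\mathbb{D}))$$ holds for $|z|=r\le R_f^*(\alpha)$, where $R_f^*(\alpha)$ is the unique root in $(0,1)$ of the equation $$J_2(r):=\Big(r-2(1-\alpha)\big(r+\ln(1-r)\big)\Big)^p-2(1-\alpha)\big(r+\ln(1-r)\big)+\mu\big(M_\alpha(r)\big)-1-2(1-\alpha)(\ln2-1)=0.$$ The radius $R_f^*(\alpha)$ is best possible.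
   Context: $\mathbb{D}=\{z\in\mathbb{C}:|z|<1\}$ is the open unit disk and $\mathbb{D}_r=\{z\in\mathbb{C}:|z|<r\}$. $\mathcal{H}$ denotes the class of orientation-preserving (sense-preserving, i.e. $|h'|^2-|g'|^2>0$) complex-valued harmonic mappings $f=h+\overline{g}$ on $\mathbb{D}$, with $h,g$ analytic in $\mathbb{D}$ and normalized by $h(0)=0=h'(0)-1$, $g(0)=0$. For $0\le\alpha<1$, $$\mathcal{P}_{\mathcal{H}}^{0}(\alpha)=\{f=h+\overline{g}\in\mathcal{H}:\ \operatorname{Re}(h'(z)-\alpha)>|g'(z)|\ \text{for all } z\in\mathbb{D},\ g'(0)=0\}.$$ Thus $h(z)=z+\sum_{n\ge2}a_nz^n$ and $g(z)=\sum_{n\ge1}b_nz^n$ with $b_1=0$. For $f=h+\overline{g}$ and $0\le r<1$, $S_r$ is the area integral of the Jacobian: $$S_r=\iint_{\mathbb{D}_r}\left(|h'(z)|^2-|g'(z)|^2\right)dx\,dy .$$ For $0\le r<1$, $$M_\alpha(r):=r^2+4(1-\alpha)^2\sum_{n=2}^{\infty}\frac{r^{2n}}{n}.$$ $d(f(0),\partial f(\mathbb{D}))$ is the Euclidean distance from $f(0)$ to the boundary of $f(\mathbb{D})$. The number $R_f^*(\alpha)$ depends only on $\alpha,p,\mu$. ''Best possible'' means that $R_f^*(\alpha)$ cannot be replaced by any larger number in $(0,1)$ such that the inequality still holds for all $f\in\mathcal{P}_{\mathcal{H}}^{0}(\alpha)$.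
   Formalization: For some increasing μ (e.g. μ ≡ 5) J_2 has no root in (0,1). Existence of the root is claimed only for μ continuous with μ(0) < 1+2(1−α)(ln 2−1); uniqueness, the inequality and sharpness are claimed for every increasing μ whenever a root in (0,1) exists. *)

(* Defs.v *)
From Stdlib Require Export Reals.
From Coquelicot Require Export Coquelicot.
Open Scope R_scope.

(* [x ^ p] for [0 <= x] and [0 < p]: [Rpower 0 p] is [1] in the standard
   library, whereas [0 ^ p] must be [0]. *)
Definition rpow (x p : R) : R :=
  if Req_EM_T x 0 then 0 else Rpower x p.

Definition in_disk (z : C) : Prop := Cmod z < 1.

Definition analytic_on_disk (h : C -> C) : Prop :=
  forall z : C, in_disk z -> @ex_derive C_AbsRing C_NormedModule h z.

(* A harmonic mapping is given by the pair [(h, g)] of its canonical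
   decomposition; [C_derive] is the complex derivative, the two functions
   being complex differentiable at every point where it is used. *)
Definition harmonic_map (h g : C -> C) (z : C) : C :=
  Cplus (h z) (Cconj (g z)).

Definition jacobian (h g : C -> C) (z : C) : R :=
  (Cmod (C_derive h z)) ^ 2 - (Cmod (C_derive g z)) ^ 2.

Definition class_H (h g : C -> C) : Prop :=
  analytic_on_disk h /\ analytic_on_disk g /\
  h (RtoC 0) = RtoC 0 /\ C_derive h (RtoC 0) = RtoC 1 /\ g (RtoC 0) = RtoC 0 /\
  (forall z : C, in_disk z -> 0 < jacobian h g z).

Definition class_PH0 (alpha : R) (h g : C -> C) : Prop :=
  class_H h g /\
  (forall z : C, in_disk z ->
     Re (Cminus (C_derive h z) (RtoC alpha)) > Cmod (C_derive g z)) /\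
  C_derive g (RtoC 0) = RtoC 0.

(* [h z = z + sum_{n >= 2} a_n z^n] and [g z = sum_{n >= 1} b_n z^n] on the
   disk; the values [a 0], [a 1] and [b 0] play no role. *)
Definition power_expansions (h g : C -> C) (a b : nat -> C) : Prop :=
  forall z : C, in_disk z ->
    @is_series C_AbsRing C_NormedModule
      (fun n => Cmult (a (n + 2)%nat) (Cpow z (n + 2))) (Cminus (h z) z) /\
    @is_series C_AbsRing C_NormedModule
      (fun n => Cmult (b (n + 1)%nat) (Cpow z (n + 1))) (g z).

(* The double integral of the Jacobian over the disk of radius [r], as an
   iterated integral; the integrand is continuous on the closed disk when
   [h], [g] are analytic in the unit disk and [0 <= r < 1]. *)
Definition area_S (h g : C -> C) (r : R) : R :=
  RInt (fun x : R =>
    RInt (fun y : R => jacobian h g (x, y))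
      (- sqrt (r ^ 2 - x ^ 2)) (sqrt (r ^ 2 - x ^ 2)))
    (- r) r.

Definition M_fun (alpha r : R) : R :=
  r ^ 2 + 4 * (1 - alpha) ^ 2 *
    Series (fun n : nat => r ^ (2 * (n + 2)) / INR (n + 2)).

Definition J2 (alpha p : R) (mu : R -> R) (r : R) : R :=
  rpow (r - 2 * (1 - alpha) * (r + ln (1 - r))) p
  - 2 * (1 - alpha) * (r + ln (1 - r))
  + mu (M_fun alpha r)
  - 1 - 2 * (1 - alpha) * (ln 2 - 1).

Definition image_of_disk (f : C -> C) (w : C) : Prop :=
  exists z : C, in_disk z /\ w = f z.

Definition boundary (E : C -> Prop) (w : C) : Prop :=
  forall eps : R, 0 < eps ->
    (exists u : C, E u /\ Cmod (Cminus u w) < eps) /\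
    (exists v : C, ~ E v /\ Cmod (Cminus v w) < eps).

(* Infimum in the extended reals, [p_infty] for an empty set. *)
Definition dist_to (w0 : C) (E : C -> Prop) : Rbar :=
  Glb_Rbar (fun d : R => exists w : C, E w /\ d = Cmod (Cminus w w0)).

Definition bohr_inequality (p : R) (mu : R -> R)
    (h g : C -> C) (a b : nat -> C) (z : C) : Prop :=
  Rbar_le
    (Finite
      (rpow (Cmod (harmonic_map h g z)) p
       + Series (fun n : nat =>
           (Cmod (a (n + 2)%nat) + Cmod (b (n + 2)%nat)) * Cmod z ^ (n + 2))
       + mu (area_S h g (Cmod z) / PI)))
    (dist_to (harmonic_map h g (RtoC 0))
       (boundary (image_of_disk (harmonic_map h g)))).

(* Main.v *)
Require Import Defs.
From Stdlib Require Import Reals Lra Lia Psatz FunctionalExtensionality.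
From Coquelicot Require Import Coquelicot.

(** The inequality reduces to four sharp estimates, each attained by the single function
    [z + 2 (1 - alpha) * sum_(n >= 2) z^n / n].

    Condition [Re (h' - alpha) > |g'|] says that for every unimodular [e] the function
    [h' + e g' - alpha] has positive real part, with value [1 - alpha] at [0].  Two classical
    facts about such functions, [caratheodory] (coefficients) and [harnack] (lower bound of
    the real part), both come from one duality principle, [positive_duality]: pairing the
    Fourier series of a positive function on a circle with a non-negative trigonometric
    polynomial gives a non-negative number.  Choosing [e] well, they yield
    [|a_n| + |b_n| <= 2 (1 - alpha) / n] ([coefficient_bound]) and
    [Re h' - |g'| >= alpha + (1 - alpha) (1 - |z|) / (1 + |z|)] ([distortion]).

    The coefficient bound gives the upper bounds of [|f(z)|] ([growth]) and of the majorant
    series ([majorant_bound]) and, through Parseval's formula for the area integral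
    ([parseval], [area_formula]), the bound [S_r / PI <= M_alpha(r)] ([area_upper]).

    The distortion bound gives the lower bound of the distance.  It makes [f] strongly
    monotone, in the sense that [Re ((f z - f w) * conj (z - w)) >= m |z - w|^2] on every
    smaller disk, and it gives [Re (f z * conj z) >= |z| * L(|z|)], where
    [L(r) = r - 2 (1 - alpha) (r - ln (1 + r))] tends to
    [L(1) = 1 + 2 (1 - alpha) (ln 2 - 1)] as [r] tends to [1].  A
    projected fixed-point iteration then solves [f z = w] for every [|w| < L(1)]
    ([covering_theorem]), so every boundary point of the image has modulus at least [L(1)].

    Hence the left-hand side is at most [J2(r) + L(1)], and the right-hand side at least
    [L(1)].  Since [J2] is strictly increasing ([J2_lt]), the inequality holds up to the root
    of [J2].  For the extremal function all estimates are equalities: the moduli and the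
    area at a positive [z] are the bounds above, and [- L(1)], the limit of [f] at [-1], is a
    boundary point of the image ([extremal_distance]); so the inequality fails wherever
    [J2 > 0]. *)

(** * Complex power series on the unit disk *)

Notation Csum a n := (@sum_n C_AbelianMonoid a n).
Notation is_Cseries a l := (@is_series C_AbsRing C_NormedModule a l).

(** Taking real and imaginary parts makes the sum a total function of [z]; it is the sum of
    the complex series wherever that converges ([PS_unique]). *)
Definition PS (c : nat -> C) (z : C) : C :=
  (Series (fun n => Re (c n * z ^ n)%C), Series (fun n => Im (c n * z ^ n)%C)).

Definition summable (c : nat -> C) : Prop :=
  forall r : R, 0 <= r < 1 -> ex_series (fun n => Cmod (c n) * r ^ n).

(** The coefficients of the formal derivative. *)
Definition dps (c : nat -> C) (n : nat) : C := (RtoC (INR (S n)) * c (S n))%C.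

Lemma Cmod_minus_sym (x y : C) : Cmod (x - y) = Cmod (y - x).
Proof. rewrite <- Cmod_opp. f_equal. ring. Qed.

Lemma Re_le_Cmod (z : C) : Re z <= Cmod z.
Proof. eapply Rle_trans; [apply Rle_abs | apply re_le_Cmod]. Qed.

Lemma Im_le_Cmod (z : C) : Rabs (Im z) <= Cmod z.
Proof.
  eapply Rle_trans; [|apply Rmax_Cmod]. apply Rmax_r.
Qed.

Lemma re_minus (a b : C) : Re (a - b) = Re a - Re b.
Proof. unfold Cminus. rewrite re_plus, re_opp. reflexivity. Qed.

Lemma Re_Csum (a : nat -> C) (n : nat) : Re (Csum a n) = sum_n (fun k => Re (a k)) n.
Proof.
  induction n as [|n IH]; [now rewrite !sum_O|].
  rewrite !sum_Sn, <- IH. reflexivity.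
Qed.

Lemma Im_Csum (a : nat -> C) (n : nat) : Im (Csum a n) = sum_n (fun k => Im (a k)) n.
Proof.
  induction n as [|n IH]; [now rewrite !sum_O|].
  rewrite !sum_Sn, <- IH. reflexivity.
Qed.

Lemma Csum_Sn (a : nat -> C) (n : nat) : Csum a (S n) = (Csum a n + a (S n))%C.
Proof. now rewrite sum_Sn. Qed.

Lemma is_Cseries_eps (a : nat -> C) (l : C) :
  is_Cseries a l ->
  forall eps, 0 < eps -> exists N, forall n, (N <= n)%nat -> Cmod (l - Csum a n) < eps.
Proof.
  intros H eps Heps.
  assert (He2 : 0 < eps / 2) by lra.
  assert (Hs : 0 < sqrt 2) by (apply sqrt_lt_R0; lra).
  assert (He : 0 < eps / sqrt 2) by (apply Rdiv_lt_0_compat; lra).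
  unfold is_series in H.
  destruct (proj1 (filterlim_locally _ _) H (mkposreal _ He)) as [N HN]. exists N. intros n Hn.
  specialize (HN n Hn).
  apply C_NormedModule_mixin_compat2 in HN. simpl in HN.
  rewrite Cmod_minus_sym.
  replace eps with (sqrt 2 * (eps / sqrt 2)) by (field; lra). exact HN.
Qed.

Lemma is_Cseries_Re (a : nat -> C) (l : C) :
  is_Cseries a l -> is_series (fun n => Re (a n)) (Re l).
Proof.
  intros H. unfold is_series.
  apply filterlim_locally. intros eps.
  destruct (is_Cseries_eps a l H eps (cond_pos eps)) as [N HN].
  exists N. intros n Hn. rewrite <- Re_Csum.
  change (Rabs (Re (Csum a n) - Re l) < eps).
  rewrite <- re_minus. eapply Rle_lt_trans; [apply re_le_Cmod|].
  rewrite Cmod_minus_sym. now apply HN.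
Qed.

Lemma is_Cseries_Im (a : nat -> C) (l : C) :
  is_Cseries a l -> is_series (fun n => Im (a n)) (Im l).
Proof.
  intros H. unfold is_series.
  apply filterlim_locally. intros eps.
  destruct (is_Cseries_eps a l H eps (cond_pos eps)) as [N HN].
  exists N. intros n Hn. rewrite <- Im_Csum.
  change (Rabs (Im (Csum a n) - Im l) < eps).
  replace (Im (Csum a n) - Im l) with (Im (Csum a n - l)%C)
    by (unfold Cminus; rewrite im_plus, im_opp; ring).
  eapply Rle_lt_trans; [apply Im_le_Cmod|].
  rewrite Cmod_minus_sym. now apply HN.
Qed.

Lemma is_Cseries_unique (a : nat -> C) (l1 l2 : C) :
  is_Cseries a l1 -> is_Cseries a l2 -> l1 = l2.
Proof.
  intros H1 H2.
  destruct l1 as [x1 y1], l2 as [x2 y2].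
  apply is_Cseries_Re in H1 as H1r. apply is_Cseries_Re in H2 as H2r.
  apply is_Cseries_Im in H1. apply is_Cseries_Im in H2.
  apply is_series_unique in H1, H2, H1r, H2r. simpl in *. congruence.
Qed.

Lemma PS_unique (c : nat -> C) (z l : C) :
  is_Cseries (fun n => c n * z ^ n)%C l -> PS c z = l.
Proof.
  intros H. unfold PS.
  apply is_Cseries_Re in H as Hr. apply is_Cseries_Im in H.
  apply is_series_unique in H, Hr. rewrite H, Hr. now destruct l.
Qed.

Lemma PS_correct (c : nat -> C) (z : C) :
  summable c -> Cmod z < 1 -> is_Cseries (fun n => c n * z ^ n)%C (PS c z).
Proof.
  intros Hc Hz.
  assert (H : @ex_series C_AbsRing C_CompleteNormedModule (fun n => c n * z ^ n)%C).
  { apply (@ex_series_le C_AbsRing C_CompleteNormedModule) with (b := fun n => Cmod (c n) * Cmod z ^ n).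
    - intros n. change (Cmod (c n * z ^ n) <= Cmod (c n) * Cmod z ^ n).
      rewrite Cmod_mult, Cmod_pow. lra.
    - apply Hc. split; [apply Cmod_ge_0 | exact Hz]. }
  destruct H as [l Hl].
  rewrite (PS_unique c z l Hl). exact Hl.
Qed.

Lemma ex_series_pow_bound (c : nat -> C) (r s B : R) :
  0 <= r < s -> (forall n, Cmod (c n) * s ^ n <= B) ->
  ex_series (fun n => Cmod (c n) * r ^ n).
Proof.
  intros [Hr Hrs] HB.
  assert (Hs : 0 < s) by lra.
  apply (@ex_series_le R_AbsRing R_CompleteNormedModule) with (b := fun n => B * (r / s) ^ n).
  - intros n. change (Rabs (Cmod (c n) * r ^ n) <= B * (r / s) ^ n).
    rewrite Rabs_pos_eq
      by (apply Rmult_le_pos; [apply Cmod_ge_0 | now apply pow_le]).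
    replace (Cmod (c n) * r ^ n) with ((Cmod (c n) * s ^ n) * (r / s) ^ n).
    + apply Rmult_le_compat_r; [|apply HB].
      apply pow_le. apply Rmult_le_pos; [lra | left; now apply Rinv_0_lt_compat].
    + rewrite Rmult_assoc, <- Rpow_mult_distr. do 2 f_equal. field. lra.
  - apply (@ex_series_scal R_AbsRing R_NormedModule).
    apply ex_series_geom.
    rewrite Rabs_pos_eq
      by (apply Rmult_le_pos; [lra | left; now apply Rinv_0_lt_compat]).
    apply Rmult_lt_reg_r with s; [lra|]. unfold Rdiv.
    rewrite Rmult_assoc, Rinv_l by lra. lra.
Qed.

Lemma is_Cseries_bounded (a : nat -> C) (l : C) :
  is_Cseries a l -> exists B, forall n, Cmod (a n) <= B.
Proof.
  intros H.
  destruct (is_Cseries_eps a l H 1 Rlt_0_1) as [N HN].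
  assert (Hfin : forall M, exists B, forall n, (n <= M)%nat -> Cmod (a n) <= B).
  { induction M as [|M [B HB]].
    - exists (Cmod (a O)). intros n Hn. replace n with O by lia. lra.
    - exists (Rmax B (Cmod (a (S M)))). intros n Hn.
      destruct (Nat.eq_dec n (S M)) as [->|Hne]; [apply Rmax_r|].
      eapply Rle_trans; [apply HB; lia | apply Rmax_l]. }
  destruct (Hfin (S N)) as [B HB].
  exists (Rmax B 2). intros n.
  destruct (Compare_dec.le_lt_dec n (S N)) as [Hn|Hn].
  - eapply Rle_trans; [now apply HB | apply Rmax_l].
  - eapply Rle_trans; [|apply Rmax_r].
    destruct n as [|n]; [lia|].
    replace (a (S n)) with ((l - Csum a n) - (l - Csum a (S n)))%C
      by (rewrite Csum_Sn; ring).
    eapply Rle_trans; [apply Cmod_triangle|]. rewrite Cmod_opp.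
    pose proof (HN n ltac:(lia)). pose proof (HN (S n) ltac:(lia)). lra.
Qed.

Lemma summable_of_converges (c : nat -> C) :
  (forall r : R, 0 <= r < 1 -> exists l, is_Cseries (fun n => c n * RtoC r ^ n)%C l) ->
  summable c.
Proof.
  intros H r Hr.
  destruct (H ((r + 1) / 2) ltac:(lra)) as [l Hl].
  destruct (is_Cseries_bounded _ _ Hl) as [B HB].
  apply ex_series_pow_bound with (s := (r + 1) / 2) (B := B); [lra|].
  intros n. specialize (HB n).
  rewrite Cmod_mult, Cmod_pow, Cmod_R, Rabs_pos_eq in HB by lra. exact HB.
Qed.

(** The radius of convergence of a real power series is unchanged by differentiation; this
    is how the formal derivative inherits [summable]. *)
Lemma summable_radius (c : nat -> C) :
  summable c -> forall r, 0 <= r < 1 -> Rbar_lt r (CV_radius (fun n => Cmod (c n))).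
Proof.
  intros H r Hr.
  apply Rbar_lt_le_trans with (Finite ((r + 1) / 2)); [simpl; lra|].
  destruct (Rbar_le_lt_dec (Finite ((r + 1) / 2)) (CV_radius (fun n => Cmod (c n))))
    as [Hle|Hlt]; [exact Hle|exfalso].
  apply (CV_disk_outside (fun n => Cmod (c n)) ((r + 1) / 2)).
  - rewrite Rabs_pos_eq by lra. exact Hlt.
  - apply ex_series_lim_0. apply H. lra.
Qed.

Lemma dps_summable (c : nat -> C) : summable c -> summable (dps c).
Proof.
  intros Hc r Hr.
  pose proof (summable_radius c Hc r Hr) as H.
  rewrite <- CV_radius_derive in H.
  rewrite <- (Rabs_pos_eq r) in H by lra.
  apply CV_disk_inside in H.
  eapply ex_series_ext; [|exact H]. intros n. simpl.
  unfold PS_derive, dps.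
  rewrite Cmod_mult, Cmod_R.
  rewrite !(Rabs_pos_eq (INR (S n))) by apply pos_INR.
  rewrite Rabs_pos_eq; [reflexivity|].
  repeat apply Rmult_le_pos; try apply pos_INR; try apply Cmod_ge_0; apply pow_le; lra.
Qed.

Lemma Series_nonneg (a : nat -> R) :
  (forall n, 0 <= a n) -> ex_series a -> 0 <= Series a.
Proof.
  intros Ha Hs. rewrite <- (Rmult_0_l (Series a)), <- Series_scal_l.
  apply Series_le; [|exact Hs]. intros n. specialize (Ha n). lra.
Qed.

Lemma Series_split (a : nat -> R) (n : nat) :
  ex_series a -> Series a = sum_n a n + Series (fun k => a (S n + k)%nat).
Proof.
  intros H. rewrite (Series_incr_n a (S n)); [|lia|exact H].
  simpl pred. now rewrite sum_n_Reals.
Qed.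

Lemma Cseries_le (a : nat -> C) (b : nat -> R) (l : C) :
  is_Cseries a l -> (forall n, Cmod (a n) <= b n) -> ex_series b -> Cmod l <= Series b.
Proof.
  intros Ha Hab Hb.
  apply Rnot_lt_le. intros Hlt.
  destruct (is_Cseries_eps a l Ha (Cmod l - Series b) ltac:(lra)) as [N HN].
  specialize (HN N (le_n N)).
  assert (Hs : Cmod (Csum a N) <= sum_n b N).
  { clear HN. induction N as [|N IH]; [rewrite !sum_O; apply Hab|].
    rewrite Csum_Sn, sum_Sn.
    eapply Rle_trans; [apply Cmod_triangle|].
    apply Rplus_le_compat; [exact IH | apply Hab]. }
  assert (Hs2 : sum_n b N <= Series b).
  { rewrite (Series_split b N Hb).
    assert (0 <= Series (fun k => b (S N + k)%nat)); [|lra].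
    assert (Hb' : ex_series (fun k => b (S N + k)%nat))
      by (now apply ex_series_incr_n).
    apply Series_nonneg; [|exact Hb'].
    intros k. eapply Rle_trans; [apply Cmod_ge_0 | apply Hab]. }
  pose proof (Cmod_triangle (l - Csum a N) (Csum a N)) as Ht.
  replace (l - Csum a N + Csum a N)%C with l in Ht by ring. lra.
Qed.

Lemma is_Cseries_tail (a : nat -> C) (l : C) (n : nat) :
  is_Cseries a l -> is_Cseries (fun k => a (S n + k)%nat) (l - Csum a n)%C.
Proof.
  intros H.
  assert (Hm : is_Cseries (fun k => a (S n + k)%nat) (plus l (opp (Csum a (pred (S n)))))).
  { apply is_series_incr_n; [lia|].
    simpl pred.
    replace (plus _ _) with l; [exact H|].
    change (l = (l + - Csum a n + Csum a n)%C). ring. }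
  exact Hm.
Qed.

Lemma PS_uniform (c : nat -> C) (r : R) :
  summable c -> 0 <= r < 1 -> forall eps, 0 < eps -> exists N, forall n, (N <= n)%nat ->
  forall z, Cmod z <= r -> Cmod (PS c z - Csum (fun k => c k * z ^ k)%C n) <= eps.
Proof.
  intros Hc Hr eps Heps.
  pose proof (Hc r Hr) as Hs.
  pose proof (Series_correct _ Hs) as Hl.
  unfold is_series in Hl.
  destruct (proj1 (filterlim_locally _ _) Hl (mkposreal _ Heps)) as [N HN]. exists N. intros n Hn z Hz.
  specialize (HN n Hn).
  assert (HN' : Rabs (sum_n (fun n => Cmod (c n) * r ^ n) n
            - Series (fun n => Cmod (c n) * r ^ n)) < eps) by exact HN.
  apply Rle_trans with (Series (fun k => Cmod (c (S n + k)%nat) * r ^ (S n + k))).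
  - apply Cseries_le with (a := fun k => (c (S n + k)%nat * z ^ (S n + k))%C).
    + apply (is_Cseries_tail (fun k => c k * z ^ k)%C). apply PS_correct; [exact Hc|lra].
    + intros k. rewrite Cmod_mult, Cmod_pow.
      apply Rmult_le_compat_l; [apply Cmod_ge_0|].
      apply pow_incr. split; [apply Cmod_ge_0 | exact Hz].
    + now apply (ex_series_incr_n (fun n => Cmod (c n) * r ^ n)).
  - rewrite (Series_split _ n Hs) in HN'.
    apply Rabs_def2 in HN'. lra.
Qed.

(** Second-order Taylor estimate for [z^(n+2)].  The remainder [E_n] of [z^n] satisfies
    [E_(n+1) = w E_n + n z^(n-1) (w - z)^2]. *)
Lemma Cpow_taylor (z w : C) (r : R) (n : nat) :
  Cmod z <= r -> Cmod w <= r ->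
  Cmod (w ^ (n + 2) - z ^ (n + 2) - RtoC (INR (n + 2)) * z ^ (n + 1) * (w - z))
  <= INR (n + 2) * INR (n + 1) * r ^ n * Cmod (w - z) ^ 2.
Proof.
  intros Hz Hw. induction n as [|n IH].
  - replace (w ^ (0 + 2) - z ^ (0 + 2) - RtoC (INR (0 + 2)) * z ^ (0 + 1) * (w - z))%C
      with ((w - z) ^ 2)%C.
    + rewrite Cmod_pow. simpl. pose proof (pow2_ge_0 (Cmod (w - z))). simpl in *. nra.
    + simpl INR. rewrite RtoC_plus. simpl. ring.
  - set (E := (w ^ (n + 2) - z ^ (n + 2) - RtoC (INR (n + 2)) * z ^ (n + 1) * (w - z))%C) in *.
    replace (w ^ (S n + 2) - z ^ (S n + 2)
             - RtoC (INR (S n + 2)) * z ^ (S n + 1) * (w - z))%C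
      with (w * E + RtoC (INR (n + 2)) * z ^ (n + 1) * ((w - z) ^ 2))%C.
    + eapply Rle_trans; [apply Cmod_triangle|].
      rewrite !Cmod_mult, !Cmod_pow, Cmod_R, (Rabs_pos_eq (INR _)) by apply pos_INR.
      set (d := Cmod (w - z) ^ 2) in *.
      assert (Hd : 0 <= d) by apply pow2_ge_0.
      pose proof (Cmod_ge_0 z). pose proof (Cmod_ge_0 w).
      assert (Hzn : Cmod z ^ (n + 1) <= r ^ (n + 1)) by (apply pow_incr; lra).
      assert (Hr : 0 <= r ^ (n+1)) by (apply pow_le; lra).
      assert (H1 : Cmod w * Cmod E <= r * (INR (n + 2) * INR (n + 1) * r ^ n * d)).
      { apply Rmult_le_compat; auto using Cmod_ge_0. }
      assert (H2 : INR (n + 2) * Cmod z ^ (n + 1) * d <= INR (n+2) * r ^ (n+1) * d).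
      { apply Rmult_le_compat_r; [exact Hd|]. apply Rmult_le_compat_l; [apply pos_INR|exact Hzn]. }
      replace (S n + 2)%nat with (n + 3)%nat by lia.
      replace (S n + 1)%nat with (n + 2)%nat by lia.
      replace (r ^ S n) with (r ^ (n+1)) by (f_equal; lia).
      replace (r * (INR (n + 2) * INR (n + 1) * r ^ n * d))
        with (INR (n + 2) * INR (n + 1) * r ^ (n+1) * d) in H1
        by (replace (n+1)%nat with (S n) by lia; simpl pow; ring).
      pose proof (pos_INR n) as Hn.
      rewrite !plus_INR in *. simpl in *.
      assert (0 <= r ^ (n + 1) * d) by (now apply Rmult_le_pos).
      nra.
    + unfold E. replace (S n + 2)%nat with (S (n + 2)) by lia.
      replace (S n + 1)%nat with (S (n + 1)) by lia.
      replace (n + 2)%nat with (S (n + 1)) by lia.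
      rewrite (S_INR (S (n+1))), RtoC_plus. rewrite !Cpow_S. ring.
Qed.

(** A uniform quadratic Taylor estimate: it gives the complex derivative, the derivative
    along real segments and local Lipschitz bounds all at once. *)
Lemma PS_taylor (c : nat -> C) (r : R) :
  summable c -> 0 <= r < 1 -> exists K, 0 <= K /\ forall z w, Cmod z <= r -> Cmod w <= r ->
  Cmod (PS c w - PS c z - PS (dps c) z * (w - z)) <= K * Cmod (w - z) ^ 2.
Proof.
  intros Hc Hr.
  assert (H2 := dps_summable _ (dps_summable c Hc) r Hr).
  exists (Series (fun n => Cmod (dps (dps c) n) * r ^ n)). split.
  { apply Series_nonneg; [|exact H2]. intros n.
    apply Rmult_le_pos; [apply Cmod_ge_0 | apply pow_le; lra]. }
  intros z w Hz Hw.
  assert (Hz1 : Cmod z < 1) by lra. assert (Hw1 : Cmod w < 1) by lra.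
  pose proof (PS_correct c z Hc Hz1) as Sz. pose proof (PS_correct c w Hc Hw1) as Sw.
  pose proof (PS_correct _ z (dps_summable c Hc) Hz1) as Sd.
  assert (S1 : is_Cseries (fun n => c (S n) * w ^ (S n) - c (S n) * z ^ (S n)
       - dps c n * z ^ n * (w - z))%C
       (PS c w - c O - (PS c z - c O) - PS (dps c) z * (w - z))%C).
  { apply (is_Cseries_tail _ _ 0) in Sz. apply (is_Cseries_tail _ _ 0) in Sw.
    rewrite sum_O in Sz, Sw.
    replace (c 0%nat * z ^ 0)%C with (c O) in Sz by (simpl; ring).
    replace (c 0%nat * w ^ 0)%C with (c O) in Sw by (simpl; ring).
    apply (@is_series_scal C_AbsRing C_NormedModule (w - z)%C) in Sd.
    pose proof (is_series_minus _ _ _ _ (is_series_minus _ _ _ _ Sw Sz) Sd) as Sm.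
    replace (PS c w - c 0%nat - (PS c z - c 0%nat) - PS (dps c) z * (w - z))%C
      with (PS c w - c 0%nat - (PS c z - c 0%nat) - (w - z) * PS (dps c) z)%C by ring.
    eapply is_series_ext; [|exact Sm]. intros n.
    change ((c (1 + n)%nat * w ^ (1 + n) - c (1 + n)%nat * z ^ (1 + n)
             - (w - z) * (dps c n * z ^ n))%C
            = (c (S n) * w ^ S n - c (S n) * z ^ S n - dps c n * z ^ n * (w - z))%C).
    change (1 + n)%nat with (S n). ring. }
  apply (is_Cseries_tail _ _ 0) in S1. rewrite sum_O in S1.
  replace (PS c w - PS c z - PS (dps c) z * (w - z))%C with
    (PS c w - c 0%nat - (PS c z - c 0%nat) - PS (dps c) z * (w - z) -
        (c 1%nat * w ^ 1 - c 1%nat * z ^ 1 - dps c 0 * z ^ 0 * (w - z)))%C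
    by (unfold dps; simpl; ring).
  eapply Rle_trans.
  - eapply Cseries_le; [exact S1| |].
    + intros n.
      instantiate (1 := fun n => Cmod (w - z) ^ 2 * (Cmod (dps (dps c) n) * r ^ n)).
      cbv beta. change (1 + n)%nat with (S n).
      replace (c (S (S n)) * w ^ S (S n) - c (S (S n)) * z ^ S (S n) - dps c (S n) * z ^ S n * (w - z))%C
       with (c (S (S n)) * (w ^ (n + 2) - z ^ (n + 2) - RtoC (INR (n + 2)) * z ^ (n + 1) * (w - z)))%C.
      * rewrite Cmod_mult.
        pose proof (Cpow_taylor z w r n Hz Hw) as Ht.
        unfold dps. rewrite !Cmod_mult, !Cmod_R, !(Rabs_pos_eq (INR _)) by apply pos_INR.
        replace (n + 2)%nat with (S (S n)) in * by lia.
        replace (n + 1)%nat with (S n) in * by lia.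
        apply (Rmult_le_compat_l _ _ _ (Cmod_ge_0 (c (S (S n))))) in Ht.
        eapply Rle_trans; [exact Ht|]. right. ring.
      * unfold dps. replace (n + 2)%nat with (S (S n)) by lia.
        replace (n + 1)%nat with (S n) by lia. ring.
    + apply (@ex_series_scal R_AbsRing R_NormedModule). exact H2.
  - rewrite Series_scal_l. right. ring.
Qed.

Lemma is_derive_of_quadratic {K : AbsRing} {V : NormedModule K}
    (f : K -> V) (x : K) (l : V) (delta M : R) :
  0 < delta -> 0 <= M ->
  (forall y : K, abs (minus y x) < delta ->
     norm (minus (minus (f y) (f x)) (scal (minus y x) l)) <= M * abs (minus y x) ^ 2) ->
  is_derive f x l.
Proof.
  intros Hd HM H. split; [apply is_linear_scal_l|].
  intros x' Hx'.
  apply (@is_filter_lim_locally_unique K (AbsRing_NormedModule K)) in Hx'. subst x'.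
  intros eps.
  assert (Hm : 0 < Rmin delta (eps / (M + 1))).
  { apply Rmin_pos; [exact Hd|]. apply Rdiv_lt_0_compat; [apply cond_pos|lra]. }
  exists (mkposreal _ Hm). intros y Hy.
  assert (Hy' : abs (minus y x) < Rmin delta (eps / (M + 1))) by exact Hy.
  pose proof (Rmin_l delta (eps / (M + 1))). pose proof (Rmin_r delta (eps / (M + 1))).
  eapply Rle_trans; [apply H; lra|].
  change (norm (minus y x)) with (abs (minus y x)).
  pose proof (abs_ge_0 (minus y x)) as Habs.
  simpl pow. rewrite Rmult_1_r, <- Rmult_assoc.
  apply Rmult_le_compat_r; [exact Habs|].
  assert (Hq : abs (minus y x) * (M + 1) < eps).
  { apply Rmult_lt_reg_r with (/ (M + 1)); [apply Rinv_0_lt_compat; lra|].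
    rewrite Rmult_assoc, Rinv_r by lra. rewrite Rmult_1_r. unfold Rdiv in *. lra. }
  nra.
Qed.

Lemma ball_in_disk (z : C) : in_disk z -> forall w, Cmod (w - z) < (1 - Cmod z) / 2 ->
  Cmod w <= (1 + Cmod z) / 2.
Proof.
  intros Hz w Hw. replace w with ((w - z) + z)%C by ring.
  eapply Rle_trans; [apply Cmod_triangle|]. lra.
Qed.

Lemma PS_is_derive (c : nat -> C) (f : C -> C) (z : C) :
  summable c -> (forall w, in_disk w -> f w = PS c w) -> in_disk z ->
  @is_derive C_AbsRing C_NormedModule f z (PS (dps c) z).
Proof.
  intros Hc Hf Hz. unfold in_disk in *. pose proof (Cmod_ge_0 z).
  destruct (PS_taylor c ((1 + Cmod z) / 2) Hc ltac:(lra)) as [K [HK HT]].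
  apply is_derive_of_quadratic with (delta := (1 - Cmod z) / 2) (M := K); [lra|exact HK|].
  intros w Hw.
  assert (Hw1 : Cmod w <= (1 + Cmod z) / 2) by (now apply ball_in_disk).
  change (Cmod (f w - f z - (w - z) * PS (dps c) z) <= K * Cmod (w - z) ^ 2).
  rewrite !Hf by lra. rewrite (Cmult_comm (w - z)). apply HT; lra.
Qed.

(** Real derivatives along segments are all that the growth and monotonicity estimates need;
    the factor [k] selects a real component. *)
Lemma PS_derive_line (c : nat -> C) (w d k : C) (s : R) :
  summable c -> in_disk (w + RtoC s * d)%C ->
  is_derive (fun t : R => Re (k * PS c (w + RtoC t * d))) s
    (Re (k * (PS (dps c) (w + RtoC s * d) * d))).
Proof.
  intros Hc Hz. set (z := (w + RtoC s * d)%C) in *.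
  unfold in_disk in *. pose proof (Cmod_ge_0 z).
  destruct (PS_taylor c ((1 + Cmod z) / 2) Hc ltac:(lra)) as [K [HK HT]].
  pose proof (Cmod_ge_0 d) as Hd. pose proof (Cmod_ge_0 k) as Hk.
  apply (@is_derive_of_quadratic R_AbsRing R_NormedModule) with
    (delta := (1 - Cmod z) / 2 / (Cmod d + 1)) (M := Cmod k * K * Cmod d ^ 2).
  - apply Rdiv_lt_0_compat; lra.
  - apply Rmult_le_pos; [now apply Rmult_le_pos | apply pow2_ge_0].
  - intros t Ht.
    assert (Ht' : Rabs (t - s) < (1 - Cmod z) / 2 / (Cmod d + 1)) by exact Ht.
    clear Ht. set (v := (w + RtoC t * d)%C).
    assert (Ev : (v - z)%C = (RtoC (t - s) * d)%C)
      by (unfold v, z; rewrite RtoC_minus; ring).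
    assert (Cv : Cmod (v - z) = Rabs (t - s) * Cmod d)
      by (rewrite Ev, Cmod_mult, Cmod_R; reflexivity).
    assert (Hv : Cmod v <= (1 + Cmod z) / 2).
    { apply ball_in_disk; [unfold in_disk; lra|]. rewrite Cv.
      assert (Rabs (t - s) * (Cmod d + 1) < (1 - Cmod z) / 2).
      { apply Rmult_lt_reg_r with (/ (Cmod d + 1)); [apply Rinv_0_lt_compat; lra|].
        rewrite Rmult_assoc, Rinv_r by lra. unfold Rdiv in *. lra. }
      pose proof (Rabs_pos (t - s)). lra. }
    specialize (HT z v ltac:(lra) Hv).
    change (Rabs (Re (k * PS c v) - Re (k * PS c z)
       - (t - s) * Re (k * (PS (dps c) z * d))) <= Cmod k * K * Cmod d ^ 2 * Rabs (t - s) ^ 2).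
    replace (Re (k * PS c v) - Re (k * PS c z) - (t - s) * Re (k * (PS (dps c) z * d)))
      with (Re (k * (PS c v - PS c z - PS (dps c) z * (v - z)))%C).
    + eapply Rle_trans; [apply re_le_Cmod|]. rewrite Cmod_mult.
      apply Rmult_le_compat_l with (r := Cmod k) in HT; [|exact Hk].
      eapply Rle_trans; [exact HT|]. rewrite Cv. right. ring.
    + rewrite Ev, <- re_scal_l, <- !re_minus. f_equal. ring.
Qed.

Lemma PS_lipschitz (c : nat -> C) (r : R) :
  summable c -> 0 <= r < 1 -> exists K, 0 < K /\ forall z w, Cmod z <= r -> Cmod w <= r ->
  Cmod (PS c w - PS c z) <= K * Cmod (w - z).
Proof.
  intros Hc Hr.
  destruct (PS_taylor c r Hc Hr) as [K [HK HT]].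
  set (D := Series (fun n => Cmod (dps c n) * r ^ n)).
  assert (HD : 0 <= D).
  { apply Series_nonneg; [|now apply dps_summable].
    intros n. apply Rmult_le_pos; [apply Cmod_ge_0 | apply pow_le; lra]. }
  exists (2 * K + D + 1). split; [lra|].
  intros z w Hz Hw. specialize (HT z w Hz Hw).
  assert (Hd : Cmod (PS (dps c) z) <= D).
  { apply (Cseries_le (fun n => dps c n * z ^ n)%C).
    - apply PS_correct; [now apply dps_summable | unfold in_disk; lra].
    - intros n. rewrite Cmod_mult, Cmod_pow. apply Rmult_le_compat_l; [apply Cmod_ge_0|].
      apply pow_incr. split; [apply Cmod_ge_0 | exact Hz].
    - now apply dps_summable. }
  assert (H2 : Cmod (w - z) <= 2).
  { eapply Rle_trans; [apply Cmod_triangle|]. rewrite Cmod_opp. lra. }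
  replace (PS c w - PS c z)%C with
    ((PS c w - PS c z - PS (dps c) z * (w - z)) + PS (dps c) z * (w - z))%C by ring.
  eapply Rle_trans; [apply Cmod_triangle|]. rewrite Cmod_mult.
  set (m := Cmod (w - z)) in *.
  assert (Hm : 0 <= m) by apply Cmod_ge_0.
  assert (K * m ^ 2 <= K * (2 * m)) by (apply Rmult_le_compat_l; nra).
  assert (Cmod (PS (dps c) z) * m <= D * m) by (now apply Rmult_le_compat_r).
  lra.
Qed.

Lemma PS_0 (c : nat -> C) : PS c 0 = c O.
Proof.
  apply PS_unique. unfold is_series.
  apply filterlim_ext with (fun _ => c O); [|apply filterlim_const].
  intros n. symmetry. change (Csum (fun k => c k * RtoC 0 ^ k)%C n = c O).
  induction n as [|n IH].
  - rewrite sum_O. exact (Cmult_1_r (c O)).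
  - rewrite Csum_Sn, IH, Cpow_S.
    assert (E : forall a b p : C, (a + b * (RtoC 0 * p) = a)%C) by (intros; ring).
    apply E.
Qed.

Lemma PS_plus_scal (c d : nat -> C) (e z : C) :
  summable c -> summable d -> in_disk z ->
  PS (fun n => c n + e * d n)%C z = (PS c z + e * PS d z)%C.
Proof.
  intros Hc Hd Hz. apply PS_unique.
  pose proof (PS_correct c z Hc Hz) as Sc.
  pose proof (PS_correct d z Hd Hz) as Sd.
  apply (@is_series_scal C_AbsRing C_NormedModule e) in Sd.
  pose proof (is_series_plus _ _ _ _ Sc Sd) as Sm.
  eapply is_series_ext; [|exact Sm]. intros n.
  change ((c n * z ^ n + e * (d n * z ^ n))%C = ((c n + e * d n) * z ^ n)%C). ring.
Qed.

Lemma summable_plus_scal (c d : nat -> C) (e : C) :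
  summable c -> summable d -> summable (fun n => c n + e * d n)%C.
Proof.
  intros Hc Hd r Hr.
  apply (@ex_series_le R_AbsRing R_CompleteNormedModule) with
    (b := fun n => Cmod (c n) * r ^ n + Cmod e * (Cmod (d n) * r ^ n)).
  - intros n. change (Rabs (Cmod (c n + e * d n) * r ^ n)
      <= Cmod (c n) * r ^ n + Cmod e * (Cmod (d n) * r ^ n)).
    assert (0 <= r ^ n) by (apply pow_le; lra).
    rewrite Rabs_pos_eq by (apply Rmult_le_pos; [apply Cmod_ge_0|assumption]).
    pose proof (Cmod_triangle (c n) (e * d n)) as Ht. rewrite Cmod_mult in Ht. nra.
  - apply (@ex_series_plus R_AbsRing R_NormedModule); [now apply Hc|].
    apply (@ex_series_scal R_AbsRing R_NormedModule). now apply Hd.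
Qed.

(** * Means over the circle *)

(** The angle is measured from the imaginary axis, so that the substitution [x = r sin t]
    used for area integrals lands on this parametrization. *)
Definition circ (t : R) : C := (sin t, cos t).

Definition is_mean (F : R -> R) (v : R) : Prop :=
  is_RInt F (- (PI / 2)) (3 * (PI / 2)) (2 * PI * v).

Lemma C_inj (a b : C) : Re a = Re b -> Im a = Im b -> a = b.
Proof. destruct a, b; simpl; intros; congruence. Qed.

(* In a normed module the carrier is hidden behind a projection that [ring] does not unfold. *)
Ltac asC := match goal with |- @eq _ ?a ?b => change (@eq C a b) end.
Ltac asR := match goal with |- @eq _ ?a ?b => change (@eq R a b) end.

Ltac Ccomp := apply C_inj; simpl; try ring.

Lemma circ_conj (t : R) : (circ t * Cconj (circ t))%C = RtoC 1.
Proof.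
  pose proof (sin2_cos2 t) as H. unfold Rsqr in H.
  Ccomp; nra.
Qed.

Lemma circ_Cmod (t : R) : Cmod (circ t) = 1.
Proof.
  unfold Cmod, circ. simpl fst; simpl snd.
  pose proof (sin2_cos2 t) as H. unfold Rsqr in H.
  replace (sin t ^ 2 + cos t ^ 2) with 1 by (simpl; lra). apply sqrt_1.
Qed.

(** [circ] is [i exp (- i t)], so multiplying by it, or by its conjugate, adds [-1], or [1],
    to the frequency; [sg] distinguishes the two cases. *)
Lemma circ_mul_derive (sg : R) (u E : R -> C) (n : R) :
  sg = 1 \/ sg = -1 -> (forall s, u s = (sin s, sg * cos s)) ->
  (forall w t, is_derive (fun s => Re (w * E s)) t (Re (Ci * RtoC n * (w * E t)))) ->
  forall w t, is_derive (fun s => Re (w * (u s * E s))) t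
                (Re (Ci * RtoC (n - sg) * (w * (u t * E t)))).
Proof.
  intros Hsg Hu H w t. set (w' := (RtoC sg * Ci * w)%C).
  apply is_derive_ext with (fun s => sin s * Re (w * E s) + cos s * Re (w' * E s)).
  { intros s. unfold w'. rewrite Hu. destruct w, (E s). simpl. ring. }
  rewrite Hu. evar_last.
  - apply (is_derive_plus (fun s => sin s * Re (w * E s)) (fun s => cos s * Re (w' * E s))).
    + apply (is_derive_mult sin (fun s => Re (w * E s)));
        [apply is_derive_Reals, derivable_pt_lim_sin | apply H | intros; apply Rmult_comm].
    + apply (is_derive_mult cos (fun s => Re (w' * E s)));
        [apply is_derive_Reals, derivable_pt_lim_cos | apply H | intros; apply Rmult_comm].
  - unfold plus, mult, w'; simpl. destruct w, (E t). simpl.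
    destruct Hsg as [-> | ->]; ring.
Qed.

Lemma circ_monomial_derive (j k : nat) (w : C) (t : R) :
  is_derive (fun s => Re (w * (circ s ^ j * Cconj (circ s) ^ k))) t
    (Re (Ci * RtoC (INR k - INR j) * (w * (circ t ^ j * Cconj (circ t) ^ k)))).
Proof.
  revert w t. induction j as [|j IH].
  - induction k as [|k IH]; intros w t.
    + apply is_derive_ext with (fun _ => Re (w * (1 * 1))); [reflexivity|].
      evar_last; [apply is_derive_const|].
      change (0 = Re (Ci * RtoC (0 - 0) * (w * (1 * 1)))).
      destruct w; simpl; ring.
    + apply is_derive_ext with (fun s => Re (w * (Cconj (circ s) * (circ s ^ 0 * Cconj (circ s) ^ k)))).
      { intros s. f_equal. rewrite !Cpow_S. ring. }
      evar_last.
      { apply (circ_mul_derive (-1) (fun s => Cconj (circ s))); [now right | | apply IH].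
        intros s. unfold circ. Ccomp. }
      f_equal. rewrite S_INR. rewrite !Cpow_S.
      replace (INR k + 1 - INR 0) with (INR k - INR 0 - -1) by ring. ring.
  - intros w t.
    apply is_derive_ext with (fun s => Re (w * (circ s * (circ s ^ j * Cconj (circ s) ^ k)))).
    { intros s. f_equal. rewrite !Cpow_S. ring. }
    evar_last.
    { apply (circ_mul_derive 1 circ); [now left | | apply IH].
      intros s. unfold circ. Ccomp. }
    f_equal. rewrite S_INR. rewrite !Cpow_S.
    replace (INR k - (INR j + 1)) with (INR k - INR j - 1) by ring. ring.
Qed.

(** Off the diagonal the integrand is the derivative of a periodic function. *)
Lemma circ_monomial_mean (j k : nat) (w : C) :
  is_mean (fun t => Re (w * (circ t ^ j * Cconj (circ t) ^ k)))
          (if Nat.eq_dec j k then Re w else 0).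
Proof.
  unfold is_mean. destruct (Nat.eq_dec j k) as [->|Hjk].
  - apply is_RInt_ext with (fun _ => Re w).
    { intros t _. rewrite <- Cpow_mult_l, circ_conj, Cpow_1_l. f_equal. ring. }
    evar_last; [apply (@is_RInt_const R_NormedModule)|].
    change ((3 * (PI / 2) - - (PI / 2)) * Re w = 2 * PI * Re w). field.
  - set (m := INR k - INR j).
    assert (Hm : m <> 0).
    { unfold m. intros H. apply Hjk. apply INR_eq. lra. }
    set (w' := (w * / (Ci * RtoC m))%C).
    assert (Hi : RtoC m <> 0) by (intros H; apply Hm; now apply RtoC_inj).
    assert (Ew : (Ci * RtoC m * w')%C = w) by (unfold w'; field; split; [exact Hi | apply Ci_nz]).
    apply is_RInt_ext with (fun t => Re (Ci * RtoC m * (w' * (circ t ^ j * Cconj (circ t) ^ k)))).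
    { intros t _. f_equal. rewrite Cmult_assoc, Ew. reflexivity. }
    evar_last.
    + apply is_RInt_derive with (f := fun t => Re (w' * (circ t ^ j * Cconj (circ t) ^ k))).
      * intros t _. apply circ_monomial_derive.
      * intros t _. apply (ex_derive_continuous (K := R_AbsRing) (V := R_NormedModule)).
        eexists.
        eapply is_derive_ext; [|apply (circ_monomial_derive j k (Ci * RtoC m * w')%C)].
        intros s. cbv beta. f_equal. ring.
    + assert (Ec : circ (3 * (PI / 2)) = circ (- (PI / 2))).
      { unfold circ. rewrite sin_3PI2, cos_3PI2, sin_neg, cos_neg, sin_PI2, cos_PI2. reflexivity. }
      rewrite Ec. rewrite minus_eq_zero. change (0 = 2 * PI * 0). ring.
Qed.

(** * Area integrals of polynomials *)

(** The span of the monomials of degree [d]: area integrals of such polynomials separate into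
    a radial and an angular factor ([homog_disk]). *)
Inductive homog : nat -> (R -> R -> R) -> Prop :=
| homog_mono (a b : nat) : homog (a + b) (fun x y => x ^ a * y ^ b)
| homog_plus (d : nat) (F G : R -> R -> R) :
    homog d F -> homog d G -> homog d (fun x y => F x y + G x y)
| homog_scal (d : nat) (k : R) (F : R -> R -> R) :
    homog d F -> homog d (fun x y => k * F x y).

Lemma homog_ext (d d' : nat) (F G : R -> R -> R) :
  homog d F -> d = d' -> (forall x y, F x y = G x y) -> homog d' G.
Proof.
  intros H <- Hx. replace G with F; [exact H|].
  extensionality x. extensionality y. apply Hx.
Qed.

Lemma homog_mul_x (d : nat) (F : R -> R -> R) :
  homog d F -> homog (S d) (fun x y => x * F x y).
Proof.
  induction 1 as [a b|d F G _ IHF _ IHG|d k F _ IH].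
  - apply (homog_ext (S a + b) _ _ _ (homog_mono (S a) b)); [lia|].
    intros; simpl; ring.
  - eapply homog_ext; [exact (homog_plus _ _ _ IHF IHG)|reflexivity|intros; simpl; ring].
  - eapply homog_ext; [exact (homog_scal _ k _ IH)|reflexivity|intros; simpl; ring].
Qed.

Lemma homog_mul_y (d : nat) (F : R -> R -> R) :
  homog d F -> homog (S d) (fun x y => y * F x y).
Proof.
  induction 1 as [a b|d F G _ IHF _ IHG|d k F _ IH].
  - apply (homog_ext (a + S b) _ _ _ (homog_mono a (S b))); [lia|].
    intros; simpl; ring.
  - eapply homog_ext; [exact (homog_plus _ _ _ IHF IHG)|reflexivity|intros; simpl; ring].
  - eapply homog_ext; [exact (homog_scal _ k _ IH)|reflexivity|intros; simpl; ring].
Qed.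

Lemma homog_cmonomial (j k : nat) (w : C) :
  homog (j + k) (fun x y => Re (w * ((x, y) ^ j * Cconj (x, y) ^ k))).
Proof.
  revert w. induction j as [|j IH].
  - induction k as [|k IH]; intros w.
    + eapply homog_ext; [exact (homog_scal _ (Re w) _ (homog_mono 0 0))|reflexivity|].
      intros x y. destruct w; simpl. ring.
    + eapply homog_ext; [exact (homog_plus _ _ _ (homog_mul_x _ _ (IH w)) (homog_mul_y _ _ (IH ((- Ci) * w)%C)))|reflexivity|].
      intros x y. cbv beta. rewrite (Cpow_S _ k).
      set (E := (Cconj (x, y) ^ k)%C). set (E' := ((x,y)^0)%C).
      destruct w, E, E'. simpl. ring.
  - intros w.
    eapply homog_ext; [exact (homog_plus _ _ _ (homog_mul_x _ _ (IH w)) (homog_mul_y _ _ (IH (Ci * w)%C)))|reflexivity|].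
    intros x y. cbv beta. rewrite (Cpow_S _ j).
    set (E := (Cconj (x, y) ^ k)%C). set (E' := ((x,y)^j)%C).
    destruct w, E, E'. simpl. ring.
Qed.

(** Half the length of the vertical chord at [x], and [0] when [|x| >= r]. *)
Definition chord (r x : R) : R := sqrt (r ^ 2 - x ^ 2).

(** An iterated integral as a relation, which keeps integrability of the sections.  Sections
    are taken at every real [x]; those outside the disk are integrals over a point. *)
Definition is_disk_int (r : R) (F : R -> R -> R) (v : R) : Prop :=
  (forall x, ex_RInt (F x) (- chord r x) (chord r x)) /\
  is_RInt (fun x => RInt (F x) (- chord r x) (chord r x)) (- r) r v.

Lemma is_disk_int_plus (r : R) (F G : R -> R -> R) (v w : R) :
  is_disk_int r F v -> is_disk_int r G w ->
  is_disk_int r (fun x y => F x y + G x y) (v + w).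
Proof.
  intros [HF1 HF2] [HG1 HG2]. split.
  - intros x. apply (ex_RInt_plus (V := R_NormedModule)); auto.
  - eapply is_RInt_ext; [|apply (is_RInt_plus (V := R_NormedModule)); [exact HF2|exact HG2]].
    intros x _. symmetry. apply (RInt_plus (V := R_CompleteNormedModule)); auto.
Qed.

Lemma is_disk_int_scal (r k : R) (F : R -> R -> R) (v : R) :
  is_disk_int r F v -> is_disk_int r (fun x y => k * F x y) (k * v).
Proof.
  intros [HF1 HF2]. split.
  - intros x. apply (ex_RInt_scal (V := R_NormedModule)); auto.
  - eapply is_RInt_ext; [|apply (is_RInt_scal (V := R_NormedModule)); exact HF2].
    intros x _. symmetry. apply (RInt_scal (V := R_CompleteNormedModule)); auto.
Qed.

Lemma is_disk_int_ext (r : R) (F G : R -> R -> R) (v : R) :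
  (forall x y, F x y = G x y) -> is_disk_int r F v -> is_disk_int r G v.
Proof.
  intros H. replace G with F; [auto|].
  extensionality x. extensionality y. apply H.
Qed.

Definition wallis (a b : nat) : R := RInt (fun t => sin t ^ a * cos t ^ b) (- (PI / 2)) (PI / 2).

Lemma continuous_sin_cos (a b : nat) (t : R) : continuous (fun t => sin t ^ a * cos t ^ b) t.
Proof. apply (ex_derive_continuous (K := R_AbsRing) (V := R_NormedModule)). now auto_derive. Qed.

Lemma wallis_correct (a b : nat) :
  is_RInt (fun t => sin t ^ a * cos t ^ b) (- (PI / 2)) (PI / 2) (wallis a b).
Proof.
  apply (RInt_correct (V := R_CompleteNormedModule)).
  apply (ex_RInt_continuous (V := R_CompleteNormedModule)).
  intros; apply continuous_sin_cos.
Qed.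

(** Integration of the derivative of [sin^(a+1) cos^(b+1)], which vanishes at both ends. *)
Lemma wallis_rec (a b : nat) : INR (a + b + 2) * wallis a (b + 2) = INR (b + 1) * wallis a b.
Proof.
  apply Rminus_diag_uniq.
  assert (H1 : is_RInt (fun t => INR (a + b + 2) * (sin t ^ a * cos t ^ (b + 2))
      - INR (b + 1) * (sin t ^ a * cos t ^ b)) (- (PI / 2)) (PI / 2)
      (INR (a + b + 2) * wallis a (b + 2) - INR (b + 1) * wallis a b)).
  { apply (is_RInt_minus (V := R_NormedModule)); apply (is_RInt_scal (V := R_NormedModule)); apply wallis_correct. }
  assert (H2 : is_RInt (fun t => INR (a + b + 2) * (sin t ^ a * cos t ^ (b + 2))
      - INR (b + 1) * (sin t ^ a * cos t ^ b)) (- (PI / 2)) (PI / 2) 0).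
  { evar_last.
    - apply (is_RInt_derive (V := R_CompleteNormedModule)) with (f := fun t => sin t ^ (a + 1) * cos t ^ (b + 1)).
      + intros t _. auto_derive; [trivial|].
        pose proof (sin2_cos2 t) as H. unfold Rsqr in H.
        rewrite !Nat.add_1_r. simpl pred.
        replace (a + b + 2)%nat with (S (a + S b)) by lia.
        rewrite !S_INR, plus_INR, !S_INR.
        replace (b + 2)%nat with (S (S b)) by lia. simpl pow.
        apply Rminus_diag_uniq.
        transitivity ((INR b + 1) * sin t ^ a * cos t ^ b * (1 - (sin t * sin t + cos t * cos t)));
          [ring | rewrite H; ring].
      + intros t _. apply (ex_derive_continuous (K := R_AbsRing) (V := R_NormedModule)). now auto_derive.
    - rewrite cos_neg, cos_PI2, !(Nat.add_1_r b).
      change (sin (PI / 2) ^ (a + 1) * 0 ^ S b - sin (- (PI / 2)) ^ (a + 1) * 0 ^ S b = 0). simpl. ring. }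
  apply (is_RInt_unique (V := R_CompleteNormedModule)) in H1. apply (is_RInt_unique (V := R_CompleteNormedModule)) in H2.
  rewrite <- H1. exact H2.
Qed.

Lemma mono_circle (a b : nat) :
  is_RInt (fun t => sin t ^ a * cos t ^ b) (- (PI / 2)) (3 * (PI / 2)) ((1 + (-1) ^ b) * wallis a b).
Proof.
  rewrite Rmult_plus_distr_r, Rmult_1_l.
  apply (is_RInt_Chasles (V := R_NormedModule)) with (PI / 2); [apply wallis_correct|].
  (* the second half of the circle is the image of the first under [t -> PI - t] *)
  apply is_RInt_ext with (fun t => scal (-1) ((- (-1) ^ b) * (sin (-1 * t + PI) ^ a * cos (-1 * t + PI) ^ b))).
  { intros t _. replace (-1 * t + PI) with (PI - t) by ring.
    rewrite sin_PI_x. replace (cos (PI - t)) with ((-1) * cos t) by (rewrite cos_minus, cos_PI, sin_PI; ring).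
    rewrite Rpow_mult_distr. unfold scal; simpl; unfold mult; simpl.
    replace (- (-1) ^ b * (sin t ^ a * ((-1) ^ b * cos t ^ b))) with (- ((-1) ^ b * (-1) ^ b) * (sin t ^ a * cos t ^ b)) by ring.
    rewrite <- Rpow_mult_distr. replace (-1 * -1) with 1 by ring. rewrite pow1. ring. }
  apply (is_RInt_comp_lin (V := R_NormedModule) (fun t => - (-1) ^ b * (sin t ^ a * cos t ^ b))).
  replace (-1 * (PI / 2) + PI) with (PI / 2) by field.
  replace (-1 * (3 * (PI / 2)) + PI) with (- (PI / 2)) by field.
  evar_last.
  - apply (is_RInt_scal (V := R_NormedModule)).
    apply (is_RInt_swap (V := R_NormedModule)). apply wallis_correct.
  - unfold scal, opp; simpl; unfold mult; simpl. ring.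
Qed.

Lemma chord_sin (r t : R) : 0 <= r -> - (PI / 2) <= t <= PI / 2 ->
  chord r (r * sin t) = r * cos t.
Proof.
  intros Hr Ht. unfold chord.
  pose proof (sin2_cos2 t) as H. unfold Rsqr in H.
  replace (r ^ 2 - (r * sin t) ^ 2) with ((r * cos t) * (r * cos t)).
  - apply sqrt_square. apply Rmult_le_pos; [exact Hr|]. apply cos_ge_0; lra.
  - replace (sin t * sin t) with (1 - cos t * cos t) in H by lra.
    simpl. replace (r * sin t * (r * sin t * 1)) with (r * r * (sin t * sin t)) by ring.
    pose proof (sin2_cos2 t) as H'. unfold Rsqr in H'.
    replace (sin t * sin t) with (1 - cos t * cos t) by lra. ring.
Qed.

Lemma RInt_mono (a b : nat) (x s : R) :
  is_RInt (fun y => x ^ a * y ^ b) (- s) s (x ^ a * (1 - (-1) ^ S b) * s ^ S b / INR (S b)).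
Proof.
  assert (Hb : INR (S b) <> 0) by (apply not_0_INR; lia).
  evar_last.
  - apply (is_RInt_derive (V := R_CompleteNormedModule)) with (f := fun y => x ^ a * (y ^ S b / INR (S b))).
    + intros y _. auto_derive; [trivial|]. change (pred (S b)) with b.
      change (match b with O => 1 | S _ => INR b + 1 end) with (INR (S b)). field. exact Hb.
    + intros y _. apply (ex_derive_continuous (K := R_AbsRing) (V := R_NormedModule)). now auto_derive.
  - change (x ^ a * (s ^ S b / INR (S b)) - x ^ a * ((- s) ^ S b / INR (S b))
      = x ^ a * (1 - (-1) ^ S b) * s ^ S b / INR (S b)).
    replace (- s) with (-1 * s) by ring. rewrite Rpow_mult_distr. field. exact Hb.
Qed.

Lemma continuous_chord (r x : R) : continuous (chord r) x.
Proof.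
  unfold chord. apply continuous_comp; [|apply continuous_sqrt].
  apply (ex_derive_continuous (K := R_AbsRing) (V := R_NormedModule)). now auto_derive.
Qed.

Lemma continuous_Rpow (f : R -> R) (n : nat) (x : R) :
  continuous f x -> continuous (fun y => f y ^ n) x.
Proof.
  intros H. apply (continuous_comp f (fun y => y ^ n)); [exact H|].
  apply (ex_derive_continuous (K := R_AbsRing) (V := R_NormedModule)). now auto_derive.
Qed.

(** The section is [x^a] times a power of the chord; [x = r sin t] turns it into a Wallis
    integral of exponents [a] and [b + 2], and [wallis_rec] relates that to the circle. *)
Lemma mono_disk (a b : nat) (r : R) : 0 <= r ->
  is_disk_int r (fun x y => x ^ a * y ^ b)
    (r ^ (a + b + 2) / INR (a + b + 2) * ((1 + (-1) ^ b) * wallis a b)).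
Proof.
  intros Hr.
  set (f := fun x => x ^ a * (1 - (-1) ^ S b) * chord r x ^ S b / INR (S b)).
  assert (Hb : INR (S b) <> 0) by (apply not_0_INR; lia).
  split.
  { intros x. eexists. apply RInt_mono. }
  apply is_RInt_ext with f.
  { intros x _. symmetry. apply (is_RInt_unique (V := R_CompleteNormedModule)). apply RInt_mono. }
  assert (Hc : forall x, continuous f x).
  { intros x. unfold f, Rdiv.
    apply (continuous_mult (K := R_AbsRing)); [|apply continuous_const].
    apply (continuous_mult (K := R_AbsRing)).
    - apply (continuous_mult (K := R_AbsRing)); [|apply continuous_const].
      apply (continuous_Rpow (fun x => x)). apply continuous_id.
    - apply continuous_Rpow. apply continuous_chord. }
  assert (Hex : ex_RInt f (- r) r)
    by (apply (ex_RInt_continuous (V := R_CompleteNormedModule)); auto).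
  replace (r ^ (a + b + 2) / INR (a + b + 2) * ((1 + (-1) ^ b) * wallis a b)) with (RInt f (- r) r);
    [now apply (RInt_correct (V := R_CompleteNormedModule))|].
  assert (H1 : is_RInt (fun t => scal (r * cos t) (f (r * sin t))) (- (PI / 2)) (PI / 2)
      (RInt f (r * sin (- (PI / 2))) (r * sin (PI / 2)))).
  { apply (is_RInt_comp (V := R_CompleteNormedModule) f (fun t => r * sin t)); [auto|].
    intros t _. split; [auto_derive; [trivial|now rewrite Rmult_1_l]|].
    apply (ex_derive_continuous (K := R_AbsRing) (V := R_NormedModule)). now auto_derive. }
  rewrite sin_neg, sin_PI2 in H1.
  replace (r * - (1)) with (- r) in H1 by ring. replace (r * 1) with r in H1 by ring.
  assert (H2 : is_RInt (fun t => scal (r * cos t) (f (r * sin t))) (- (PI / 2)) (PI / 2)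
      (r ^ (a + b + 2) * (1 + (-1) ^ b) / INR (S b) * wallis a (b + 2))).
  { apply is_RInt_ext with (fun t => (r ^ (a + b + 2) * (1 + (-1) ^ b) / INR (S b)) * (sin t ^ a * cos t ^ (b + 2))).
    - intros t Ht. pose proof PI_RGT_0.
      rewrite Rmin_left, Rmax_right in Ht by lra.
      change (r ^ (a + b + 2) * (1 + (-1) ^ b) / INR (S b) * (sin t ^ a * cos t ^ (b + 2))
        = r * cos t * f (r * sin t)).
      unfold f.
      rewrite chord_sin by lra.
      rewrite !Rpow_mult_distr, !pow_add. simpl pow. unfold Rdiv. ring.
    - apply (is_RInt_scal (V := R_NormedModule)). apply wallis_correct. }
  apply (is_RInt_unique (V := R_CompleteNormedModule)) in H1. apply (is_RInt_unique (V := R_CompleteNormedModule)) in H2.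
  rewrite <- H1, H2.
  pose proof (wallis_rec a b) as Hw.
  assert (Hab : INR (a + b + 2) <> 0) by (apply not_0_INR; lia).
  replace (wallis a (b + 2)) with (INR (b + 1) * wallis a b / INR (a + b + 2))
    by (rewrite <- Hw; field; exact Hab).
  rewrite Nat.add_1_r. asR. field. split; assumption.
Qed.

(** Integration in polar coordinates.  It suffices to treat monomials, where no change of
    variables in the plane is needed. *)
Lemma homog_disk (d : nat) (F : R -> R -> R) (v r : R) :
  homog d F -> 0 <= r ->
  is_RInt (fun t => F (sin t) (cos t)) (- (PI / 2)) (3 * (PI / 2)) v ->
  is_disk_int r F (r ^ (d + 2) / INR (d + 2) * v).
Proof.
  intros HF Hr Hv.
  assert (H : exists v', is_RInt (fun t => F (sin t) (cos t)) (- (PI / 2)) (3 * (PI / 2)) v'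
             /\ is_disk_int r F (r ^ (d + 2) / INR (d + 2) * v')).
  { clear Hv. induction HF as [a b|d F G _ [v1 [H1 D1]] _ [v2 [H2 D2]]|d k F _ [v1 [H1 D1]]].
    - exists ((1 + (-1) ^ b) * wallis a b). split; [apply mono_circle | now apply mono_disk].
    - exists (v1 + v2). split; [now apply (is_RInt_plus (V := R_NormedModule))|].
      rewrite Rmult_plus_distr_l. now apply is_disk_int_plus.
    - exists (k * v1). split; [now apply (is_RInt_scal (V := R_NormedModule))|].
      replace (r ^ (d + 2) / INR (d + 2) * (k * v1)) with (k * (r ^ (d + 2) / INR (d + 2) * v1)) by ring.
      now apply is_disk_int_scal. }
  destruct H as [v' [H1 H2]].
  apply (is_RInt_unique (V := R_CompleteNormedModule)) in H1. apply (is_RInt_unique (V := R_CompleteNormedModule)) in Hv.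
  replace v with v' by congruence. exact H2.
Qed.

Lemma cmonomial_disk (j k : nat) (w : C) (r : R) : 0 <= r ->
  is_disk_int r (fun x y => Re (w * ((x, y) ^ j * Cconj (x, y) ^ k)))
    (if Nat.eq_dec j k then PI * Re w * r ^ (2 * j + 2) / INR (j + 1) else 0).
Proof.
  intros Hr.
  pose proof (homog_disk _ _ _ r (homog_cmonomial j k w) Hr (circ_monomial_mean j k w)) as H.
  destruct (Nat.eq_dec j k) as [->|Hjk].
  - replace (PI * Re w * r ^ (2 * k + 2) / INR (k + 1))
      with (r ^ (k + k + 2) / INR (k + k + 2) * (2 * PI * Re w)); [exact H|].
    replace (k + k + 2)%nat with (2 * k + 2)%nat by lia.
    assert (Hk : INR (k + 1) <> 0) by (apply not_0_INR; lia).
    replace (2 * k + 2)%nat with (2 * (k + 1))%nat by lia.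
    rewrite mult_INR. change (INR 2) with 2. field. exact Hk.
  - rewrite !Rmult_0_r in H. exact H.
Qed.

(** * Functions with positive real part *)

Lemma is_mean_plus (F G : R -> R) (v w : R) :
  is_mean F v -> is_mean G w -> is_mean (fun t => F t + G t) (v + w).
Proof.
  intros HF HG. unfold is_mean. rewrite Rmult_plus_distr_l.
  now apply (is_RInt_plus (V := R_NormedModule)).
Qed.

Lemma is_mean_scal (k : R) (F : R -> R) (v : R) :
  is_mean F v -> is_mean (fun t => k * F t) (k * v).
Proof.
  intros HF. unfold is_mean. replace (2 * PI * (k * v)) with (k * (2 * PI * v)) by ring.
  now apply (is_RInt_scal (V := R_NormedModule)).
Qed.

Lemma is_mean_ext (F G : R -> R) (v w : R) :
  (forall t, F t = G t) -> v = w -> is_mean F v -> is_mean G w.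
Proof.
  intros H <-. replace G with F; [auto|]. extensionality t. apply H.
Qed.

Lemma is_mean_nonneg (F : R -> R) (v : R) :
  (forall t, 0 <= F t) -> is_mean F v -> 0 <= v.
Proof.
  intros HF Hv. pose proof PI_RGT_0.
  assert (H0 : 0 <= 2 * PI * v).
  { apply is_RInt_le with (f := fun _ => 0) (g := F) (a := - (PI / 2)) (b := 3 * (PI / 2)).
    - lra.
    - evar_last; [apply (@is_RInt_const R_NormedModule)|]. apply Rmult_0_r.
    - exact Hv.
    - auto. }
  nra.
Qed.

Lemma mono_mono_mean (a d : C) (n m : nat) :
  is_mean (fun t => Re (a * circ t ^ n) * Re (d * circ t ^ m))
    (1 / 2 * ((if Nat.eq_dec (n + m) 0 then Re (a * d) else 0)
            + (if Nat.eq_dec n m then Re (a * Cconj d) else 0))).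
Proof.
  eapply is_mean_ext; [|reflexivity|
    apply is_mean_scal, is_mean_plus;
    [exact (circ_monomial_mean (n + m) 0 (a * d)%C)
    |exact (circ_monomial_mean n m (a * Cconj d)%C)]].
  intros t. cbv beta. rewrite Cpow_add_r.
  replace (a * d * (circ t ^ n * circ t ^ m * Cconj (circ t) ^ 0))%C
    with ((a * circ t ^ n) * (d * circ t ^ m))%C
    by (change (Cconj (circ t) ^ 0)%C with (RtoC 1); ring).
  replace (a * Cconj d * (circ t ^ n * Cconj (circ t) ^ m))%C
    with ((a * circ t ^ n) * Cconj (d * circ t ^ m))%C
    by (rewrite Cmult_conj, Cpow_conj; ring).
  destruct (a * circ t ^ n)%C, (d * circ t ^ m)%C. simpl. field.
Qed.

Lemma mono_poly_mean (a : C) (d : nat -> C) (n M : nat) :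
  is_mean (fun t => Re (a * circ t ^ n) * Re (Csum (fun m => d m * circ t ^ m)%C M))
    (1 / 2 * ((if Nat.eq_dec n 0 then Re (a * d 0%nat) else 0)
            + (if Compare_dec.le_dec n M then Re (a * Cconj (d n)) else 0))).
Proof.
  induction M as [|M IH].
  - eapply is_mean_ext; [| |exact (mono_mono_mean a (d 0%nat) n 0)].
    + intros t. now rewrite sum_O.
    + destruct n as [|n].
      * destruct (Compare_dec.le_dec 0 0); [reflexivity|lia].
      * destruct (Compare_dec.le_dec (S n) 0); [lia|reflexivity].
  - eapply is_mean_ext; [| |exact (is_mean_plus _ _ _ _ IH (mono_mono_mean a (d (S M)) n (S M)))].
    + intros t. rewrite Csum_Sn, re_plus. symmetry. apply Rmult_plus_distr_l.
    + destruct (Nat.eq_dec (n + S M) 0) as [H|_]; [lia|].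
      destruct (Nat.eq_dec n (S M)) as [->|Hn].
      * destruct (Compare_dec.le_dec (S M) M); [lia|].
        destruct (Compare_dec.le_dec (S M) (S M)); [|lia]. ring.
      * destruct (Compare_dec.le_dec n M), (Compare_dec.le_dec n (S M)); try lia; ring.
Qed.

Lemma poly_poly_mean (a d : nat -> C) (N M : nat) :
  is_mean (fun t => Re (Csum (fun n => a n * circ t ^ n)%C N)
                  * Re (Csum (fun m => d m * circ t ^ m)%C M))
    (1 / 2 * (Re (a 0%nat * d 0%nat)
      + sum_n (fun n => if Compare_dec.le_dec n M then Re (a n * Cconj (d n)) else 0) N)).
Proof.
  induction N as [|N IH].
  - eapply is_mean_ext; [| |exact (mono_poly_mean (a 0%nat) d 0 M)].
    + intros t. now rewrite sum_O.
    + rewrite sum_O. reflexivity.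
  - eapply is_mean_ext; [| |exact (is_mean_plus _ _ _ _ IH (mono_poly_mean (a (S N)) d (S N) M))].
    + intros t. rewrite Csum_Sn, re_plus. symmetry. apply Rmult_plus_distr_r.
    + rewrite sum_Sn. unfold plus; simpl. ring.
Qed.

(** If [Re (PS c)] is non-negative on the disk and [d] gives a non-negative trigonometric
    polynomial [Q], then the mean of the product [Re (PS c (rho u)) * Q u] over the circle is
    non-negative, and it is computed coefficientwise.  Only a partial sum of [PS c] is
    integrated: it is at least [- eps] on the circle, whence the last term. *)
Lemma positive_duality (c : nat -> C) (rho eps : R) :
  summable c -> (forall z, in_disk z -> 0 <= Re (PS c z)) -> 0 <= rho < 1 -> 0 < eps ->
  exists N0, forall N, (N0 <= N)%nat -> forall d : nat -> C,
    (forall t, 0 <= Re (Csum (fun m => d m * circ t ^ m)%C N)) ->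
    0 <= 1 / 2 * (Re (c 0%nat * d 0%nat)
            + Re (Csum (fun n => c n * RtoC rho ^ n * Cconj (d n))%C N)) + eps * Re (d 0%nat).
Proof.
  intros Hc Hp Hr Heps.
  destruct (PS_uniform c rho Hc Hr eps Heps) as [N0 HN0].
  exists N0. intros N HN d Hd.
  set (a := fun n => (c n * RtoC rho ^ n)%C).
  assert (HT : forall t, - eps <= Re (Csum (fun n => a n * circ t ^ n)%C N)).
  { intros t. specialize (HN0 N HN (RtoC rho * circ t)%C).
    assert (Hm : Cmod (RtoC rho * circ t) = rho)
      by (rewrite Cmod_mult, circ_Cmod, Cmod_R, Rabs_pos_eq; lra).
    specialize (HN0 ltac:(lra)).
    pose proof (Hp (RtoC rho * circ t)%C ltac:(unfold in_disk; lra)) as H0.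
    replace (Csum (fun n => a n * circ t ^ n)%C N) with
      (Csum (fun k => c k * (RtoC rho * circ t) ^ k)%C N).
    - pose proof (Re_le_Cmod (PS c (RtoC rho * circ t) - Csum (fun k => c k * (RtoC rho * circ t) ^ k)%C N)) as H1.
      rewrite re_minus in H1. lra.
    - apply sum_n_ext. intros n. unfold a. rewrite Cpow_mult_l.
      apply Cmult_assoc. }
  assert (H1 : is_mean (fun t => (Re (Csum (fun n => a n * circ t ^ n)%C N) + eps) *
       Re (Csum (fun m => d m * circ t ^ m)%C N))
     (1 / 2 * (Re (a 0%nat * d 0%nat) + sum_n (fun n => if Compare_dec.le_dec n N then Re (a n * Cconj (d n)) else 0) N) + eps * (1 / 2 * (Re (RtoC 1 * d 0%nat)
            + Re (RtoC 1 * Cconj (d 0%nat)))))).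
  { eapply is_mean_ext; [| |apply is_mean_plus; [exact (poly_poly_mean a d N N)|
      apply (is_mean_scal eps); exact (mono_poly_mean (RtoC 1) d 0 N)]].
    - intros t. cbv beta. change (circ t ^ 0)%C with (RtoC 1). rewrite Cmult_1_r. simpl. ring.
    - reflexivity. }
  apply is_mean_nonneg in H1.
  - eapply Rle_trans; [exact H1|]. right. f_equal; [f_equal|].
    + unfold a. rewrite Cmult_1_r. f_equal.
      rewrite Re_Csum. apply sum_n_ext_loc. intros n Hn.
      destruct (Compare_dec.le_dec n N); [reflexivity|lia].
    + rewrite !Cmult_1_l, re_conj. field.
  - intros t. apply Rmult_le_pos; [|apply Hd]. specialize (HT t). lra.
Qed.

Lemma Csum_two (f : nat -> C) (k N : nat) :
  (1 <= k <= N)%nat -> (forall n, n <> O -> n <> k -> f n = RtoC 0) ->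
  Csum f N = (f O + f k)%C.
Proof.
  intros Hk Hf.
  assert (H0 : forall m, (m < k)%nat -> Csum f m = f O).
  { induction m as [|m IH]; intros Hm; [now rewrite sum_O|].
    rewrite Csum_Sn, IH by lia. rewrite (Hf (S m)) by lia. apply Cplus_0_r. }
  assert (H1 : forall m, Csum f (k + m) = (f O + f k)%C).
  { induction m as [|m IH].
    - rewrite Nat.add_0_r. destruct k as [|k]; [lia|]. rewrite Csum_Sn, H0 by lia. reflexivity.
    - rewrite Nat.add_succ_r, Csum_Sn, IH. rewrite (Hf (S (k + m))) by lia. apply Cplus_0_r. }
  replace N with (k + (N - k))%nat by lia. apply H1.
Qed.

Lemma le_of_eps (x y K : R) : (forall e, 0 < e -> x <= y + K * e) -> x <= y.
Proof.
  intros H. apply Rnot_lt_le. intros Hlt.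
  pose proof (Rabs_pos K) as HK. pose proof (Rle_abs K) as HK'.
  specialize (H ((x - y) / 2 / (Rabs K + 1)) ltac:(apply Rdiv_lt_0_compat; lra)).
  assert (E : (Rabs K + 1) * ((x - y) / 2 / (Rabs K + 1)) = (x - y) / 2) by (field; lra).
  assert (0 < (x - y) / 2 / (Rabs K + 1)) by (apply Rdiv_lt_0_compat; lra).
  set (e := (x - y) / 2 / (Rabs K + 1)) in *. nra.
Qed.

(** Used to let an inner radius [rho] tend to [1]. *)
Lemma affine_limit (A B s : R) : s < 1 -> (forall rho, s < rho < 1 -> 0 <= A * rho + B) -> 0 <= A + B.
Proof.
  intros Hs H. apply (le_of_eps _ _ (Rabs A * (1 - s))). intros e He.
  pose proof (Rle_abs (- A)) as HA. rewrite Rabs_Ropp in HA. pose proof (Rabs_pos A) as HA'.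
  assert (Hq : forall q, 0 <= q -> - A * q <= Rabs A * q)
    by (intros; now apply Rmult_le_compat_r).
  destruct (Rlt_le_dec e 1) as [H1|H1].
  - specialize (H (1 - e * (1 - s)) ltac:(nra)).
    specialize (Hq (e * (1 - s)) ltac:(nra)). lra.
  - specialize (H ((1 + s) / 2) ltac:(lra)).
    specialize (Hq ((1 - s) / 2) ltac:(lra)).
    assert (0 <= Rabs A * (1 - s) * (e - 1 / 2)) by (apply Rmult_le_pos; nra).
    lra.
Qed.

Lemma polar_form (z : C) : exists w : C, Cmod w = 1 /\ z = (RtoC (Cmod z) * w)%C.
Proof.
  destruct (Ceq_dec z 0) as [->|Hz].
  - exists (RtoC 1). rewrite Cmod_1, Cmod_0. split; [reflexivity|ring].
  - pose proof (proj1 (Cmod_gt_0 z) Hz) as Hm.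
    assert (Hm' : RtoC (Cmod z) <> 0) by (intros E; apply RtoC_inj in E; lra).
    exists (z / RtoC (Cmod z))%C. split; [|field; exact Hm'].
    rewrite Cmod_div by exact Hm'. rewrite Cmod_R, Rabs_pos_eq by lra. field. lra.
Qed.

Lemma opposite_phase (z : C) :
  exists w : C, Cmod w = 1 /\ (z * Cconj w)%C = RtoC (- Cmod z).
Proof.
  destruct (polar_form z) as [w [Hw E]]. exists (- w)%C.
  split; [now rewrite Cmod_opp|].
  rewrite E at 1.
  replace (RtoC (Cmod z) * w * Cconj (- w))%C with (- (RtoC (Cmod z) * (w * Cconj w)))%C
    by (rewrite Copp_conj; ring).
  rewrite <- Cmod2_conj, Hw, RtoC_opp. simpl pow. rewrite !Rmult_1_r. ring.
Qed.

(** Duality with [Q u = 1 + Re (w u^k)], where the unimodular [w] is opposite in phase to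
    [c_k]. *)
Lemma caratheodory (c : nat -> C) (k : nat) :
  summable c -> (forall z, in_disk z -> 0 <= Re (PS c z)) -> (1 <= k)%nat ->
  Cmod (c k) <= 2 * Re (c 0%nat).
Proof.
  intros Hc Hp Hk.
  destruct (opposite_phase (c k)) as [w [Hw1 Hw]].
  assert (H : forall rho, 0 <= rho < 1 -> rho ^ k * Cmod (c k) <= 2 * Re (c 0%nat)).
  { intros rho Hr. apply (le_of_eps _ _ 2). intros eps Heps.
    destruct (positive_duality c rho eps Hc Hp Hr Heps) as [N0 H].
    set (N := Nat.max N0 k).
    set (d := fun n : nat => match n with O => RtoC 1 | _ => if Nat.eq_dec n k then w else RtoC 0 end).
    assert (dk : d k = w).
    { unfold d. destruct k; [lia|]. destruct (Nat.eq_dec (S k) (S k)); [reflexivity|lia]. }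
    assert (dz : forall n, n <> O -> n <> k -> d n = RtoC 0).
    { intros n H0 H1. unfold d. destruct n; [lia|]. destruct (Nat.eq_dec (S n) k); [lia|reflexivity]. }
    assert (HkN : (1 <= k <= N)%nat) by (unfold N; lia).
    specialize (H N ltac:(unfold N; lia) d).
    rewrite (Csum_two (fun n => c n * RtoC rho ^ n * Cconj (d n))%C k N HkN) in H.
    2: { intros n H0 H1. rewrite dz by assumption. replace (Cconj (RtoC 0)) with (RtoC 0) by Ccomp. ring. }
    assert (HQ : forall t, 0 <= Re (Csum (fun m => d m * circ t ^ m)%C N)).
    { intros t. rewrite (Csum_two _ k N HkN).
      2: { intros n H0 H1. rewrite dz by assumption. ring. }
      rewrite re_plus, dk.
      change (d O * circ t ^ 0)%C with (RtoC 1 * RtoC 1)%C.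
      assert (Hm : Cmod (w * circ t ^ k) = 1)
        by (rewrite Cmod_mult, Cmod_pow, circ_Cmod, pow1, Hw1; ring).
      pose proof (re_le_Cmod (w * circ t ^ k)) as Hre. rewrite Hm in Hre.
      apply Rabs_le_between in Hre. rewrite Cmult_1_l. rewrite re_RtoC. lra. }
    specialize (H HQ). rewrite dk in H.
    change (d O) with (RtoC 1) in H.
    change (RtoC rho ^ 0)%C with (RtoC 1) in H.
    replace (c k * RtoC rho ^ k * Cconj w)%C with (RtoC (rho ^ k) * (c k * Cconj w))%C in H
      by (rewrite RtoC_pow; ring).
    rewrite Hw in H. replace (Cconj (RtoC 1)) with (RtoC 1) in H by Ccomp.
    rewrite !Cmult_1_r, re_plus, re_scal_l, !re_RtoC in H. lra. }
  apply Rnot_lt_le. intros Hlt.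
  assert (Hc0 : 0 <= 2 * Re (c 0%nat)).
  { specialize (H 0 ltac:(lra)). pose proof (Cmod_ge_0 (c k)).
    rewrite pow_ne_zero in H by lia. lra. }
  set (q := 2 * Re (c 0%nat)) in *.
  assert (Hl : is_lim_seq (fun n => (1 - / (INR n + 1)) ^ k * Cmod (c k)) (1 ^ k * Cmod (c k))).
  { apply is_lim_seq_mult'; [|apply is_lim_seq_const].
    assert (H1 : is_lim_seq (fun n => 1 - / (INR n + 1)) 1).
    { replace (Finite 1) with (Finite (1 - 0)) by (f_equal; ring).
      apply is_lim_seq_minus'; [apply is_lim_seq_const|].
      apply is_lim_seq_inv with (l := p_infty); [|discriminate].
      apply is_lim_seq_ext with (fun n => INR (S n)); [intros; apply S_INR|].
      apply -> is_lim_seq_incr_1. apply is_lim_seq_INR. }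
    apply (is_lim_seq_continuous (fun x => x ^ k)); [|exact H1].
    apply derivable_continuous_pt, derivable_pt_pow. }
  rewrite pow1, Rmult_1_l in Hl.
  assert (Hle : Rbar_le (Cmod (c k)) q).
  { eapply is_lim_seq_le; [|exact Hl|apply is_lim_seq_const].
    intros n. apply H. pose proof (pos_INR n).
    assert (0 < / (INR n + 1)) by (apply Rinv_0_lt_compat; lra).
    assert (/ (INR n + 1) <= 1) by (rewrite <- Rinv_1; apply Rinv_le_contravar; lra).
    lra. }
  simpl in Hle. lra.
Qed.

Lemma geometric_Csum (v : C) (N : nat) :
  ((RtoC 1 - v) * Csum (fun n => v ^ n)%C N)%C = (RtoC 1 - v ^ S N)%C.
Proof.
  induction N as [|N IH].
  - rewrite sum_O. rewrite Cpow_S. change (v ^ 0)%C with (RtoC 1). ring.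
  - rewrite Csum_Sn, Cmult_plus_distr_l, IH. rewrite (Cpow_S _ (S N)). ring.
Qed.

Lemma one_minus_neq0 (v : C) : Cmod v < 1 -> (RtoC 1 - v)%C <> 0.
Proof.
  intros H E. assert (v = RtoC 1) by (replace v with (RtoC 1 - (RtoC 1 - v))%C by ring; rewrite E; ring).
  subst v. rewrite Cmod_1 in H. lra.
Qed.

Lemma Re_inv_one_minus (v : C) : Cmod v < 1 -> / (1 + Cmod v) <= Re (/ (RtoC 1 - v)).
Proof.
  intros Hv. pose proof (Cmod_ge_0 v) as H0.
  pose proof (Cmod2_alt v) as Hm. set (t := Cmod v) in *.
  pose proof (Re_le_Cmod v) as Hx. pose proof (Rle_abs (- Re v)) as Hx2.
  rewrite Rabs_Ropp in Hx2. pose proof (re_le_Cmod v) as Hx3. fold t in Hx, Hx3.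
  destruct v as [x y]. simpl in Hm, Hx, Hx2, Hx3 |- *.
  set (D := (1 + - x) * ((1 + - x) * 1) + (0 + - y) * ((0 + - y) * 1)).
  assert (HD : D = 1 - 2 * x + t * t) by (unfold D; nra).
  assert (HD0 : 0 < D) by nra.
  apply Rmult_le_reg_r with ((1 + t) * D); [nra|].
  replace (/ (1 + t) * ((1 + t) * D)) with D by (field; lra).
  replace ((1 + - x) / D * ((1 + t) * D)) with ((1 - x) * (1 + t)) by (field; lra).
  rewrite HD. assert (0 <= (t + x) * (1 - t)) by (apply Rmult_le_pos; lra). nra.
Qed.

(** With [v = t u] the right-hand side is a partial sum of the Poisson kernel, whose minimum
    over the circle is [(1 - t) / (1 + t) = 2 / (1 + t) - 1]. *)
Lemma poisson_kernel_lower (v : C) (N : nat) : Cmod v < 1 ->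
  2 / (1 + Cmod v) - 1 - 2 * (Cmod v ^ S N / (1 - Cmod v))
  <= 2 * Re (Csum (fun m => v ^ m)%C N) - 1.
Proof.
  intros Hv. pose proof (one_minus_neq0 v Hv) as Hn.
  assert (ES : Csum (fun m => v ^ m)%C N = (/ (1 - v) - v ^ S N / (1 - v))%C).
  { replace (Csum (fun m => v ^ m)%C N)
      with ((1 - v) * Csum (fun m => v ^ m)%C N / (1 - v))%C by (field; exact Hn).
    rewrite geometric_Csum. asC. field. exact Hn. }
  rewrite ES, re_minus.
  pose proof (Re_inv_one_minus v Hv) as Hi.
  assert (Hs : Re (v ^ S N / (1 - v)) <= Cmod v ^ S N / (1 - Cmod v)).
  { eapply Rle_trans; [apply Re_le_Cmod|].
    rewrite Cmod_div, Cmod_pow by exact Hn.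
    apply Rmult_le_compat_l; [apply pow_le, Cmod_ge_0|].
    apply Rinv_le_contravar; [lra|].
    pose proof (Cmod_triangle (1 - v) v) as Htr.
    replace (1 - v + v)%C with (RtoC 1) in Htr by ring. rewrite Cmod_1 in Htr. lra. }
  unfold Rdiv in *. lra.
Qed.

Lemma pow_small (t e : R) : 0 <= t < 1 -> 0 < e -> exists N0, forall N, (N0 <= N)%nat -> t ^ N < e.
Proof.
  intros Ht He.
  destruct (pow_lt_1_zero t ltac:(rewrite Rabs_pos_eq; lra) e He) as [N0 H].
  exists N0. intros N HN. specialize (H N HN).
  rewrite Rabs_pos_eq in H; [exact H|]. apply pow_le; lra.
Qed.

Lemma Csum_head (f : nat -> C) (a : C) (N : nat) :
  Csum (fun n => match n with O => a | S _ => f n end) N =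
  (Csum f N + (a - f O))%C.
Proof.
  induction N as [|N IH].
  - rewrite !sum_O. assert (E : forall x y : C, (x = y + (x - y))%C) by (intros; ring). apply E.
  - rewrite !Csum_Sn, IH. assert (E : forall x y z : C, (x + y + z = x + z + y)%C) by (intros; ring). apply E.
Qed.

(** Duality with the truncated Poisson kernel minus its minimum, corrected by a small [e] to
    absorb the truncation. *)
Lemma harnack (c : nat -> C) (z : C) :
  summable c -> (forall z, in_disk z -> 0 <= Re (PS c z)) -> Im (c 0%nat) = 0 -> in_disk z ->
  Re (c 0%nat) * (1 - Cmod z) <= Re (PS c z) * (1 + Cmod z).
Proof.
  intros Hc Hp Hreal Hz. unfold in_disk in Hz.
  pose proof (Cmod_ge_0 z) as Hz0.
  set (c0 := Re (c 0%nat)).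
  assert (Ec0 : c 0%nat = RtoC c0) by (apply C_inj; simpl; [reflexivity|exact Hreal]).
  set (X := Re (PS c z)).
  assert (H : forall rho, Cmod z < rho < 1 -> 0 <= (X - c0) * rho + (X + c0) * Cmod z).
  { intros rho Hr.
    set (zeta := (z * RtoC (/ rho))%C). set (t := Cmod z / rho).
    assert (Ht : Cmod zeta = t).
    { unfold zeta, t. rewrite Cmod_mult, Cmod_R, Rabs_pos_eq; [reflexivity|].
      left. apply Rinv_0_lt_compat. lra. }
    assert (Ht1 : 0 <= t < 1).
    { rewrite <- Ht. split; [apply Cmod_ge_0|]. rewrite Ht. unfold t.
      apply Rmult_lt_reg_r with rho; [lra|]. unfold Rdiv. rewrite Rmult_assoc, Rinv_l by lra. lra. }
    assert (Ez : (RtoC rho * zeta)%C = z).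
    { unfold zeta. rewrite Cmult_comm, <- Cmult_assoc, <- RtoC_mult, Rinv_l by lra. ring. }
    (* [kap = (1 - t) / (1 + t)] is the minimum of the Poisson kernel at radius [t] *)
    set (kap := 2 / (1 + t) - 1).
    assert (Hk : c0 * kap <= X).
    { apply (le_of_eps _ _ (c0 + (1 - kap + 1) + 1)). intros e0 He0.
      set (e := Rmin e0 1).
      assert (He : 0 < e <= 1) by (unfold e; split; [apply Rmin_pos; lra | apply Rmin_r]).
      assert (Hee : e <= e0) by apply Rmin_l.
      assert (Hkap : kap <= 1).
      { unfold kap. apply Rplus_le_reg_r with 1. unfold Rdiv.
        apply Rmult_le_reg_r with (1 + t); [lra|].
        replace (2 * / (1 + t) - 1 + 1) with (2 * / (1 + t)) by ring.
        rewrite Rmult_assoc, Rinv_l by lra. lra. }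
      assert (Hc0 : 0 <= c0).
      { pose proof (Hp (RtoC 0) ltac:(unfold in_disk; rewrite Cmod_0; lra)) as HH.
        rewrite PS_0 in HH. exact HH. }
      destruct (positive_duality c rho e Hc Hp ltac:(lra) ltac:(lra)) as [N1 H1].
      destruct (pow_small t (e * (1 - t) / 2) Ht1 ltac:(apply Rdiv_lt_0_compat; nra)) as [N2 H2].
      destruct (PS_uniform c (Cmod z) Hc ltac:(lra) e ltac:(lra)) as [N3 H3].
      set (N := Nat.max N1 (Nat.max N2 N3)).
      specialize (H1 N ltac:(unfold N; lia)).
      specialize (H2 (S N) ltac:(unfold N; lia)).
      specialize (H3 N ltac:(unfold N; lia) z (Rle_refl _)).
      set (q := 1 - kap + e).
      specialize (H1 (fun n => match n with O => RtoC q | S _ => (2 * Cconj zeta ^ n)%C end)).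
      cbv beta iota in H1.
      assert (HQ : forall u, 0 <= Re (Csum (fun m => match m with O => RtoC q | S _ => (2 * Cconj zeta ^ m)%C end * circ u ^ m)%C N)).
      { intros u. set (v := (Cconj zeta * circ u)%C).
        assert (Hv : Cmod v = t) by (unfold v; rewrite Cmod_mult, Cmod_conj, circ_Cmod, Ht; ring).
        rewrite (sum_n_ext _ (fun m => match m with O => RtoC q | S _ => (2 * v ^ m)%C end)).
        2: { intros [|m]; [apply Cmult_1_r|]. unfold v. rewrite Cpow_mult_l. symmetry. apply Cmult_assoc. }
        rewrite (Csum_head (fun m => 2 * v ^ m)%C), (sum_n_mult_l (K := C_Ring)).
        change (0 <= Re (2 * Csum (fun m => v ^ m)%C N + (RtoC q - 2 * RtoC 1))).
        rewrite re_plus, re_minus, Cmult_1_r, re_scal_l, !re_RtoC.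
        pose proof (poisson_kernel_lower v N ltac:(lra)) as Hv2. rewrite Hv in Hv2.
        assert (Ht2 : t ^ S N / (1 - t) <= e / 2).
        { apply Rmult_le_reg_r with (1 - t); [lra|].
          unfold Rdiv at 1. rewrite Rmult_assoc, Rinv_l by lra. lra. }
        unfold q, kap. lra. }
      specialize (H1 HQ).
      rewrite (sum_n_ext _ (fun n => match n with O => (c 0%nat * RtoC q)%C | S _ => (2 * (c n * z ^ n))%C end)) in H1.
      2: { intros [|n].
           - asC. change (c O * RtoC rho ^ 0 * Cconj (RtoC q) = c O * RtoC q)%C.
             replace (Cconj (RtoC q)) with (RtoC q) by Ccomp.
             change (RtoC rho ^ 0)%C with (RtoC 1). ring.
           - rewrite Cmult_conj, Cpow_conj, Cconj_conj.
             replace (Cconj 2) with (RtoC 2) by Ccomp.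
             rewrite <- Ez. rewrite Cpow_mult_l.
             assert (E : forall a b d : C, (a * b * (2 * d) = 2 * (a * (b * d)))%C) by (intros; ring). apply E. }
      rewrite (Csum_head (fun n => 2 * (c n * z ^ n))%C) in H1.
      rewrite (sum_n_mult_l (K := C_Ring)) in H1.
      change (mult (RtoC 2) (sum_n (fun k : nat => (c k * z ^ k)%C) N)) with (2 * Csum (fun k => c k * z ^ k)%C N)%C in H1.
      change (z ^ 0)%C with (RtoC 1) in H1.
      rewrite Ec0 in H1.
      rewrite re_plus, re_minus, Cmult_1_r, !re_scal_l, !re_RtoC in H1.
      pose proof (re_le_Cmod (PS c z - Csum (fun k => c k * z ^ k)%C N)) as H4.
      rewrite re_minus in H4. fold X in H4.
      assert (H5 : Re (Csum (fun k => c k * z ^ k)%C N) <= X + e).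
      { assert (H6 : Rabs (X - Re (Csum (fun k : nat => (c k * z ^ k)%C) N)) <= e) by lra.
        apply Rabs_le_between in H6. lra. }
      unfold q in H1.
      assert (0 <= c0 * (e0 - e)) by (apply Rmult_le_pos; lra).
      assert (e * (1 - kap + e) <= e0 * (1 - kap + 1)) by (apply Rmult_le_compat; lra).
      nra. }
    unfold kap, t in Hk.
    replace (2 / (1 + Cmod z / rho) - 1) with ((rho - Cmod z) / (rho + Cmod z)) in Hk by (field; lra).
    apply Rmult_le_compat_r with (r := rho + Cmod z) in Hk; [|lra].
    replace (c0 * ((rho - Cmod z) / (rho + Cmod z)) * (rho + Cmod z)) with (c0 * (rho - Cmod z)) in Hk by (field; lra).
    lra. }
  apply affine_limit in H; [lra|exact Hz].
Qed.

(** * Coefficient and distortion bounds for the class *)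

(** What the class and the expansions say about the two coefficient sequences, with
    [A 0], [A 1] and [B 0] filled in. *)
Record normalized (alpha : R) (A B : nat -> C) : Prop := {
  nA : summable A;
  nB : summable B;
  nA0 : A 0%nat = RtoC 0;
  nA1 : A 1%nat = RtoC 1;
  nB0 : B 0%nat = RtoC 0;
  nB1 : B 1%nat = RtoC 0;
  nRe : forall z, in_disk z -> Cmod (PS (dps B) z) < Re (PS (dps A) z) - alpha }.

Definition htail (a : nat -> C) (n : nat) : C :=
  match n with O => RtoC 0 | 1%nat => RtoC 1 | _ => a n end.
Definition gtail (b : nat -> C) (n : nat) : C :=
  match n with O => RtoC 0 | _ => b n end.

Lemma is_Cseries_cons (a : nat -> C) (l : C) :
  is_Cseries (fun n => a (S n)) l -> is_Cseries a (a 0%nat + l)%C.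
Proof.
  intros H. apply (is_series_decr_1 (K := C_AbsRing) (V := C_NormedModule)).
  match goal with |- is_series _ ?x => replace x with l; [exact H|] end.
  change (l = (a 0%nat + l + - a 0%nat)%C). ring.
Qed.

Lemma power_expansions_series (h g : C -> C) (a b : nat -> C) (z : C) :
  power_expansions h g a b -> in_disk z ->
  is_Cseries (fun n => htail a n * z ^ n)%C (h z) /\
  is_Cseries (fun n => gtail b n * z ^ n)%C (g z).
Proof.
  intros H Hz. destruct (H z Hz) as [Hh Hg]. split.
  - replace (h z) with (htail a 0 * z ^ 0 + (htail a 1 * z ^ 1 + (h z - z)))%C
      by (simpl htail; change (z ^ 0)%C with (RtoC 1); rewrite Cpow_1_r; ring).
    apply (is_Cseries_cons (fun n => htail a n * z ^ n)%C).
    apply (is_Cseries_cons (fun n => htail a (S n) * z ^ (S n))%C).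
    eapply is_series_ext; [|exact Hh]. intros n. cbv beta.
    now replace (n + 2)%nat with (S (S n)) by lia.
  - replace (g z) with (gtail b 0 * z ^ 0 + g z)%C
      by (simpl gtail; change (z ^ 0)%C with (RtoC 1); ring).
    apply (is_Cseries_cons (fun n => gtail b n * z ^ n)%C).
    eapply is_series_ext; [|exact Hg]. intros n. cbv beta.
    now replace (n + 1)%nat with (S n) by lia.
Qed.

Lemma in_disk_R (r : R) : 0 <= r < 1 -> in_disk (RtoC r).
Proof. intros H. unfold in_disk. rewrite Cmod_R, Rabs_pos_eq; lra. Qed.

Lemma power_expansions_PS (h g : C -> C) (a b : nat -> C) :
  power_expansions h g a b ->
  summable (htail a) /\ summable (gtail b) /\
  (forall z, in_disk z -> h z = PS (htail a) z /\ g z = PS (gtail b) z).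
Proof.
  intros H.
  split; [|split].
  - apply summable_of_converges. intros r Hr. exists (h (RtoC r)).
    apply (power_expansions_series h g a b (RtoC r) H). now apply in_disk_R.
  - apply summable_of_converges. intros r Hr. exists (g (RtoC r)).
    apply (power_expansions_series h g a b (RtoC r) H). now apply in_disk_R.
  - intros z Hz. destruct (power_expansions_series h g a b z H Hz) as [H1 H2].
    split; symmetry; now apply PS_unique.
Qed.

Lemma class_PH0_normalized (alpha : R) (h g : C -> C) (a b : nat -> C) :
  class_PH0 alpha h g -> power_expansions h g a b ->
  normalized alpha (htail a) (gtail b) /\
  (forall z, in_disk z -> h z = PS (htail a) z /\ g z = PS (gtail b) z /\
     C_derive h z = PS (dps (htail a)) z /\ C_derive g z = PS (dps (gtail b)) z).
Proof.
  intros [_ [Hre Hg0]] Hp.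
  destruct (power_expansions_PS h g a b Hp) as [HA [HB Hhg]].
  assert (HD : forall z, in_disk z -> C_derive h z = PS (dps (htail a)) z
              /\ C_derive g z = PS (dps (gtail b)) z).
  { intros z Hz. split; apply is_C_derive_unique; apply PS_is_derive; try assumption;
    intros w Hw; now apply Hhg. }
  split; [|intros z Hz; destruct (Hhg z Hz), (HD z Hz); auto].
  constructor; try assumption; try reflexivity.
  - assert (H0 : in_disk (RtoC 0)) by (apply in_disk_R; lra).
    destruct (HD _ H0) as [_ E]. rewrite Hg0, PS_0 in E. unfold dps in E.
    simpl INR in E. rewrite Cmult_1_l in E. now symmetry.
  - intros z Hz. destruct (HD z Hz) as [E1 E2]. specialize (Hre z Hz).
    rewrite E1, E2, re_minus, re_RtoC in Hre. lra.
Qed.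

Definition unit0 (n : nat) : C := match n with O => RtoC 1 | _ => RtoC 0 end.

Lemma unit0_series (z : C) : is_Cseries (fun n => unit0 n * z ^ n)%C (RtoC 1).
Proof.
  replace (RtoC 1) with (unit0 0 * z ^ 0 + RtoC 0)%C
    by (simpl unit0; change (z ^ 0)%C with (RtoC 1); ring).
  apply (is_Cseries_cons (fun n => unit0 n * z ^ n)%C).
  unfold is_series. apply filterlim_ext with (fun _ => RtoC 0); [|apply filterlim_const].
  intros n. symmetry. change (Csum (fun k => unit0 (S k) * z ^ (S k))%C n = RtoC 0).
  induction n as [|n IH].
  - rewrite sum_O. apply Cmult_0_l.
  - rewrite Csum_Sn, IH. simpl unit0. asC. ring.
Qed.

Lemma PS_unit0 (z : C) : PS unit0 z = RtoC 1.
Proof. apply PS_unique, unit0_series. Qed.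

Lemma summable_unit0 : summable unit0.
Proof. apply summable_of_converges. intros r _. eexists. apply unit0_series. Qed.

(** Coefficients of [h' + e g' - alpha], which has positive real part when [|e| = 1]. *)
Definition carath (alpha : R) (A B : nat -> C) (e : C) (n : nat) : C :=
  ((dps A n + e * dps B n) + RtoC (- alpha) * unit0 n)%C.

Lemma summable_carath (alpha : R) (A B : nat -> C) (e : C) :
  normalized alpha A B -> summable (carath alpha A B e).
Proof.
  intros H. unfold carath.
  apply (summable_plus_scal (fun n => dps A n + e * dps B n)%C unit0).
  - apply summable_plus_scal; apply dps_summable; [apply (nA _ _ _ H)|apply (nB _ _ _ H)].
  - apply summable_unit0.
Qed.

Lemma PS_carath (alpha : R) (A B : nat -> C) (e z : C) :
  normalized alpha A B -> in_disk z ->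
  Re (PS (carath alpha A B e) z) = Re (PS (dps A) z) + Re (e * PS (dps B) z) - alpha.
Proof.
  intros H Hz. unfold carath.
  pose proof (dps_summable _ (nA _ _ _ H)) as HA. pose proof (dps_summable _ (nB _ _ _ H)) as HB.
  rewrite (PS_plus_scal (fun n => dps A n + e * dps B n)%C unit0);
    [|now apply summable_plus_scal|apply summable_unit0|exact Hz].
  rewrite (PS_plus_scal (dps A) (dps B)) by assumption.
  rewrite PS_unit0, Cmult_1_r, !re_plus, re_RtoC. ring.
Qed.

Lemma carath_pos (alpha : R) (A B : nat -> C) (e : C) :
  normalized alpha A B -> Cmod e = 1 ->
  forall z, in_disk z -> 0 <= Re (PS (carath alpha A B e) z).
Proof.
  intros H He z Hz. rewrite (PS_carath alpha A B e z H Hz).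
  pose proof (nRe _ _ _ H z Hz) as Hre.
  pose proof (re_le_Cmod (e * PS (dps B) z)) as Hr.
  rewrite Cmod_mult, He, Rmult_1_l in Hr. apply Rabs_le_between in Hr. lra.
Qed.

Lemma carath_0 (alpha : R) (A B : nat -> C) (e : C) :
  normalized alpha A B -> carath alpha A B e 0 = RtoC (1 - alpha).
Proof.
  intros H. unfold carath, dps. rewrite (nA1 _ _ _ H), (nB1 _ _ _ H).
  simpl INR. simpl unit0. rewrite RtoC_minus, RtoC_opp. ring.
Qed.

Lemma aligned_phase (x y : C) : exists e, Cmod e = 1 /\ Cmod (x + e * y) = Cmod x + Cmod y.
Proof.
  destruct (polar_form x) as [wx [Hx Ex]]. destruct (polar_form y) as [wy [Hy Ey]].
  exists (wx * Cconj wy)%C. split; [rewrite Cmod_mult, Cmod_conj, Hx, Hy; ring|].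
  assert (E : (x + wx * Cconj wy * y = RtoC (Cmod x + Cmod y) * wx)%C).
  { rewrite Ex at 1. rewrite Ey at 1. rewrite RtoC_plus.
    replace (wx * Cconj wy * (RtoC (Cmod y) * wy))%C with (wx * RtoC (Cmod y) * (wy * Cconj wy))%C by ring.
    rewrite <- Cmod2_conj, Hy. simpl pow. rewrite !Rmult_1_r. ring. }
  rewrite E, Cmod_mult, Hx, Cmod_R, Rabs_pos_eq; [ring|].
  pose proof (Cmod_ge_0 x). pose proof (Cmod_ge_0 y). lra.
Qed.

(** Choosing the phase [e] for which [|A n + e B n| = |A n| + |B n|] bounds both
    coefficients at once. *)
Lemma coefficient_bound (alpha : R) (A B : nat -> C) (n : nat) :
  normalized alpha A B -> (2 <= n)%nat ->
  Cmod (A n) + Cmod (B n) <= 2 * (1 - alpha) / INR n.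
Proof.
  intros H Hn.
  destruct (aligned_phase (A n) (B n)) as [e [He E]].
  destruct n as [|[|n]]; [lia|lia|].
  pose proof (caratheodory (carath alpha A B e) (S n) (summable_carath _ _ _ e H)
     (carath_pos alpha A B e H He) ltac:(lia)) as Hc.
  rewrite (carath_0 _ _ _ _ H), re_RtoC in Hc.
  unfold carath, dps in Hc. simpl unit0 in Hc.
  replace (RtoC (INR (S (S n))) * A (S (S n)) + e * (RtoC (INR (S (S n))) * B (S (S n))) + RtoC (- alpha) * 0)%C
    with (RtoC (INR (S (S n))) * (A (S (S n)) + e * B (S (S n))))%C in Hc by ring.
  rewrite Cmod_mult, E, Cmod_R, Rabs_pos_eq in Hc by apply pos_INR.
  assert (Hp : 0 < INR (S (S n))) by (apply lt_0_INR; lia).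
  apply Rmult_le_reg_r with (INR (S (S n))); [exact Hp|].
  unfold Rdiv. rewrite (Rmult_assoc (2 * (1 - alpha))), Rinv_l by lra. lra.
Qed.

(** Harnack's inequality for the phase [e] that makes [e g'(z)] equal to [- |g'(z)|].  The
    left-hand side is [alpha + (1 - alpha) (1 - |z|) / (1 + |z|)]. *)
Lemma distortion (alpha : R) (A B : nat -> C) (z : C) :
  normalized alpha A B -> in_disk z ->
  1 - 2 * (1 - alpha) * (1 - / (1 + Cmod z)) <= Re (PS (dps A) z) - Cmod (PS (dps B) z).
Proof.
  intros H Hz.
  destruct (opposite_phase (PS (dps B) z)) as [w [Hw E]].
  assert (He : Cmod (Cconj w) = 1) by (rewrite Cmod_conj; exact Hw).
  pose proof (harnack (carath alpha A B (Cconj w)) z (summable_carath _ _ _ _ H)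
     (carath_pos alpha A B _ H He)) as Hh.
  rewrite (carath_0 _ _ _ _ H) in Hh. specialize (Hh eq_refl Hz).
  rewrite (PS_carath _ _ _ _ _ H Hz), (Cmult_comm (Cconj w)), E, !re_RtoC in Hh.
  pose proof (Cmod_ge_0 z).
  apply Rmult_le_reg_r with (1 + Cmod z); [lra|].
  replace ((1 - 2 * (1 - alpha) * (1 - / (1 + Cmod z))) * (1 + Cmod z))
    with ((1 - 2 * (1 - alpha)) * (1 + Cmod z) + 2 * (1 - alpha)) by (field; lra).
  lra.
Qed.

(** * Growth along segments and the covering theorem *)

Definition harm (A B : nat -> C) : C -> C := harmonic_map (PS A) (PS B).

(** The Euclidean inner product of the plane. *)
Definition dot (x y : C) : R := Re (x * Cconj y).

Lemma dot_self (x : C) : dot x x = Cmod x ^ 2.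
Proof. unfold dot. rewrite <- Cmod2_conj, re_RtoC. reflexivity. Qed.

Lemma dot_le (x y : C) : dot x y <= Cmod x * Cmod y.
Proof.
  unfold dot. eapply Rle_trans; [apply Re_le_Cmod|].
  rewrite Cmod_mult, Cmod_conj. lra.
Qed.

Lemma nondecreasing_of_derive (f df : R -> R) :
  (forall s, 0 <= s <= 1 -> is_derive f s (df s)) ->
  (forall s, 0 <= s <= 1 -> 0 <= df s) -> f 0 <= f 1.
Proof.
  intros Hd Hp.
  destruct (MVT_gen f 0 1 df) as [c [Hc E]].
  - intros s Hs. rewrite Rmin_left, Rmax_right in Hs by lra. apply Hd. lra.
  - intros s Hs. rewrite Rmin_left, Rmax_right in Hs by lra.
    apply continuity_pt_filterlim.
    apply (ex_derive_continuous (K := R_AbsRing) (V := R_NormedModule)).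
    eexists. now apply Hd.
  - rewrite Rmin_left, Rmax_right in Hc by lra. specialize (Hp c Hc). lra.
Qed.

Lemma in_disk_segment (r : R) (w d : C) (s : R) :
  Cmod w <= r -> Cmod (w + d) <= r -> 0 <= s <= 1 -> Cmod (w + RtoC s * d) <= r.
Proof.
  intros H1 H2 Hs.
  replace (w + RtoC s * d)%C with (RtoC (1 - s) * w + RtoC s * (w + d))%C
    by (rewrite RtoC_minus; ring).
  eapply Rle_trans; [apply Cmod_triangle|].
  rewrite !Cmod_mult, !Cmod_R, !Rabs_pos_eq by lra. nra.
Qed.

(** The derivative of [Re (f (w + s d) * conj d)] in [s] is
    [|d|^2 Re h' + Re (d^2 g')], at least [|d|^2 (Re h' - |g'|)]. *)
Lemma segment_growth (A B : nat -> C) (w d : C) (k dk : R -> R) :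
  summable A -> summable B ->
  (forall s, 0 <= s <= 1 -> in_disk (w + RtoC s * d)%C) ->
  (forall s, 0 <= s <= 1 -> is_derive k s (dk s)) ->
  (forall s, 0 <= s <= 1 ->
     dk s <= Re (PS (dps A) (w + RtoC s * d)) - Cmod (PS (dps B) (w + RtoC s * d))) ->
  Cmod d ^ 2 * (k 1 - k 0) <= dot (harm A B (w + d) - harm A B w) d.
Proof.
  intros HA HB Hin Hk Hlow.
  set (f := fun s => Re (Cconj d * PS A (w + RtoC s * d)) + Re (d * PS B (w + RtoC s * d))
                 - Cmod d ^ 2 * k s).
  assert (H : f 0 <= f 1).
  { apply (nondecreasing_of_derive f (fun s =>
      Re (Cconj d * (PS (dps A) (w + RtoC s * d) * d))
      + Re (d * (PS (dps B) (w + RtoC s * d) * d)) - Cmod d ^ 2 * dk s)).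
    - intros s Hs. unfold f.
      apply (is_derive_minus (K := R_AbsRing) (V := R_NormedModule)).
      + apply (is_derive_plus (K := R_AbsRing) (V := R_NormedModule));
        apply PS_derive_line; auto.
      + apply is_derive_scal. now apply Hk.
    - intros s Hs. specialize (Hlow s Hs).
      set (p := PS (dps A) (w + RtoC s * d)) in *. set (q := PS (dps B) (w + RtoC s * d)) in *.
      replace (Cconj d * (p * d))%C with (RtoC (Cmod d ^ 2) * p)%C
        by (rewrite Cmod2_conj; ring).
      rewrite re_scal_l.
      pose proof (re_le_Cmod (d * (q * d))) as Hr. apply Rabs_le_between in Hr.
      rewrite !Cmod_mult in Hr.
      assert (0 <= Cmod d ^ 2 * (Re p - Cmod q - dk s))
        by (apply Rmult_le_pos; [apply pow2_ge_0 | lra]).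
      simpl pow in *. lra. }
  unfold f in H.
  replace (w + RtoC 0 * d)%C with w in H by ring.
  replace (w + RtoC 1 * d)%C with (w + d)%C in H by ring.
  unfold dot, harm, harmonic_map.
  set (P1 := PS A (w + d)) in *. set (P0 := PS A w) in *.
  set (Q1 := PS B (w + d)) in *. set (Q0 := PS B w) in *.
  replace (Re ((P1 + Cconj Q1 - (P0 + Cconj Q0)) * Cconj d)) with
    (Re (Cconj d * P1) + Re (d * Q1) - (Re (Cconj d * P0) + Re (d * Q0))).
  - lra.
  - destruct d, P1, P0, Q1, Q0. simpl. ring.
Qed.

Lemma ratio_incr (s t : R) : 0 <= s <= t -> 1 - / (1 + s) <= 1 - / (1 + t).
Proof.
  intros H. assert (/ (1 + t) <= / (1 + s)) by (apply Rinv_le_contravar; lra). lra.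
Qed.

Lemma strongly_monotone (alpha : R) (A B : nat -> C) (r : R) (z w : C) :
  0 <= alpha < 1 -> normalized alpha A B -> r < 1 -> Cmod z <= r -> Cmod w <= r ->
  (1 - 2 * (1 - alpha) * (1 - / (1 + r))) * Cmod (z - w) ^ 2
    <= dot (harm A B z - harm A B w) (z - w).
Proof.
  intros Ha H Hr Hz Hw.
  set (m := 1 - 2 * (1 - alpha) * (1 - / (1 + r))).
  assert (Hin : forall s, 0 <= s <= 1 -> Cmod (w + RtoC s * (z - w)) <= r).
  { intros s Hs. apply in_disk_segment; [exact Hw| |exact Hs].
    now replace (w + (z - w))%C with z by ring. }
  pose proof (segment_growth A B w (z - w)%C (fun s => m * s) (fun _ => m)
    (nA _ _ _ H) (nB _ _ _ H)) as Hs.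
  replace (w + (z - w))%C with z in Hs by ring.
  replace (m * Cmod (z - w) ^ 2) with (Cmod (z - w) ^ 2 * (m * 1 - m * 0)) by ring.
  apply Hs.
  - intros s Hs1. specialize (Hin s Hs1). unfold in_disk. lra.
  - intros s _. auto_derive; [trivial|ring].
  - intros s Hs1. specialize (Hin s Hs1).
    eapply Rle_trans; [|apply (distortion alpha); [exact H|unfold in_disk; lra]].
    unfold m.
    pose proof (ratio_incr (Cmod (w + RtoC s * (z - w))) r (conj (Cmod_ge_0 _) Hin)).
    nra.
Qed.

(** The integral from [0] to [r] of the distortion bound. *)
Definition lower_growth (alpha r : R) : R := r - 2 * (1 - alpha) * (r - ln (1 + r)).

Lemma radial_growth (alpha : R) (A B : nat -> C) (z : C) :
  0 <= alpha < 1 -> normalized alpha A B -> in_disk z ->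
  Cmod z * lower_growth alpha (Cmod z) <= dot (harm A B z) z.
Proof.
  intros Ha H Hz. unfold in_disk in Hz.
  pose proof (Cmod_ge_0 z) as H0. set (r := Cmod z) in *.
  assert (E0 : harm A B 0 = RtoC 0).
  { unfold harm, harmonic_map. rewrite !PS_0, (nA0 _ _ _ H), (nB0 _ _ _ H). Ccomp. }
  destruct (Req_dec r 0) as [Hr|Hr].
  { assert (z = RtoC 0) by (now apply Cmod_eq_0). subst z.
    rewrite E0. unfold dot. rewrite Hr. rewrite Cmult_0_l, re_RtoC. lra. }
  assert (Hseg : forall s, 0 <= s <= 1 -> Cmod (0 + RtoC s * z) = s * r).
  { intros s Hs. rewrite Cplus_0_l, Cmod_mult, Cmod_R, Rabs_pos_eq by lra. reflexivity. }
  pose proof (segment_growth A B 0 z (fun s => s - 2 * (1 - alpha) * (s - ln (1 + r * s) / r))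
    (fun s => 1 - 2 * (1 - alpha) * (1 - / (1 + r * s))) (nA _ _ _ H) (nB _ _ _ H)) as Hs.
  rewrite Cplus_0_l, E0 in Hs.
  replace (harm A B z - 0)%C with (harm A B z) in Hs by ring.
  eapply Rle_trans; [|apply Hs].
  - fold r. unfold lower_growth. rewrite Rmult_0_r, Rplus_0_r, ln_1, !Rmult_1_r.
    right. field. exact Hr.
  - intros s Hs1. unfold in_disk. rewrite Hseg by exact Hs1. nra.
  - intros s Hs1. assert (0 < 1 + r * s) by nra. auto_derive; [assumption|]. field. lra.
  - intros s Hs1. rewrite Rmult_comm with (r1 := r).
    rewrite <- (Hseg s Hs1). apply distortion; [exact H|].
    unfold in_disk. rewrite Hseg by exact Hs1. nra.
Qed.

(** Banach's theorem, the iterates being summed as a series of complex numbers. *)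
Lemma disk_fixed_point (r q : R) (T : C -> C) :
  0 <= r -> 0 <= q < 1 ->
  (forall z, Cmod z <= r -> Cmod (T z) <= r) ->
  (forall z w, Cmod z <= r -> Cmod w <= r -> Cmod (T z - T w) <= q * Cmod (z - w)) ->
  exists z, Cmod z <= r /\ T z = z.
Proof.
  intros Hr Hq Hmap Hc.
  set (u := fix u (n : nat) : C := match n with O => RtoC 0 | S n => T (u n) end).
  assert (Hu : forall n, Cmod (u n) <= r).
  { induction n as [|n IH]; simpl; [rewrite Cmod_0; exact Hr | now apply Hmap]. }
  set (a := fun n => (u (S n) - u n)%C).
  assert (Ha : forall n, Cmod (a n) <= Cmod (a 0%nat) * q ^ n).
  { induction n as [|n IH]; [simpl; lra|].
    unfold a at 1. change (u (S (S n))) with (T (u (S n))). change (u (S n)) with (T (u n)) at 2.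
    eapply Rle_trans; [apply Hc; apply Hu|]. fold (a n). simpl pow.
    apply Rmult_le_compat_l with (r := q) in IH; lra. }
  assert (Hex : @ex_series C_AbsRing C_CompleteNormedModule a).
  { apply (@ex_series_le C_AbsRing C_CompleteNormedModule) with (b := fun n => Cmod (a 0%nat) * q ^ n).
    - exact Ha.
    - apply (@ex_series_scal R_AbsRing R_NormedModule). apply ex_series_geom.
      rewrite Rabs_pos_eq; lra. }
  destruct Hex as [l Hl].
  assert (Hsum : forall n, Csum a n = u (S n)).
  { induction n as [|n IH].
    - rewrite sum_O. unfold a. change (u 0%nat) with (RtoC 0). asC. ring.
    - rewrite Csum_Sn, IH. unfold a. asC. ring. }
  assert (Hlim : forall eps, 0 < eps -> exists n, Cmod (l - u n) < eps /\ Cmod (l - u (S n)) < eps).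
  { intros eps He. destruct (is_Cseries_eps a l Hl eps He) as [N HN].
    exists (S N). rewrite <- !Hsum. split; apply HN; lia. }
  assert (Hlr : Cmod l <= r).
  { apply (le_of_eps _ _ 1). intros e He. destruct (Hlim e He) as [n [Hn _]].
    specialize (Hu n). replace l with ((l - u n) + u n)%C by ring.
    eapply Rle_trans; [apply Cmod_triangle|]. lra. }
  exists l. split; [exact Hlr|].
  apply Ceq_minus. apply Cmod_eq_0. apply Rle_antisym; [|apply Cmod_ge_0].
  apply (le_of_eps _ _ 2). intros e He. destruct (Hlim e He) as [n [Hn Hn1]].
  replace (T l - l)%C with ((T l - T (u n)) + (u (S n) - l))%C
    by (change (u (S n)) with (T (u n)); ring).
  eapply Rle_trans; [apply Cmod_triangle|].
  rewrite (Cmod_minus_sym (u (S n))).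
  specialize (Hc l (u n) Hlr (Hu n)). pose proof (Cmod_ge_0 (l - u n)). nra.
Qed.

Definition proj_disk (r : R) (x : C) : C :=
  if Rle_dec (Cmod x) r then x else (RtoC (r / Cmod x) * x)%C.

(** The nearest-point projection moves a point along its own ray, and only when it lands on
    the boundary circle. *)
Lemma proj_disk_spec (r : R) (x : C) : 0 < r ->
  Cmod (proj_disk r x) <= r /\
  exists kappa, 0 <= kappa /\ (x - proj_disk r x)%C = (RtoC kappa * proj_disk r x)%C /\
    (kappa = 0 \/ Cmod (proj_disk r x) = r).
Proof.
  intros Hr. unfold proj_disk. destruct (Rle_dec (Cmod x) r) as [H|H].
  - split; [exact H|]. exists 0. split; [lra|]. split; [ring | now left].
  - assert (Hx : r < Cmod x) by lra.
    assert (E : Cmod (RtoC (r / Cmod x) * x) = r).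
    { rewrite Cmod_mult, Cmod_R, Rabs_pos_eq; [field; lra|].
      left. apply Rdiv_lt_0_compat; lra. }
    split; [lra|]. exists (Cmod x / r - 1). split.
    + assert (1 <= Cmod x / r); [|lra].
      apply Rmult_le_reg_r with r; [exact Hr|]. unfold Rdiv.
      rewrite Rmult_assoc, Rinv_l by lra. lra.
    + split; [|now right].
      rewrite Cmult_assoc, <- RtoC_mult.
      replace ((Cmod x / r - 1) * (r / Cmod x)) with (1 - r / Cmod x) by (field; lra).
      rewrite RtoC_minus. ring.
Qed.

Lemma proj_disk_variational (r : R) (x q : C) : 0 < r -> Cmod q <= r ->
  dot (x - proj_disk r x) (q - proj_disk r x) <= 0.
Proof.
  intros Hr Hq. destruct (proj_disk_spec r x Hr) as [_ [k [Hk [E Hor]]]].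
  set (p := proj_disk r x) in *. rewrite E.
  assert (E2 : dot (RtoC k * p) (q - p) = k * (dot p q - Cmod p ^ 2)).
  { rewrite <- dot_self. unfold dot. destruct p, q. simpl. ring. }
  rewrite E2. destruct Hor as [->|Hp]; [lra|].
  pose proof (dot_le p q) as Hd. rewrite Hp in *.
  assert (r * Cmod q <= r * r) by (apply Rmult_le_compat_l; lra). simpl pow. nra.
Qed.

Lemma sqr_le (a b : R) : 0 <= b -> a ^ 2 <= b ^ 2 -> a <= b.
Proof. intros Hb H. apply Rnot_lt_le. intros Hlt. simpl in H. nra. Qed.

(** Adding the variational inequalities of the two projections bounds [|p - q|^2] by the
    inner product of [x - y] and [p - q]. *)
Lemma proj_disk_nonexpansive (r : R) (x y : C) : 0 < r ->
  Cmod (proj_disk r x - proj_disk r y) <= Cmod (x - y).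
Proof.
  intros Hr.
  pose proof (proj_disk_variational r x (proj_disk r y) Hr (proj1 (proj_disk_spec r y Hr))) as H1.
  pose proof (proj_disk_variational r y (proj_disk r x) Hr (proj1 (proj_disk_spec r x Hr))) as H2.
  set (p := proj_disk r x) in *. set (q := proj_disk r y) in *.
  assert (H3 : Cmod (p - q) ^ 2 <= dot (x - y) (p - q)).
  { rewrite <- dot_self. revert H1 H2. unfold dot. destruct p, q, x, y. simpl. lra. }
  pose proof (dot_le (x - y) (p - q)) as H4.
  pose proof (Cmod_ge_0 (p - q)) as H5. simpl in H3.
  destruct (Req_dec (Cmod (p - q)) 0) as [->|Hn]; [apply Cmod_ge_0|].
  apply Rmult_le_reg_r with (Cmod (p - q)); lra.
Qed.

Lemma harm_lipschitz (A B : nat -> C) (r : R) :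
  summable A -> summable B -> 0 <= r < 1 -> exists K, 0 < K /\
  forall z w, Cmod z <= r -> Cmod w <= r ->
    Cmod (harm A B z - harm A B w) <= K * Cmod (z - w).
Proof.
  intros HA HB Hr.
  destruct (PS_lipschitz A r HA Hr) as [K1 [HK1 H1]].
  destruct (PS_lipschitz B r HB Hr) as [K2 [HK2 H2]].
  exists (K1 + K2). split; [lra|]. intros z w Hz Hw.
  unfold harm, harmonic_map.
  replace (PS A z + Cconj (PS B z) - (PS A w + Cconj (PS B w)))%C
    with ((PS A z - PS A w) + Cconj (PS B z - PS B w))%C by (rewrite Cminus_conj; ring).
  eapply Rle_trans; [apply Cmod_triangle|]. rewrite Cmod_conj.
  specialize (H1 w z Hw Hz). specialize (H2 w z Hw Hz). lra.
Qed.

Lemma ln2_bounds : / 2 < ln 2 < 1.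
Proof.
  split; [apply ln_lt_2|].
  pose proof (exp_ineq1 1 ltac:(lra)) as He. rewrite <- (ln_exp 1).
  apply ln_increasing; lra.
Qed.

Lemma ln_two_le (r : R) : 0 <= r <= 1 -> ln 2 - (1 - r) <= ln (1 + r).
Proof.
  intros Hr.
  assert (H : ln (2 / (1 + r)) <= 1 - r).
  { rewrite <- (ln_exp (1 - r)). apply ln_le; [apply Rdiv_lt_0_compat; lra|].
    eapply Rle_trans; [|apply exp_ineq1_le].
    apply Rmult_le_reg_r with (1 + r); [lra|]. unfold Rdiv.
    rewrite Rmult_assoc, Rinv_l by lra. nra. }
  unfold Rdiv in H. rewrite ln_mult, ln_Rinv in H; [lra|lra|lra|apply Rinv_0_lt_compat; lra].
Qed.

(** The value of [lower_growth] at [r = 1]. *)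
Definition covering_radius (alpha : R) : R := 1 + 2 * (1 - alpha) * (ln 2 - 1).

Lemma covering_radius_bounds (alpha : R) : 0 <= alpha < 1 -> 0 <= covering_radius alpha < 1.
Proof. intros Ha. pose proof ln2_bounds. unfold covering_radius. nra. Qed.

(** Solve the variational inequality on a closed disk of radius [r] close to [1]: strong
    monotonicity and the Lipschitz bound make [z - lam (f z - w)], projected to the disk, a
    contraction.  Its fixed point satisfies [w = f z + (k / lam) z] with [k >= 0], and
    [k > 0] only if [|z| = r]; but then [|w| >= Re (f z * conj z) / r >= L(r)], which
    exceeds [|w|] for [r] close to [1]. *)
Lemma covering_theorem (alpha : R) (A B : nat -> C) (w : C) :
  0 <= alpha < 1 -> normalized alpha A B -> Cmod w < covering_radius alpha ->
  exists z, in_disk z /\ harm A B z = w.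
Proof.
  intros Ha H Hw.
  set (L := covering_radius alpha) in *.
  assert (HL : L < 1) by (now apply covering_radius_bounds).
  pose proof (Cmod_ge_0 w) as Hw0.
  (* [L - lower_growth alpha r <= 1 - r] for every [r] in the unit interval *)
  set (r := 1 - (L - Cmod w) / 2).
  assert (Hr : 0 < r < 1) by (unfold r; lra).
  assert (Hlow : Cmod w < lower_growth alpha r).
  { pose proof (ln_two_le r ltac:(lra)) as Hl. unfold lower_growth.
    apply Rlt_le_trans with (r - 2 * (1 - alpha) * (1 - ln 2)).
    - unfold L, covering_radius in *. unfold r in *. lra.
    - assert (0 <= (1 - alpha) * (ln (1 + r) - (ln 2 - (1 - r)))) by (apply Rmult_le_pos; lra).
      lra. }
  set (m := 1 - 2 * (1 - alpha) * (1 - / (1 + r))).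
  assert (Hm : 0 < m).
  { unfold m. assert (/ 2 < / (1 + r)) by (apply Rinv_lt_contravar; lra). nra. }
  destruct (harm_lipschitz A B r (nA _ _ _ H) (nB _ _ _ H) ltac:(lra)) as [K0 [HK0 HLip0]].
  set (K := Rmax K0 m).
  assert (HK : 0 < K) by (unfold K; apply Rlt_le_trans with m; [exact Hm|apply Rmax_r]).
  assert (HmK : m <= K) by apply Rmax_r.
  assert (HLip : forall z v, Cmod z <= r -> Cmod v <= r ->
      Cmod (harm A B z - harm A B v) <= K * Cmod (z - v)).
  { intros z v Hz Hv. eapply Rle_trans; [now apply HLip0|].
    apply Rmult_le_compat_r; [apply Cmod_ge_0|apply Rmax_l]. }
  (* this step minimizes the squared contraction factor [1 - 2 lam m + lam^2 K^2] *)
  set (lam := m / K ^ 2).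
  assert (HK2 : 0 < K ^ 2) by (now apply pow_lt).
  assert (Hlam : 0 < lam) by (now apply Rdiv_lt_0_compat).
  set (q2 := 1 - m ^ 2 / K ^ 2).
  assert (Hq2 : 0 <= q2 < 1).
  { unfold q2. assert (m ^ 2 <= K ^ 2) by (apply pow_incr; lra).
    assert (0 < m ^ 2 / K ^ 2) by (apply Rdiv_lt_0_compat; [now apply pow_lt|lra]).
    assert (m ^ 2 / K ^ 2 <= 1).
    { apply Rmult_le_reg_r with (K ^ 2); [lra|]. unfold Rdiv.
      rewrite Rmult_assoc, Rinv_l by lra. lra. }
    lra. }
  set (T := fun z => proj_disk r (z - RtoC lam * (harm A B z - w))%C).
  destruct (disk_fixed_point r (sqrt q2) T) as [z [Hz Tz]].
  - lra.
  - split; [apply sqrt_pos|]. rewrite <- sqrt_1. apply sqrt_lt_1; lra.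
  - intros z _. apply proj_disk_spec. lra.
  - intros z v Hz Hv. unfold T.
    eapply Rle_trans; [apply proj_disk_nonexpansive; lra|].
    set (D := (z - v)%C). set (DF := (harm A B z - harm A B v)%C).
    replace (z - RtoC lam * (harm A B z - w) - (v - RtoC lam * (harm A B v - w)))%C
      with (D - RtoC lam * DF)%C by (unfold D, DF; ring).
    apply sqr_le; [apply Rmult_le_pos; [apply sqrt_pos|apply Cmod_ge_0]|].
    rewrite Rpow_mult_distr, pow2_sqrt by lra.
    pose proof (strongly_monotone alpha A B r z v Ha H ltac:(lra) Hz Hv) as Hmon.
    fold m D DF in Hmon.
    pose proof (HLip z v Hz Hv) as Hl. fold D DF in Hl.
    assert (E : Cmod (D - RtoC lam * DF) ^ 2 = Cmod D ^ 2 - 2 * lam * dot DF D + lam ^ 2 * Cmod DF ^ 2).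
    { rewrite <- !dot_self. unfold dot. destruct D, DF. simpl. ring. }
    rewrite E.
    assert (Hl2 : Cmod DF ^ 2 <= K ^ 2 * Cmod D ^ 2).
    { rewrite <- Rpow_mult_distr. apply pow_incr. split; [apply Cmod_ge_0|exact Hl]. }
    assert (lam * (m * Cmod D ^ 2) <= lam * dot DF D) by (apply Rmult_le_compat_l; lra).
    assert (lam ^ 2 * Cmod DF ^ 2 <= lam ^ 2 * (K ^ 2 * Cmod D ^ 2))
      by (apply Rmult_le_compat_l; [apply pow2_ge_0|exact Hl2]).
    assert (E2 : lam ^ 2 * (K ^ 2 * Cmod D ^ 2) = lam * m * Cmod D ^ 2)
      by (unfold lam; field; lra).
    assert (E3 : q2 * Cmod D ^ 2 = Cmod D ^ 2 - lam * m * Cmod D ^ 2)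
      by (unfold q2, lam; field; lra).
    lra.
  - assert (Hzd : in_disk z) by (unfold in_disk; lra).
    exists z. split; [exact Hzd|].
    unfold T in Tz.
    destruct (proj_disk_spec r (z - RtoC lam * (harm A B z - w))%C ltac:(lra)) as [_ [k [Hk [E Hor]]]].
    rewrite Tz in E, Hor.
    assert (Hl' : RtoC lam <> 0) by (intros E0; apply RtoC_inj in E0; lra).
    assert (Ew : w = (harm A B z + RtoC (k / lam) * z)%C).
    { rewrite RtoC_div by lra.
      replace w with (((z - RtoC lam * (harm A B z - w) - z) / RtoC lam) + harm A B z)%C
        by (field; exact Hl').
      rewrite E. field. exact Hl'. }
    destruct Hor as [->|Hzr].
    + rewrite Ew. unfold Rdiv. rewrite Rmult_0_l. ring.
    + exfalso.
      pose proof (radial_growth alpha A B z Ha H Hzd) as Hrad. rewrite Hzr in Hrad.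
      assert (Hwz : dot w z = dot (harm A B z) z + k / lam * Cmod z ^ 2).
      { rewrite Ew at 1. rewrite <- dot_self. unfold dot.
        destruct (harm A B z), z. simpl. ring. }
      pose proof (dot_le w z) as Hd. rewrite Hzr in Hd, Hwz.
      assert (0 <= k / lam * r ^ 2).
      { apply Rmult_le_pos; [|apply pow2_ge_0].
        apply Rmult_le_pos; [exact Hk|left; now apply Rinv_0_lt_compat]. }
      assert (r * Cmod w < r * lower_growth alpha r) by (apply Rmult_lt_compat_l; lra).
      lra.
Qed.

(** * The area of the image *)

Lemma cross_term_disk (c : nat -> C) (a : C) (n M : nat) (r : R) :
  0 <= r -> (M < n)%nat ->
  is_disk_int r (fun x y => Re (a * (x, y) ^ n * Cconj (Csum (fun k => c k * (x, y) ^ k)%C M))) 0.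
Proof.
  intros Hr. induction M as [|M IH]; intros HM.
  - pose proof (cmonomial_disk n 0 (a * Cconj (c 0%nat))%C r Hr) as H.
    destruct (Nat.eq_dec n 0) as [E|_]; [lia|].
    eapply is_disk_int_ext; [|exact H]. intros x y. cbv beta. f_equal.
    rewrite sum_O. rewrite !Cmult_conj, Cpow_conj. ring.
  - pose proof (cmonomial_disk n (S M) (a * Cconj (c (S M)))%C r Hr) as H.
    destruct (Nat.eq_dec n (S M)) as [E|_]; [lia|].
    replace 0 with (0 + 0) by ring.
    eapply is_disk_int_ext; [|apply is_disk_int_plus; [apply IH; lia|exact H]].
    intros x y. cbv beta. rewrite <- re_plus. f_equal.
    rewrite Csum_Sn, Cplus_conj, Cmult_conj, Cpow_conj. ring.
Qed.

Lemma Cmod_plus_sqr (p q : C) : Cmod (p + q) ^ 2 = Cmod p ^ 2 + Cmod q ^ 2 + 2 * Re (q * Cconj p).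
Proof. rewrite !Cmod2_alt. destruct p, q. simpl. ring. Qed.

Lemma poly_parseval (c : nat -> C) (N : nat) (r : R) : 0 <= r ->
  is_disk_int r (fun x y => Cmod (Csum (fun k => c k * (x, y) ^ k)%C N) ^ 2)
    (sum_n (fun n => PI * (Cmod (c n) ^ 2 * r ^ (2 * n + 2) / INR (n + 1))) N).
Proof.
  intros Hr.
  assert (H1 : forall n, is_disk_int r (fun x y => Cmod (c n * (x, y) ^ n) ^ 2)
     (PI * (Cmod (c n) ^ 2 * r ^ (2 * n + 2) / INR (n + 1)))).
  { intros n. pose proof (cmonomial_disk n n (RtoC (Cmod (c n) ^ 2)) r Hr) as H.
    destruct (Nat.eq_dec n n) as [_|E]; [|lia].
    rewrite re_RtoC in H.
    replace (PI * (Cmod (c n) ^ 2 * r ^ (2 * n + 2) / INR (n + 1)))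
      with (PI * Cmod (c n) ^ 2 * r ^ (2 * n + 2) / INR (n + 1)) by (unfold Rdiv; ring).
    eapply is_disk_int_ext; [|exact H]. intros x y. cbv beta.
    rewrite re_scal_l, <- Cpow_conj, <- Cmod2_conj, re_RtoC, Cmod_mult. ring. }
  induction N as [|N IH].
  - rewrite sum_O. eapply is_disk_int_ext; [|apply H1]. intros x y. now rewrite sum_O.
  - rewrite sum_Sn.
    match goal with |- is_disk_int _ _ (plus ?u ?v) => replace (plus u v) with (u + v + 2 * 0) by (unfold plus; simpl; ring) end.
    eapply is_disk_int_ext; [|apply is_disk_int_plus; [apply is_disk_int_plus; [exact IH|apply H1]|
      apply is_disk_int_scal; apply (cross_term_disk c (c (S N)) (S N) N r Hr); lia]].
    intros x y. cbv beta. rewrite Csum_Sn, Cmod_plus_sqr. reflexivity.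
Qed.

Lemma chord_le (r x : R) : 0 <= r -> chord r x <= r.
Proof.
  intros Hr. unfold chord. rewrite <- (sqrt_pow2 r) at 2 by exact Hr.
  apply sqrt_le_1_alt. pose proof (pow2_ge_0 x). lra.
Qed.

Lemma chord_spec (r x y : R) :
  0 <= r -> Rabs x <= r -> - chord r x <= y <= chord r x -> Cmod (x, y) <= r.
Proof.
  intros Hr Hx Hy. unfold Cmod. simpl fst; simpl snd.
  rewrite <- (sqrt_pow2 r) by exact Hr. apply sqrt_le_1_alt.
  assert (Hx2 : x ^ 2 <= r ^ 2) by (apply pow_maj_Rabs; exact Hx).
  assert (Hc : chord r x ^ 2 = r ^ 2 - x ^ 2) by (apply pow2_sqrt; lra).
  assert (y ^ 2 <= chord r x ^ 2) by (simpl; nra). lra.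
Qed.

Lemma chord_out (r x : R) : 0 <= r -> r < Rabs x -> chord r x = 0.
Proof.
  intros Hr Hx. unfold chord. apply sqrt_neg_0.
  rewrite <- (pow2_abs x). assert (r ^ 2 <= Rabs x ^ 2) by (apply pow_incr; lra). lra.
Qed.

Lemma chord_nonneg (r x : R) : 0 <= chord r x.
Proof. apply sqrt_pos. Qed.

(** Uniform convergence on the disk makes the section integrals converge uniformly on the
    whole line, because these integrals vanish off the disk. *)
Lemma is_disk_int_limit (r : R) (Fn : nat -> R -> R -> R) (F : R -> R -> R)
    (vn : nat -> R) (v : R) :
  0 <= r ->
  (forall n, is_disk_int r (Fn n) (vn n)) ->
  (forall x, Rabs x <= r -> ex_RInt (F x) (- chord r x) (chord r x)) ->
  (forall eps, 0 < eps -> exists N, forall n, (N <= n)%nat -> forall x y,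
     Cmod (x, y) <= r -> Rabs (Fn n x y - F x y) <= eps) ->
  is_lim_seq vn v -> is_disk_int r F v.
Proof.
  intros Hr Hn HF Hunif Hv.
  assert (HF' : forall x, ex_RInt (F x) (- chord r x) (chord r x)).
  { intros x. destruct (Rle_lt_dec (Rabs x) r) as [H|H]; [now apply HF|].
    rewrite chord_out by assumption. rewrite Ropp_0. apply ex_RInt_point. }
  split; [exact HF'|].
  set (Phi := fun x => RInt (F x) (- chord r x) (chord r x)).
  set (Phin := fun n x => RInt (Fn n x) (- chord r x) (chord r x)).
  destruct (filterlim_RInt (V := R_CompleteNormedModule) Phin (- r) r eventually _ Phi vn) as [I [H1 H2]].
  - intros n. apply (Hn n).
  - apply filterlim_locally. intros eps.
    destruct (Hunif (eps / (2 * r + 1)) ltac:(apply Rdiv_lt_0_compat; [apply cond_pos|lra])) as [N HN].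
    exists N. intros n Hnn x.
    change (Rabs (Phin n x - Phi x) < eps).
    unfold Phin, Phi.
    destruct (Rle_lt_dec (Rabs x) r) as [Hx|Hx].
    + rewrite <- (RInt_minus (V := R_CompleteNormedModule) (Fn n x) (F x));
        [|apply (Hn n)|apply HF'].
      pose proof (chord_nonneg r x) as Hc0. pose proof (chord_le r x Hr) as Hc1.
      eapply Rle_lt_trans.
      * apply abs_RInt_le_const with (M := eps / (2 * r + 1)).
        -- lra.
        -- apply (ex_RInt_minus (V := R_NormedModule)); [apply (Hn n)|apply HF'].
        -- intros y Hy. apply HN; [exact Hnn|]. now apply chord_spec.
      * apply Rle_lt_trans with (2 * r * (eps / (2 * r + 1))).
        { apply Rmult_le_compat_r; [|lra].
          left. apply Rdiv_lt_0_compat; [apply cond_pos|lra]. }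
        pose proof (cond_pos eps).
        apply Rmult_lt_reg_r with (2 * r + 1); [lra|].
        replace (2 * r * (eps / (2 * r + 1)) * (2 * r + 1)) with (2 * r * eps) by (field; lra).
        lra.
    + rewrite chord_out by assumption. rewrite Ropp_0, !RInt_point, Rminus_diag.
      rewrite Rabs_R0. apply cond_pos.
  - assert (E : I = v).
    { assert (is_lim_seq vn I) by exact H1.
      apply is_lim_seq_unique in H. apply is_lim_seq_unique in Hv.
      rewrite H in Hv. now injection Hv. }
    rewrite <- E. exact H2.
Qed.

Lemma PS_vertical_continuous (c : nat -> C) (x y : R) :
  summable c -> in_disk (x, y) -> continuous (fun t => Cmod (PS c (x, t)) ^ 2) y.
Proof.
  intros Hc Hz.
  assert (E : forall t, (RtoC x + RtoC t * Ci)%C = (x, t)) by (intros t; Ccomp).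
  apply continuous_ext with (fun t => Re (1 * PS c (RtoC x + RtoC t * Ci)) ^ 2
                                 + Re (- Ci * PS c (RtoC x + RtoC t * Ci)) ^ 2).
  { intros t. rewrite E.
    assert (E2 : forall p : C, Re (1 * p) ^ 2 + Re (- Ci * p) ^ 2 = Cmod p ^ 2)
      by (intros [p q]; rewrite Cmod2_alt; simpl; ring).
    apply E2. }
  apply (ex_derive_continuous (K := R_AbsRing) (V := R_NormedModule)).
  assert (Hd : in_disk (RtoC x + RtoC y * Ci)%C) by (rewrite E; exact Hz).
  apply (ex_derive_plus (K := R_AbsRing) (V := R_NormedModule));
    apply ex_derive_pow; eexists; now apply PS_derive_line.
Qed.

Lemma square_summable (c : nat -> C) (r : R) : summable c -> 0 <= r < 1 ->
  ex_series (fun n => Cmod (c n) ^ 2 * r ^ (2 * n + 2) / INR (n + 1)).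
Proof.
  intros Hc Hr.
  destruct (is_Cseries_bounded _ _ (PS_correct c (RtoC r) Hc (in_disk_R r Hr))) as [B HB].
  apply (@ex_series_le R_AbsRing R_CompleteNormedModule) with (b := fun n => B * (Cmod (c n) * r ^ n)).
  - intros n. specialize (HB n). rewrite Cmod_mult, Cmod_pow, Cmod_R, Rabs_pos_eq in HB by lra.
    assert (Hp : 0 <= Cmod (c n) * r ^ n) by (apply Rmult_le_pos; [apply Cmod_ge_0|apply pow_le; lra]).
    set (p := Cmod (c n) * r ^ n) in *.
    assert (HI : 1 <= INR (n + 1)) by (rewrite plus_INR; simpl; pose proof (pos_INR n); lra).
    change (Rabs (Cmod (c n) ^ 2 * r ^ (2 * n + 2) / INR (n + 1)) <= B * p).
    replace (Cmod (c n) ^ 2 * r ^ (2 * n + 2) / INR (n + 1)) with (p ^ 2 * (r ^ 2 / INR (n + 1)))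
      by (unfold p; rewrite Rpow_mult_distr, <- pow_mult, pow_add, (Nat.mul_comm n 2); unfold Rdiv; ring).
    assert (Hq : 0 <= r ^ 2 / INR (n + 1) <= 1).
    { split; [apply Rmult_le_pos; [apply pow2_ge_0|left; apply Rinv_0_lt_compat; lra]|].
      apply Rmult_le_reg_r with (INR (n + 1)); [lra|]. unfold Rdiv.
      rewrite Rmult_assoc, Rinv_l by lra. simpl; nra. }
    rewrite Rabs_pos_eq by (apply Rmult_le_pos; [apply pow2_ge_0|lra]).
    apply Rle_trans with (p ^ 2 * 1).
    + apply Rmult_le_compat_l; [apply pow2_ge_0|lra].
    + simpl. rewrite !Rmult_1_r. now apply Rmult_le_compat_r.
  - apply (@ex_series_scal R_AbsRing R_NormedModule). now apply Hc.
Qed.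

Lemma PS_bounded (c : nat -> C) (r : R) : summable c -> 0 <= r < 1 ->
  exists M, 0 < M /\ forall z, Cmod z <= r -> Cmod (PS c z) <= M.
Proof.
  intros Hc Hr. destruct (PS_lipschitz c r Hc Hr) as [K [HK H]].
  exists (K * r + Cmod (c 0%nat) + 1). pose proof (Cmod_ge_0 (c 0%nat)).
  split; [nra|]. intros z Hz.
  specialize (H (RtoC 0) z ltac:(rewrite Cmod_0; lra) Hz). rewrite PS_0 in H.
  replace (z - 0)%C with z in H by ring.
  replace (PS c z) with ((PS c z - c 0%nat) + c 0%nat)%C by ring.
  eapply Rle_trans; [apply Cmod_triangle|]. nra.
Qed.

(** Limit of [poly_parseval]: partial sums converge uniformly on the closed disk of radius
    [r < 1]. *)
Lemma parseval (c : nat -> C) (r : R) : summable c -> 0 <= r < 1 ->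
  is_disk_int r (fun x y => Cmod (PS c (x, y)) ^ 2)
    (PI * Series (fun n => Cmod (c n) ^ 2 * r ^ (2 * n + 2) / INR (n + 1))).
Proof.
  intros Hc Hr.
  eapply is_disk_int_limit; [lra|intros n; apply (poly_parseval c n r); lra| | |].
  - intros x Hx. apply (ex_RInt_continuous (V := R_CompleteNormedModule)).
    intros y Hy. pose proof (chord_nonneg r x).
    rewrite Rmin_left, Rmax_right in Hy by lra.
    apply PS_vertical_continuous; [exact Hc|].
    pose proof (chord_spec r x y ltac:(lra) Hx Hy). unfold in_disk. lra.
  - intros eps Heps.
    destruct (PS_bounded c r Hc Hr) as [M [HM HMb]].
    set (e := Rmin 1 (eps / (2 * M + 1))).
    assert (He : 0 < e) by (apply Rmin_pos; [lra|apply Rdiv_lt_0_compat; lra]).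
    destruct (PS_uniform c r Hc Hr e He) as [N HN].
    exists N. intros n Hn x y Hz. specialize (HN n Hn _ Hz). specialize (HMb _ Hz).
    set (p := PS c (x, y)) in *. set (q := Csum (fun k => c k * (x, y) ^ k)%C n) in *.
    assert (He1 : e <= 1) by apply Rmin_l.
    assert (He2 : e * (2 * M + 1) <= eps).
    { apply Rle_trans with (eps / (2 * M + 1) * (2 * M + 1)).
      - apply Rmult_le_compat_r; [lra|apply Rmin_r].
      - right. field. lra. }
    pose proof (Cmod_ge_0 p) as Hp0. pose proof (Cmod_ge_0 q) as Hq0.
    assert (Hqp : Rabs (Cmod q - Cmod p) <= e).
    { apply Rabs_le.
      assert (T : forall u v : C, Cmod u <= Cmod (u - v) + Cmod v).
      { intros u v. pose proof (Cmod_triangle (u - v) v) as T.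
        now replace (u - v + v)%C with u in T by ring. }
      pose proof (T p q). pose proof (T q p) as T2.
      rewrite (Cmod_minus_sym q p) in T2. lra. }
    replace (Cmod q ^ 2 - Cmod p ^ 2) with ((Cmod q - Cmod p) * (Cmod q + Cmod p)) by ring.
    rewrite Rabs_mult, (Rabs_pos_eq (Cmod q + Cmod p)) by lra.
    apply Rle_trans with (e * (2 * M + 1)); [|exact He2].
    apply Rmult_le_compat; [apply Rabs_pos|lra|exact Hqp|].
    apply Rabs_le_between in Hqp. lra.
  - apply is_lim_seq_ext with (fun N => PI * sum_n (fun n => Cmod (c n) ^ 2 * r ^ (2 * n + 2) / INR (n + 1)) N).
    { intros N. symmetry. apply (sum_n_mult_l (K := R_Ring)). }
    apply (is_lim_seq_scal_l _ PI (Finite _)).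
    exact (Series_correct _ (square_summable c r Hc Hr)).
Qed.

Lemma is_disk_int_nonneg (r : R) (F : R -> R -> R) (v : R) :
  0 <= r -> (forall x y, Cmod (x, y) <= r -> 0 <= F x y) -> is_disk_int r F v -> 0 <= v.
Proof.
  intros Hr HF [H1 H2].
  apply (is_RInt_ge_0 (fun x => RInt (F x) (- chord r x) (chord r x)) (- r) r); [lra|exact H2|].
  intros x Hx. pose proof (chord_nonneg r x). apply RInt_ge_0; [lra|apply H1|].
  intros y Hy. apply HF. apply chord_spec; [exact Hr|apply Rabs_le; lra|lra].
Qed.

Lemma area_of_disk_int (h g : C -> C) (r : R) (F : R -> R -> R) (v : R) :
  0 <= r -> (forall x y, Cmod (x, y) <= r -> jacobian h g (x, y) = F x y) ->
  is_disk_int r F v -> area_S h g r = v.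
Proof.
  intros Hr HF [H1 H2]. unfold area_S.
  apply (is_RInt_unique (V := R_CompleteNormedModule)).
  eapply is_RInt_ext; [|exact H2]. intros x Hx. cbv beta.
  rewrite Rmin_left, Rmax_right in Hx by lra.
  apply (RInt_ext (V := R_CompleteNormedModule)). intros y Hy.
  assert (Hc : - chord r x <= chord r x) by (pose proof (chord_nonneg r x); lra).
  rewrite Rmin_left, Rmax_right in Hy by exact Hc.
  symmetry. apply HF. apply chord_spec; [exact Hr|apply Rabs_le; lra|].
  destruct Hy. split; now left.
Qed.

(** [sum_(n >= 1) n |A_n|^2 r^(2 n)]. *)
Definition area_series (A : nat -> C) (r : R) : R :=
  Series (fun n => INR (n + 1) * Cmod (A (n + 1)%nat) ^ 2 * r ^ (2 * (n + 1))).

Lemma area_term (A : nat -> C) (r : R) (n : nat) :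
  Cmod (dps A n) ^ 2 * r ^ (2 * n + 2) / INR (n + 1)
  = INR (n + 1) * Cmod (A (n + 1)%nat) ^ 2 * r ^ (2 * (n + 1)).
Proof.
  unfold dps. rewrite Cmod_mult, Cmod_R, Rabs_pos_eq by apply pos_INR.
  replace (2 * n + 2)%nat with (2 * (n + 1))%nat by lia.
  replace (S n) with (n + 1)%nat by lia.
  field. apply not_0_INR. lia.
Qed.

Lemma ex_area_series (A : nat -> C) (r : R) : summable A -> 0 <= r < 1 ->
  ex_series (fun n => INR (n + 1) * Cmod (A (n + 1)%nat) ^ 2 * r ^ (2 * (n + 1))).
Proof.
  intros HA Hr. eapply ex_series_ext; [intros n; apply area_term|].
  apply square_summable; [now apply dps_summable|exact Hr].
Qed.

Lemma area_formula (h g : C -> C) (A B : nat -> C) (r : R) :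
  summable A -> summable B -> 0 <= r < 1 ->
  (forall z, in_disk z -> C_derive h z = PS (dps A) z /\ C_derive g z = PS (dps B) z) ->
  (forall z, in_disk z -> 0 <= jacobian h g z) ->
  area_S h g r / PI = area_series A r - area_series B r /\ 0 <= area_S h g r / PI.
Proof.
  intros HA HB Hr HD HJ. pose proof PI_RGT_0 as Hpi.
  pose proof (parseval _ r (dps_summable A HA) Hr) as PA.
  pose proof (parseval _ r (dps_summable B HB) Hr) as PB.
  pose proof (is_disk_int_plus _ _ _ _ _ PA (is_disk_int_scal _ (-1) _ _ PB)) as P.
  assert (EJ : forall x y, Cmod (x, y) <= r -> jacobian h g (x, y) =
     Cmod (PS (dps A) (x, y)) ^ 2 + -1 * Cmod (PS (dps B) (x, y)) ^ 2).
  { intros x y Hz. unfold jacobian. destruct (HD (x, y) ltac:(unfold in_disk; lra)) as [-> ->]. ring. }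
  pose proof (area_of_disk_int h g r _ _ ltac:(lra) EJ P) as E.
  split.
  - rewrite E. unfold area_series.
    rewrite (Series_ext _ _ (area_term A r)), (Series_ext _ _ (area_term B r)). field. lra.
  - rewrite E. apply Rmult_le_pos; [|left; now apply Rinv_0_lt_compat].
    eapply is_disk_int_nonneg; [|intros x y Hz|exact P]; [lra|].
    cbv beta. rewrite <- EJ by exact Hz. apply HJ. unfold in_disk. lra.
Qed.

Lemma M_summable (r : R) : 0 <= r < 1 -> ex_series (fun n : nat => r ^ (2 * (n + 2)) / INR (n + 2)).
Proof.
  intros Hr. apply (@ex_series_le R_AbsRing R_CompleteNormedModule) with (b := fun n => (r * r) ^ n).
  - intros n. change (Rabs (r ^ (2 * (n + 2)) / INR (n + 2)) <= (r * r) ^ n).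
    assert (HI : 1 <= INR (n + 2)) by (rewrite plus_INR; simpl; pose proof (pos_INR n); lra).
    assert (Hp : 0 <= (r * r) ^ n) by (apply pow_le; nra).
    replace (r ^ (2 * (n + 2))) with ((r * r) ^ n * (r * r) ^ 2)
      by (rewrite <- pow_add; replace (r * r) with (r ^ 2) by ring; rewrite <- pow_mult; reflexivity).
    assert (Hq : 0 <= (r * r) ^ 2 <= 1).
    { split; [apply pow2_ge_0|]. rewrite <- (pow1 2). apply pow_incr. nra. }
    assert (Hi : 0 < / INR (n + 2) <= 1).
    { split; [apply Rinv_0_lt_compat; lra|]. rewrite <- Rinv_1. apply Rinv_le_contravar; lra. }
    unfold Rdiv. rewrite Rabs_pos_eq by (apply Rmult_le_pos; [apply Rmult_le_pos|]; lra).
    rewrite Rmult_assoc. rewrite <- (Rmult_1_r ((r * r) ^ n)) at 2.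
    apply Rmult_le_compat_l; [exact Hp|]. nra.
  - apply ex_series_geom. rewrite Rabs_pos_eq by nra. nra.
Qed.

Lemma area_series_split (A : nat -> C) (r : R) : summable A -> 0 <= r < 1 -> A 1%nat = RtoC 1 ->
  area_series A r = r ^ 2 + Series (fun n => INR (n + 2) * Cmod (A (n + 2)%nat) ^ 2 * r ^ (2 * (n + 2))).
Proof.
  intros HA Hr H1. unfold area_series.
  rewrite Series_incr_1 by (now apply ex_area_series). f_equal.
  - simpl (0 + 1)%nat. rewrite H1, Cmod_1. simpl. ring.
  - apply Series_ext. intros n. now replace (S n + 1)%nat with (n + 2)%nat by lia.
Qed.

Lemma area_upper (alpha : R) (A B : nat -> C) (r : R) :
  0 <= alpha < 1 -> normalized alpha A B -> 0 <= r < 1 ->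
  area_series A r - area_series B r <= M_fun alpha r.
Proof.
  intros Ha H Hr.
  assert (HB : 0 <= area_series B r).
  { apply Series_nonneg; [|apply ex_area_series; [apply (nB _ _ _ H)|exact Hr]].
    intros n. apply Rmult_le_pos; [apply Rmult_le_pos; [apply pos_INR|apply pow2_ge_0]|].
    apply pow_le; lra. }
  rewrite (area_series_split A r (nA _ _ _ H) Hr (nA1 _ _ _ H)).
  unfold M_fun. rewrite <- Series_scal_l.
  assert (Hle : Series (fun n : nat => INR (n + 2) * Cmod (A (n + 2)%nat) ^ 2 * r ^ (2 * (n + 2)))
     <= Series (fun n : nat => 4 * (1 - alpha) ^ 2 * (r ^ (2 * (n + 2)) / INR (n + 2)))).
  { apply Series_le.
    - intros n. assert (HI : 0 < INR (n + 2)) by (apply lt_0_INR; lia).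
      assert (Hrp : 0 <= r ^ (2 * (n + 2))) by (apply pow_le; lra).
      split; [apply Rmult_le_pos; [apply Rmult_le_pos; [lra|apply pow2_ge_0]|exact Hrp]|].
      pose proof (coefficient_bound alpha A B (n + 2) H ltac:(lia)) as Hc.
      pose proof (Cmod_ge_0 (A (n + 2)%nat)). pose proof (Cmod_ge_0 (B (n + 2)%nat)).
      assert (Hc2 : Cmod (A (n + 2)%nat) ^ 2 <= (2 * (1 - alpha) / INR (n + 2)) ^ 2)
        by (apply pow_incr; lra).
      apply Rle_trans with (INR (n + 2) * (2 * (1 - alpha) / INR (n + 2)) ^ 2 * r ^ (2 * (n + 2))).
      + apply Rmult_le_compat_r; [exact Hrp|]. apply Rmult_le_compat_l; lra.
      + right. field. lra.
    - apply (@ex_series_scal R_AbsRing R_NormedModule). now apply M_summable. }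
  lra.
Qed.

(** * The logarithmic series and the function J2 *)

(** Coefficients of [- ln (1 - z)]. *)
Definition log_coef (n : nat) : C := RtoC (match n with O => 0 | S _ => / INR n end).

Lemma log_coef_summable : summable log_coef.
Proof.
  intros r Hr. apply (@ex_series_le R_AbsRing R_CompleteNormedModule) with (b := fun n => r ^ n).
  - intros n. change (Rabs (Cmod (log_coef n) * r ^ n) <= r ^ n).
    assert (Hp : 0 <= r ^ n) by (apply pow_le; lra).
    rewrite Rabs_pos_eq by (apply Rmult_le_pos; [apply Cmod_ge_0|exact Hp]).
    rewrite <- (Rmult_1_l (r ^ n)) at 2. apply Rmult_le_compat_r; [exact Hp|].
    unfold log_coef. rewrite Cmod_R. destruct n as [|n]; [rewrite Rabs_R0; lra|].
    assert (1 <= INR (S n)) by (rewrite S_INR; pose proof (pos_INR n); lra).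
    rewrite Rabs_pos_eq by (left; apply Rinv_0_lt_compat; lra).
    rewrite <- Rinv_1. apply Rinv_le_contravar; lra.
  - apply ex_series_geom. rewrite Rabs_pos_eq; lra.
Qed.

Lemma dps_log_coef (n : nat) : dps log_coef n = RtoC 1.
Proof.
  unfold dps, log_coef. rewrite <- RtoC_mult. f_equal. apply Rinv_r. apply not_0_INR. lia.
Qed.

Lemma PS_ext (c d : nat -> C) (z : C) : (forall n, c n = d n) -> PS c z = PS d z.
Proof. intros H. now rewrite (functional_extensionality c d H). Qed.

Lemma PS_dps_log (z : C) : in_disk z -> PS (dps log_coef) z = (/ (RtoC 1 - z))%C.
Proof.
  intros Hz.
  pose proof (PS_correct _ z (dps_summable _ log_coef_summable) Hz) as S1.
  set (l := PS (dps log_coef) z) in *.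
  (* the sum satisfies [l = 1 + z l] *)
  assert (S2 : is_Cseries (fun n => dps log_coef n * z ^ n)%C (1 + z * l)%C).
  { replace (1 + z * l)%C with (dps log_coef 0 * z ^ 0 + z * l)%C
      by (rewrite dps_log_coef; change (z ^ 0)%C with (RtoC 1); ring).
    apply (is_Cseries_cons (fun n => dps log_coef n * z ^ n)%C).
    apply (@is_series_scal C_AbsRing C_NormedModule z) in S1.
    eapply is_series_ext; [|exact S1]. intros n. cbv beta.
    rewrite !dps_log_coef, Cpow_S.
    change ((z * (1 * z ^ n))%C = (1 * (z * z ^ n))%C). ring. }
  pose proof (is_Cseries_unique _ _ _ S1 S2) as E.
  pose proof (one_minus_neq0 z Hz) as Hn.
  replace l with (((1 - z) * l) / (1 - z))%C by (field; exact Hn).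
  replace ((1 - z) * l)%C with (l - z * l)%C by ring.
  rewrite E at 1. field. exact Hn.
Qed.

(** Both sides have the same derivative along the segment from [0] to [r]. *)
Lemma PS_log_real (r : R) : -1 < r < 1 -> PS log_coef (RtoC r) = RtoC (- ln (1 - r)).
Proof.
  intros Hr. apply C_inj; [|].
  - set (f := fun s => Re (1 * PS log_coef (0 + RtoC s * RtoC r)) + ln (1 - s * r)).
    assert (Hin : forall s, 0 <= s <= 1 -> in_disk (0 + RtoC s * RtoC r)%C).
    { intros s Hs. rewrite Cplus_0_l, <- RtoC_mult. unfold in_disk. rewrite Cmod_R.
      apply Rabs_def1; nra. }
    assert (Hpos : forall s, 0 <= s <= 1 -> 0 < 1 - s * r) by (intros; nra).
    assert (Hd : forall s, 0 <= s <= 1 -> is_derive f s 0).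
    { intros s Hs. specialize (Hpos s Hs). unfold f.
      evar_last.
      - apply (is_derive_plus (K := R_AbsRing) (V := R_NormedModule)
          (fun s => Re (1 * PS log_coef (0 + RtoC s * RtoC r))) (fun s => ln (1 - s * r)) s
          (Re (1 * (PS (dps log_coef) (0 + RtoC s * RtoC r) * RtoC r))) (- r / (1 - s * r))).
        + apply PS_derive_line; [apply log_coef_summable|now apply Hin].
        + auto_derive; [exact Hpos|]. field. lra.
      - rewrite PS_dps_log by (now apply Hin).
        rewrite Cplus_0_l, <- RtoC_mult, <- RtoC_minus, <- RtoC_inv by lra.
        rewrite <- RtoC_mult, Cmult_1_l, re_RtoC. unfold plus; simpl. field. lra. }
    assert (H1 : f 0 <= f 1) by (apply (nondecreasing_of_derive f (fun _ => 0)); intros; [auto|lra]).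
    assert (H2 : - f 0 <= - f 1).
    { apply (nondecreasing_of_derive (fun s => - f s) (fun _ => 0)); intros; [|lra].
      evar_last; [|apply Ropp_0].
      apply (is_derive_opp (K := R_AbsRing) (V := R_NormedModule)). auto. }
    assert (E : f 0 = f 1) by lra. unfold f in E.
    replace (0 + 0 * RtoC r)%C with (RtoC 0) in E by ring.
    replace (0 + 1 * RtoC r)%C with (RtoC r) in E by ring.
    rewrite PS_0, Rmult_0_l, Rminus_0_r, ln_1, Rmult_1_l, !Cmult_1_l in E.
    rewrite re_RtoC. unfold log_coef at 1 in E. rewrite re_RtoC in E. lra.
  - rewrite im_RtoC. change (Series (fun n => Im (log_coef n * RtoC r ^ n)) = 0).
    rewrite (Series_ext _ (fun n => 0 * 0)).
    + rewrite Series_scal_l. ring.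
    + intros n. unfold log_coef. rewrite <- RtoC_pow, <- RtoC_mult, im_RtoC. ring.
Qed.

(** The sum of [r^n / n] over [n >= 2]. *)
Definition log_tail (r : R) : R := - (r + ln (1 - r)).

Lemma log_tail_ex (r : R) : 0 <= r < 1 -> ex_series (fun n => r ^ (n + 2) / INR (n + 2)).
Proof.
  intros Hr. pose proof (log_coef_summable r Hr) as H.
  apply (ex_series_incr_n _ 2) in H.
  eapply ex_series_ext; [|exact H]. intros n. cbv beta.
  replace (n + 2)%nat with (2 + n)%nat by lia.
  unfold log_coef. simpl (2 + n)%nat. rewrite Cmod_R, Rabs_pos_eq.
  - asR. unfold Rdiv. ring.
  - left. apply Rinv_0_lt_compat. apply lt_0_INR. lia.
Qed.

Lemma log_tail_series (r : R) : 0 <= r < 1 ->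
  Series (fun n => r ^ (n + 2) / INR (n + 2)) = log_tail r.
Proof.
  intros Hr. pose proof (PS_log_real r ltac:(lra)) as E.
  assert (E2 : Series (fun n => Re (log_coef n * RtoC r ^ n)) = - ln (1 - r))
    by (exact (f_equal Re E)).
  rewrite (Series_ext _ (fun n => Cmod (log_coef n) * r ^ n)) in E2.
  - rewrite (Series_split _ 1 (log_coef_summable r Hr)) in E2.
    rewrite sum_Sn, sum_O in E2. unfold plus in E2. simpl in E2.
    unfold log_coef at 1 2 in E2. rewrite !Cmod_R, Rabs_R0 in E2. simpl in E2.
    rewrite Rinv_1, Rabs_R1 in E2. unfold log_tail.
    rewrite (Series_ext _ (fun k => Cmod (log_coef (S (S k))) * (r * (r * r ^ k)))).
    + lra.
    + intros n. replace (n + 2)%nat with (S (S n)) by lia. unfold log_coef.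
      rewrite Cmod_R, Rabs_pos_eq; [simpl; unfold Rdiv; ring|].
      left. apply Rinv_0_lt_compat. apply lt_0_INR. lia.
  - intros n. unfold log_coef. rewrite <- RtoC_pow, re_scal_l, re_RtoC, Cmod_R.
    rewrite Rabs_pos_eq; [reflexivity|].
    destruct n; [lra|]. left. apply Rinv_0_lt_compat. apply lt_0_INR. lia.
Qed.

(** The closed form reduces continuity and monotonicity of [M_fun] to those of [log_tail]. *)
Lemma M_fun_closed (alpha r : R) : 0 <= r < 1 ->
  M_fun alpha r = r ^ 2 + 4 * (1 - alpha) ^ 2 * log_tail (r ^ 2).
Proof.
  intros Hr. unfold M_fun. rewrite <- log_tail_series by (simpl; nra).
  do 2 f_equal. apply Series_ext. intros n. now rewrite pow_mult.
Qed.

Lemma ln_le_minus_one (x : R) : 0 < x -> ln x <= x - 1.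
Proof.
  intros Hx. rewrite <- (ln_exp (x - 1)). apply ln_le; [exact Hx|].
  pose proof (exp_ineq1_le (x - 1)). lra.
Qed.

Lemma log_tail_incr (r s : R) : 0 <= r <= s -> s < 1 -> log_tail r <= log_tail s.
Proof.
  intros Hr Hs. unfold log_tail.
  pose proof (ln_le_minus_one ((1 - s) / (1 - r)) ltac:(apply Rdiv_lt_0_compat; lra)) as H.
  unfold Rdiv in H at 1. rewrite ln_mult, ln_Rinv in H; [|lra|lra|apply Rinv_0_lt_compat; lra].
  assert (H2 : (1 - s) / (1 - r) - 1 <= r - s).
  { apply Rmult_le_reg_r with (1 - r); [lra|].
    replace (((1 - s) / (1 - r) - 1) * (1 - r)) with (r - s) by (field; lra). nra. }
  lra.
Qed.

Lemma log_tail_0 : log_tail 0 = 0.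
Proof. unfold log_tail. rewrite Rminus_0_r, ln_1. ring. Qed.

Lemma log_tail_nonneg (r : R) : 0 <= r < 1 -> 0 <= log_tail r.
Proof. intros Hr. rewrite <- log_tail_0. apply log_tail_incr; lra. Qed.

Lemma rpow_nonneg (x p : R) : 0 <= rpow x p.
Proof.
  unfold rpow. destruct (Req_EM_T x 0); [lra|]. left. apply exp_pos.
Qed.

Lemma rpow_lt (x y p : R) : 0 < p -> 0 <= x < y -> rpow x p < rpow y p.
Proof.
  intros Hp Hxy. unfold rpow.
  destruct (Req_EM_T y 0) as [E|_]; [lra|].
  destruct (Req_EM_T x 0) as [E|E]; [apply exp_pos|].
  apply Rlt_Rpower_l; lra.
Qed.

Lemma rpow_le (x y p : R) : 0 < p -> 0 <= x <= y -> rpow x p <= rpow y p.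
Proof.
  intros Hp Hxy. destruct (Req_dec x y) as [->|E]; [lra|].
  left. apply rpow_lt; lra.
Qed.

(** The value of the extremal function at [r], and the bound of [|f|] on [|z| = r]. *)
Definition upper_growth (alpha r : R) : R := r + 2 * (1 - alpha) * log_tail r.

Lemma J2_eq (alpha p : R) (mu : R -> R) (r : R) :
  J2 alpha p mu r = rpow (upper_growth alpha r) p + 2 * (1 - alpha) * log_tail r
     + mu (M_fun alpha r) - covering_radius alpha.
Proof.
  unfold J2, upper_growth, log_tail, covering_radius.
  replace (r - 2 * (1 - alpha) * (r + ln (1 - r))) with (r + 2 * (1 - alpha) * - (r + ln (1 - r))) by ring.
  ring.
Qed.

Lemma upper_growth_lt (alpha r s : R) : 0 <= alpha < 1 -> 0 <= r < s -> s < 1 ->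
  0 <= upper_growth alpha r < upper_growth alpha s.
Proof.
  intros Ha Hr Hs. unfold upper_growth.
  pose proof (log_tail_incr r s ltac:(lra) Hs). pose proof (log_tail_nonneg r ltac:(lra)).
  nra.
Qed.

Lemma M_fun_incr (alpha r s : R) : 0 <= r <= s -> s < 1 -> 0 <= M_fun alpha r <= M_fun alpha s.
Proof.
  intros Hr Hs. rewrite !M_fun_closed by lra.
  assert (H2 : 0 <= r ^ 2 <= s ^ 2) by (split; [apply pow2_ge_0|apply pow_incr; lra]).
  assert (H3 : s ^ 2 < 1) by (simpl; nra).
  pose proof (log_tail_incr _ _ H2 H3). pose proof (log_tail_nonneg (r ^ 2) ltac:(lra)).
  pose proof (pow2_ge_0 (1 - alpha)). nra.
Qed.

Lemma J2_lt (alpha p : R) (mu : R -> R) (r s : R) :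
  0 <= alpha < 1 -> 1 <= p -> (forall x y, 0 <= x -> x <= y -> mu x <= mu y) ->
  0 <= r < s -> s < 1 -> J2 alpha p mu r < J2 alpha p mu s.
Proof.
  intros Ha Hp Hmu Hr Hs. rewrite !J2_eq.
  pose proof (rpow_lt _ _ p ltac:(lra) (upper_growth_lt alpha r s Ha Hr Hs)).
  destruct (M_fun_incr alpha r s ltac:(lra) Hs) as [M0 M1].
  pose proof (Hmu _ _ M0 M1).
  pose proof (log_tail_incr r s ltac:(lra) Hs). nra.
Qed.

(** Composing with [clamp] extends functions on the interval from [0] to [b] to continuous
    functions on the line, as the intermediate value theorem requires. *)
Definition clamp (b x : R) : R := Rmax 0 (Rmin x b).

Lemma clamp_range (b x : R) : 0 <= b -> 0 <= clamp b x <= b.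
Proof.
  intros Hb. unfold clamp. split; [apply Rmax_l|].
  apply Rmax_lub; [exact Hb|apply Rmin_r].
Qed.

Lemma clamp_id (b x : R) : 0 <= x <= b -> clamp b x = x.
Proof. intros H. unfold clamp. rewrite Rmin_left, Rmax_right; lra. Qed.

Lemma continuity_Rmax0 (x : R) : continuity_pt (Rmax 0) x.
Proof.
  apply (continuity_pt_ext (fun y => (y + Rabs y) / 2)).
  - intros y. unfold Rmax. destruct (Rle_dec 0 y) as [H|H].
    + rewrite Rabs_pos_eq by exact H. field.
    + rewrite Rabs_left by lra. field.
  - apply continuity_pt_mult; [|apply continuity_pt_const; now intros ? ?].
    apply continuity_pt_plus; [apply derivable_continuous_pt, derivable_pt_id|apply Rcontinuity_abs].
Qed.

Lemma continuity_clamp (b x : R) : continuity_pt (clamp b) x.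
Proof.
  apply (continuity_pt_comp (fun y => Rmin y b) (Rmax 0)); [|apply continuity_Rmax0].
  apply (continuity_pt_ext (fun y => b - Rmax 0 (b - y))).
  - intros y. unfold Rmin, Rmax. destruct (Rle_dec 0 (b - y)), (Rle_dec y b); lra.
  - apply continuity_pt_minus; [apply continuity_pt_const; now intros ? ?|].
    apply (continuity_pt_comp (fun y => b - y) (Rmax 0)); [|apply continuity_Rmax0].
    apply continuity_pt_minus; [apply continuity_pt_const; now intros ? ?|apply derivable_continuous_pt, derivable_pt_id].
Qed.

Lemma continuity_pt_Rplus (f g : R -> R) (x : R) :
  continuity_pt f x -> continuity_pt g x -> continuity_pt (fun y => f y + g y) x.
Proof. intros Hf Hg. exact (continuity_pt_plus f g x Hf Hg). Qed.

Lemma continuity_pt_cst (k x : R) : continuity_pt (fun _ => k) x.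
Proof. apply continuity_pt_const. now intros ? ?. Qed.

Lemma continuity_pt_smult (k : R) (f : R -> R) (x : R) :
  continuity_pt f x -> continuity_pt (fun y => k * f y) x.
Proof. intros Hf. exact (continuity_pt_scal f k x Hf). Qed.

Lemma continuity_log_tail (f : R -> R) (x : R) :
  continuity_pt f x -> f x < 1 -> continuity_pt (fun y => log_tail (f y)) x.
Proof.
  intros Hf Hx. apply (continuity_pt_comp f log_tail); [exact Hf|].
  apply continuity_pt_filterlim.
  apply (ex_derive_continuous (K := R_AbsRing) (V := R_NormedModule)).
  unfold log_tail. auto_derive. lra.
Qed.

(** At the origin, continuity comes from [0 <= y ^ p <= y] for [0 < y < 1]. *)
Lemma continuity_rpow_pos (p x : R) : 1 <= p -> continuity_pt (fun y => rpow (Rmax 0 y) p) x.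
Proof.
  intros Hp. destruct (Rlt_le_dec 0 x) as [Hx|Hx].
  - apply continuity_pt_locally_ext with (f := fun y => Rpower y p) (a := x); [exact Hx| |].
    + intros y Hy. unfold Rdist in Hy. apply Rabs_def2 in Hy.
      rewrite Rmax_right by lra. unfold rpow. destruct (Req_EM_T y 0); [lra|reflexivity].
    + apply continuity_pt_filterlim.
      apply (ex_derive_continuous (K := R_AbsRing) (V := R_NormedModule) (fun y => Rpower y p)).
      unfold Rpower. auto_derive. exact Hx.
  - intros eps Heps. exists (Rmin 1 eps). split; [apply Rmin_pos; lra|].
    intros y [_ Hy]. simpl in *. unfold Rdist in *.
    rewrite (Rmax_left 0 x) by lra.
    replace (rpow 0 p) with 0 by (unfold rpow; destruct (Req_EM_T 0 0); [reflexivity|lra]).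
    rewrite Rminus_0_r, Rabs_pos_eq by apply rpow_nonneg.
    pose proof (Rmin_l 1 eps). pose proof (Rmin_r 1 eps). apply Rabs_def2 in Hy.
    unfold rpow. destruct (Req_EM_T (Rmax 0 y) 0) as [E|E]; [lra|].
    assert (Hy0 : 0 < y).
    { apply Rnot_le_lt. intros Hn. apply E. rewrite Rmax_left; lra. }
    rewrite Rmax_right by lra.
    apply Rle_lt_trans with y; [|lra].
    rewrite <- (exp_ln y) at 2 by exact Hy0. unfold Rpower.
    assert (Hl : ln y <= 0) by (rewrite <- ln_1; apply ln_le; lra).
    destruct (Req_dec (p * ln y) (ln y)) as [->|Hne]; [lra|].
    left. apply exp_increasing. nra.
Qed.

Lemma continuity_mu_extended (mu : R -> R) (x : R) :
  (forall x : R, 0 <= x ->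
      filterlim mu (within (fun t : R => 0 <= t) (locally x)) (locally (mu x))) ->
  continuity_pt (fun y => mu (Rmax 0 y)) x.
Proof.
  intros Hmu. apply continuity_pt_filterlim.
  eapply filterlim_comp; [|apply (Hmu (Rmax 0 x)); apply Rmax_l].
  intros P HP.
  pose proof (proj1 (continuity_pt_filterlim _ _) (continuity_Rmax0 x) _ HP) as H.
  unfold filtermap in *. eapply filter_imp; [|exact H].
  intros y Hy. apply Hy. apply Rmax_l.
Qed.

Lemma root_exists (alpha p : R) (mu : R -> R) :
  0 <= alpha < 1 -> 1 <= p -> (forall x : R, 0 <= x -> 0 <= mu x) ->
  (forall x : R, 0 <= x ->
      filterlim mu (within (fun t : R => 0 <= t) (locally x)) (locally (mu x))) ->
  mu 0 < covering_radius alpha ->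
  exists r : R, 0 < r < 1 /\ J2 alpha p mu r = 0.
Proof.
  intros Ha Hp Hpos Hmu Hmu0.
  set (beta := 2 * (1 - alpha)).
  assert (Hb : 0 < beta) by (unfold beta; lra).
  (* at [b = 1 - exp (- T)] the first summand is already at least [1] *)
  set (T := 1 + / beta). set (b := 1 - exp (- T)).
  assert (HT : 0 < T) by (unfold T; pose proof (Rinv_0_lt_compat _ Hb); lra).
  assert (He : 0 < exp (- T) < 1).
  { split; [apply exp_pos|]. rewrite <- exp_0. apply exp_increasing. lra. }
  assert (Hb1 : 0 < b < 1) by (unfold b; lra).
  assert (Hub : 1 <= upper_growth alpha b).
  { unfold upper_growth, log_tail. fold beta.
    replace (1 - b) with (exp (- T)) by (unfold b; ring). rewrite ln_exp.
    assert (beta * (T - 1) = 1) by (unfold T; field; lra). nra. }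
  assert (Hlt : forall x, 0 <= x < 1 -> 0 <= upper_growth alpha x).
  { intros x Hx. unfold upper_growth. pose proof (log_tail_nonneg x Hx). nra. }
  set (F := fun x => rpow (Rmax 0 (clamp b x + beta * log_tail (clamp b x))) p
      + beta * log_tail (clamp b x)
      + mu (Rmax 0 (clamp b x ^ 2 + 4 * (1 - alpha) ^ 2 * log_tail (clamp b x ^ 2)))
      + - covering_radius alpha).
  assert (HF : forall x, F x = J2 alpha p mu (clamp b x)).
  { intros x. pose proof (clamp_range b x ltac:(lra)) as Hc.
    rewrite J2_eq. unfold F. fold beta.
    pose proof (M_fun_incr alpha (clamp b x) (clamp b x) ltac:(lra) ltac:(lra)) as HM.
    rewrite M_fun_closed in HM by lra. rewrite M_fun_closed by lra.
    rewrite (Rmax_right 0 (clamp b x ^ 2 + _)) by lra.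
    pose proof (Hlt (clamp b x) ltac:(lra)) as Hu. unfold upper_growth in *. fold beta in Hu |- *.
    rewrite (Rmax_right 0 (clamp b x + _)) by lra. ring. }
  assert (Hcont : continuity F).
  { intros x. pose proof (clamp_range b x ltac:(lra)) as Hc.
    pose proof (continuity_clamp b x) as Cc.
    assert (C2 : continuity_pt (fun y => clamp b y ^ 2) x).
    { apply (continuity_pt_comp (clamp b) (fun y => y ^ 2)); [exact Cc|].
      apply derivable_continuous_pt, derivable_pt_pow. }
    pose proof (continuity_log_tail _ x Cc ltac:(lra)) as Cl.
    pose proof (continuity_log_tail _ x C2 ltac:(simpl; nra)) as Cl2.
    unfold F. repeat apply continuity_pt_Rplus.
    - apply (continuity_pt_comp (fun y => clamp b y + beta * log_tail (clamp b y)) (fun y => rpow (Rmax 0 y) p)).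
      + apply continuity_pt_Rplus; [exact Cc|]. now apply continuity_pt_smult.
      + now apply continuity_rpow_pos.
    - now apply continuity_pt_smult.
    - apply (continuity_pt_comp (fun y => clamp b y ^ 2 + 4 * (1 - alpha) ^ 2 * log_tail (clamp b y ^ 2)) (fun y => mu (Rmax 0 y))).
      + apply continuity_pt_Rplus; [exact C2|]. now apply continuity_pt_smult.
      + now apply continuity_mu_extended.
    - apply continuity_pt_cst. }
  assert (H0 : F 0 < 0).
  { rewrite HF, clamp_id by lra. rewrite J2_eq, M_fun_closed by lra.
    unfold upper_growth. rewrite (pow_i 2) by lia. rewrite log_tail_0, !Rmult_0_r, !Rplus_0_r.
    replace (rpow 0 p) with 0 by (unfold rpow; destruct (Req_EM_T 0 0); [reflexivity|lra]). lra. }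
  assert (H1 : 0 < F b).
  { rewrite HF, clamp_id by lra. rewrite J2_eq.
    pose proof (log_tail_nonneg b ltac:(lra)).
    pose proof (Hpos (M_fun alpha b) ltac:(apply (M_fun_incr alpha b b); lra)).
    pose proof (rpow_le 1 (upper_growth alpha b) p ltac:(lra) ltac:(lra)) as Hr.
    replace (rpow 1 p) with 1 in Hr.
    - pose proof (covering_radius_bounds alpha Ha). nra.
    - unfold rpow. destruct (Req_EM_T 1 0); [lra|]. unfold Rpower. now rewrite ln_1, Rmult_0_r, exp_0. }
  destruct (IVT F 0 b Hcont ltac:(lra) H0 H1) as [r [Hr Er]].
  assert (Hr0 : r <> 0) by (intros ->; lra).
  exists r. split; [lra|]. rewrite HF, clamp_id in Er by exact Hr. exact Er.
Qed.

(** * The inequality *)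

Lemma PS_abs_le (A : nat -> C) (z : C) : summable A -> in_disk z ->
  Cmod (PS A z) <= Series (fun n => Cmod (A n) * Cmod z ^ n).
Proof.
  intros HA Hz. apply (Cseries_le (fun n => A n * z ^ n)%C).
  - now apply PS_correct.
  - intros n. rewrite Cmod_mult, Cmod_pow. lra.
  - apply HA. split; [apply Cmod_ge_0|exact Hz].
Qed.

Lemma majorant_bound (alpha r : R) (A B : nat -> C) :
  0 <= alpha < 1 -> normalized alpha A B -> 0 <= r < 1 ->
  Series (fun n => (Cmod (A (n + 2)%nat) + Cmod (B (n + 2)%nat)) * r ^ (n + 2))
   <= 2 * (1 - alpha) * log_tail r.
Proof.
  intros Ha H Hr. rewrite <- log_tail_series, <- Series_scal_l by exact Hr.
  apply Series_le.
  - intros n. assert (Hp : 0 <= r ^ (n + 2)) by (apply pow_le; lra).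
    split.
    + apply Rmult_le_pos; [|exact Hp].
      pose proof (Cmod_ge_0 (A (n + 2)%nat)). pose proof (Cmod_ge_0 (B (n + 2)%nat)). lra.
    + replace (2 * (1 - alpha) * (r ^ (n + 2) / INR (n + 2))) with
        (2 * (1 - alpha) / INR (n + 2) * r ^ (n + 2)) by (unfold Rdiv; ring).
      apply Rmult_le_compat_r; [exact Hp|]. apply coefficient_bound; [exact H|lia].
  - apply (@ex_series_scal R_AbsRing R_NormedModule). now apply log_tail_ex.
Qed.

Lemma growth (alpha : R) (A B : nat -> C) (z : C) :
  0 <= alpha < 1 -> normalized alpha A B -> in_disk z ->
  Cmod (harm A B z) <= upper_growth alpha (Cmod z).
Proof.
  intros Ha H Hz.
  set (r := Cmod z). assert (Hr : 0 <= r < 1) by (split; [apply Cmod_ge_0|exact Hz]).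
  pose proof (nA _ _ _ H r Hr) as SA. pose proof (nB _ _ _ H r Hr) as SB.
  assert (S2 : ex_series (fun n => (Cmod (A n) + Cmod (B n)) * r ^ n)).
  { eapply ex_series_ext; [|apply (@ex_series_plus R_AbsRing R_NormedModule _ _ SA SB)].
    intros n. symmetry. apply Rmult_plus_distr_r. }
  apply Rle_trans with (Series (fun n => (Cmod (A n) + Cmod (B n)) * r ^ n)).
  - unfold harm, harmonic_map. eapply Rle_trans; [apply Cmod_triangle|].
    rewrite Cmod_conj.
    rewrite (Series_ext _ (fun n => Cmod (A n) * r ^ n + Cmod (B n) * r ^ n))
      by (intros n; ring).
    rewrite Series_plus by assumption.
    apply Rplus_le_compat; apply PS_abs_le; try exact Hz;
      [apply (nA _ _ _ H)|apply (nB _ _ _ H)].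
  - rewrite (Series_split _ 1 S2), sum_Sn, sum_O. unfold plus; simpl.
    rewrite (nA0 _ _ _ H), (nB0 _ _ _ H), (nA1 _ _ _ H), (nB1 _ _ _ H), Cmod_0, Cmod_1.
    pose proof (majorant_bound alpha r A B Ha H Hr) as Hm.
    rewrite (Series_ext _ (fun n => (Cmod (A (n + 2)%nat) + Cmod (B (n + 2)%nat)) * r ^ (n + 2))).
    + unfold upper_growth. lra.
    + intros n. replace (n + 2)%nat with (S (S n)) by lia. simpl. reflexivity.
Qed.

(** A boundary point is a limit of omitted values, and values of modulus below the covering
    radius are not omitted. *)
Lemma boundary_distance (alpha : R) (A B : nat -> C) (h g : C -> C) (w : C) :
  0 <= alpha < 1 -> normalized alpha A B ->
  (forall z, in_disk z -> h z = PS A z /\ g z = PS B z) ->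
  boundary (image_of_disk (harmonic_map h g)) w -> covering_radius alpha <= Cmod w.
Proof.
  intros Ha H Hhg Hw. apply Rnot_lt_le. intros Hlt.
  destruct (Hw (covering_radius alpha - Cmod w) ltac:(lra)) as [_ [v [Hv Hvw]]].
  apply Hv.
  assert (Hv2 : Cmod v < covering_radius alpha).
  { replace v with ((v - w) + w)%C by ring.
    eapply Rle_lt_trans; [apply Cmod_triangle|]. lra. }
  destruct (covering_theorem alpha A B v Ha H Hv2) as [z [Hz E]].
  exists z. split; [exact Hz|]. rewrite <- E. unfold harm, harmonic_map.
  destruct (Hhg z Hz) as [-> ->]. reflexivity.
Qed.

Lemma harmonic_map_0 (alpha : R) (h g : C -> C) : class_PH0 alpha h g ->
  harmonic_map h g (RtoC 0) = RtoC 0.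
Proof.
  intros [[_ [_ [Hh [_ [Hg _]]]]] _]. unfold harmonic_map. rewrite Hh, Hg. Ccomp.
Qed.

(** The left-hand side is at most [J2(r) + L(1)], hence at most [L(1)] for [r <= Rf]. *)
Lemma bohr_inequality_below (alpha p : R) (mu : R -> R) (Rf : R)
    (h g : C -> C) (a b : nat -> C) (z : C) :
  0 <= alpha < 1 -> 1 <= p -> (forall x y, 0 <= x -> x <= y -> mu x <= mu y) ->
  0 < Rf < 1 -> J2 alpha p mu Rf = 0 ->
  class_PH0 alpha h g -> power_expansions h g a b -> Cmod z <= Rf ->
  bohr_inequality p mu h g a b z.
Proof.
  intros Ha Hp Hmu HRf HJ Hcl Hpe Hz.
  destruct (class_PH0_normalized alpha h g a b Hcl Hpe) as [H HD].
  set (A := htail a) in *. set (B := gtail b) in *.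
  set (r := Cmod z) in *. assert (Hr : 0 <= r < 1) by (split; [apply Cmod_ge_0|lra]).
  assert (Hzd : in_disk z) by (unfold in_disk; fold r; lra).
  assert (H1 : rpow (Cmod (harmonic_map h g z)) p <= rpow (upper_growth alpha r) p).
  { apply rpow_le; [lra|]. split; [apply Cmod_ge_0|].
    destruct (HD z Hzd) as [E1 [E2 _]].
    replace (harmonic_map h g z) with (harm A B z)
      by (unfold harm, harmonic_map; now rewrite E1, E2).
    now apply growth. }
  pose proof (majorant_bound alpha r A B Ha H Hr) as H2.
  rewrite (Series_ext _ (fun n => (Cmod (a (n + 2)%nat) + Cmod (b (n + 2)%nat)) * r ^ (n + 2))) in H2.
  2: { intros n. unfold A, B. now replace (n + 2)%nat with (S (S n)) by lia. }
  destruct (area_formula h g A B r (nA _ _ _ H) (nB _ _ _ H) Hr) as [Earea Hpos].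
  { intros v Hv. destruct (HD v Hv) as [_ [_ [E3 E4]]]. now split. }
  { intros v Hv. left. destruct Hcl as [[_ [_ [_ [_ [_ Hj]]]]] _]. now apply Hj. }
  assert (H3 : mu (area_S h g r / PI) <= mu (M_fun alpha r)).
  { apply Hmu; [exact Hpos|]. rewrite Earea. now apply area_upper. }
  assert (H4 : J2 alpha p mu r <= 0).
  { rewrite <- HJ. destruct (Req_dec r Rf) as [->|Hne]; [lra|].
    left. apply J2_lt; try assumption; lra. }
  rewrite J2_eq in H4.
  unfold bohr_inequality. fold r.
  apply Rbar_le_trans with (Finite (covering_radius alpha)); [simpl; lra|].
  unfold dist_to. apply Glb_Rbar_correct. intros d [w [Hw ->]]. simpl.
  rewrite (harmonic_map_0 alpha h g Hcl).
  replace (w - 0)%C with w by ring.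
  apply (boundary_distance alpha A B h g w Ha H); [|exact Hw].
  intros v Hv. destruct (HD v Hv) as [E1 [E2 _]]. now split.
Qed.

(** * The extremal function *)

Definition id_coef (n : nat) : C := match n with 1%nat => RtoC 1 | _ => RtoC 0 end.

Lemma id_coef_series (z : C) : is_Cseries (fun n => id_coef n * z ^ n)%C z.
Proof.
  pose proof (unit0_series z) as H.
  apply (@is_series_scal C_AbsRing C_NormedModule z) in H.
  assert (E : (id_coef 0 * z ^ 0 + z * RtoC 1)%C = z)
    by (simpl id_coef; change (z ^ 0)%C with (RtoC 1); ring).
  refine (eq_rect _ (fun l => is_Cseries (fun n => id_coef n * z ^ n)%C l) _ _ E).
  apply (is_Cseries_cons (fun n => id_coef n * z ^ n)%C).
  eapply is_series_ext; [|exact H]. intros n. cbv beta.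
  change ((z * (unit0 n * z ^ n))%C = (id_coef (S n) * z ^ S n)%C).
  rewrite Cpow_S. destruct n; simpl id_coef; simpl unit0; ring.
Qed.

Lemma summable_id_coef : summable id_coef.
Proof. apply summable_of_converges. intros r _. eexists. apply id_coef_series. Qed.

(** [z] plus [2 (1 - alpha)] times the tail of the logarithmic series from degree [2] on. *)
Definition extremal_coef (alpha : R) (n : nat) : C :=
  (RtoC (1 - 2 * (1 - alpha)) * id_coef n + RtoC (2 * (1 - alpha)) * log_coef n)%C.

Definition extremal (alpha : R) : C -> C := PS (extremal_coef alpha).

Definition zero_coef (n : nat) : C := RtoC 0.
Definition zero_fun (z : C) : C := RtoC 0.

Lemma summable_scal (c : nat -> C) (e : C) : summable c -> summable (fun n => e * c n)%C.
Proof.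
  intros H r Hr.
  eapply ex_series_ext; [|apply (@ex_series_scal R_AbsRing R_NormedModule (Cmod e)); apply (H r Hr)].
  intros n. rewrite Cmod_mult. asR. unfold scal; simpl; unfold mult; simpl. ring.
Qed.

Lemma PS_scal (c : nat -> C) (e z : C) : summable c -> in_disk z ->
  PS (fun n => e * c n)%C z = (e * PS c z)%C.
Proof.
  intros H Hz. apply PS_unique.
  pose proof (PS_correct c z H Hz) as S1.
  apply (@is_series_scal C_AbsRing C_NormedModule e) in S1.
  eapply is_series_ext; [|exact S1]. intros n.
  change ((e * (c n * z ^ n))%C = (e * c n * z ^ n)%C). ring.
Qed.

Lemma zero_coef_eq : zero_coef = (fun n => RtoC 0 * id_coef n)%C.
Proof. extensionality n. unfold zero_coef. ring. Qed.

Lemma summable_zero : summable zero_coef.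
Proof. rewrite zero_coef_eq. apply summable_scal, summable_id_coef. Qed.

Lemma PS_zero (z : C) : in_disk z -> PS zero_coef z = RtoC 0.
Proof.
  intros Hz. rewrite zero_coef_eq, PS_scal by (try exact Hz; apply summable_id_coef). ring.
Qed.

Lemma PS_dps_zero (z : C) : in_disk z -> PS (dps zero_coef) z = RtoC 0.
Proof.
  intros Hz. rewrite <- (PS_zero z Hz). apply PS_ext. intros n. unfold dps, zero_coef. ring.
Qed.

Lemma summable_extremal (alpha : R) : summable (extremal_coef alpha).
Proof.
  apply (summable_plus_scal (fun n => RtoC (1 - 2 * (1 - alpha)) * id_coef n)%C log_coef).
  - apply summable_scal, summable_id_coef.
  - apply log_coef_summable.
Qed.

Lemma extremal_eq (alpha : R) (z : C) : in_disk z ->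
  extremal alpha z = (RtoC (1 - 2 * (1 - alpha)) * z + RtoC (2 * (1 - alpha)) * PS log_coef z)%C.
Proof.
  intros Hz. unfold extremal, extremal_coef.
  rewrite (PS_plus_scal (fun n => RtoC (1 - 2 * (1 - alpha)) * id_coef n)%C log_coef);
    [|apply summable_scal, summable_id_coef|apply log_coef_summable|exact Hz].
  rewrite PS_scal by (try exact Hz; apply summable_id_coef).
  now rewrite (PS_unique _ _ _ (id_coef_series z)).
Qed.

Lemma extremal_deriv (alpha : R) (z : C) : in_disk z ->
  PS (dps (extremal_coef alpha)) z =
  (RtoC (1 - 2 * (1 - alpha)) + RtoC (2 * (1 - alpha)) * / (1 - z))%C.
Proof.
  intros Hz.
  rewrite (PS_ext _ (fun n => RtoC (1 - 2 * (1 - alpha)) * unit0 n + RtoC (2 * (1 - alpha)) * dps log_coef n)%C).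
  - rewrite (PS_plus_scal (fun n => RtoC (1 - 2 * (1 - alpha)) * unit0 n)%C (dps log_coef));
      [|apply summable_scal, summable_unit0|apply dps_summable, log_coef_summable|exact Hz].
    rewrite PS_scal by (try exact Hz; apply summable_unit0).
    rewrite PS_unit0, PS_dps_log by exact Hz. ring.
  - intros n. unfold dps, extremal_coef. destruct n as [|n]; simpl id_coef; simpl unit0.
    + simpl INR. ring.
    + ring.
Qed.

Lemma extremal_Re_deriv (alpha : R) (z : C) : 0 <= alpha < 1 -> in_disk z ->
  1 - 2 * (1 - alpha) + 2 * (1 - alpha) * / (1 + Cmod z) <= Re (PS (dps (extremal_coef alpha)) z).
Proof.
  intros Ha Hz. rewrite extremal_deriv by exact Hz.
  rewrite re_plus, re_scal_l, re_RtoC.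
  pose proof (Re_inv_one_minus z Hz). nra.
Qed.

Lemma inv_gt_half (t : R) : 0 <= t < 1 -> / 2 < / (1 + t).
Proof. intros H. apply Rinv_lt_contravar; lra. Qed.

Lemma extremal_Re_gt (alpha : R) (z : C) : 0 <= alpha < 1 -> in_disk z ->
  alpha < Re (PS (dps (extremal_coef alpha)) z).
Proof.
  intros Ha Hz. pose proof (extremal_Re_deriv alpha z Ha Hz).
  pose proof (inv_gt_half (Cmod z) (conj (Cmod_ge_0 z) Hz)). nra.
Qed.

Lemma extremal_is_derive (alpha : R) (z : C) : in_disk z ->
  @is_derive C_AbsRing C_NormedModule (extremal alpha) z (PS (dps (extremal_coef alpha)) z).
Proof. intros Hz. apply PS_is_derive; [apply summable_extremal|reflexivity|exact Hz]. Qed.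

Lemma zero_is_derive (z : C) : @is_derive C_AbsRing C_NormedModule zero_fun z (RtoC 0).
Proof. apply (@is_derive_const C_AbsRing C_NormedModule (RtoC 0)). Qed.

Lemma extremal_class (alpha : R) : 0 <= alpha < 1 -> class_PH0 alpha (extremal alpha) zero_fun.
Proof.
  intros Ha.
  assert (Hg : forall z, C_derive zero_fun z = RtoC 0)
    by (intros z; apply is_C_derive_unique, zero_is_derive).
  assert (Hh : forall z, in_disk z -> C_derive (extremal alpha) z = PS (dps (extremal_coef alpha)) z)
    by (intros z Hz; now apply is_C_derive_unique, extremal_is_derive).
  assert (H0 : in_disk (RtoC 0)) by (apply in_disk_R; lra).
  split; [|split].
  - split; [intros z Hz; eexists; now apply extremal_is_derive|].
    split; [intros z Hz; eexists; apply zero_is_derive|].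
    split; [unfold extremal; rewrite PS_0; unfold extremal_coef, log_coef; simpl id_coef; ring|].
    split.
    { rewrite Hh, extremal_deriv by exact H0.
      replace (1 - 0)%C with (RtoC 1) by ring. rewrite <- RtoC_inv by lra.
      rewrite <- RtoC_mult, <- RtoC_plus. f_equal. field. }
    split; [reflexivity|].
    intros z Hz. unfold jacobian. rewrite Hg, Cmod_0, Hh by exact Hz.
    pose proof (extremal_Re_gt alpha z Ha Hz) as H1.
    pose proof (Re_le_Cmod (PS (dps (extremal_coef alpha)) z)). simpl. nra.
  - intros z Hz. rewrite Hg, Cmod_0, Hh, re_minus, re_RtoC by exact Hz.
    pose proof (extremal_Re_gt alpha z Ha Hz). lra.
  - apply Hg.
Qed.

Lemma extremal_coef_0 (alpha : R) : extremal_coef alpha 0 = RtoC 0.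
Proof. unfold extremal_coef, log_coef. simpl id_coef. ring. Qed.

Lemma extremal_coef_1 (alpha : R) : extremal_coef alpha 1 = RtoC 1.
Proof.
  unfold extremal_coef, log_coef. simpl id_coef. simpl INR.
  rewrite Rinv_1, <- !RtoC_mult, <- RtoC_plus. f_equal. ring.
Qed.

Lemma extremal_coef_tail (alpha : R) (n : nat) :
  extremal_coef alpha (n + 2) = RtoC (2 * (1 - alpha) / INR (n + 2)).
Proof.
  replace (n + 2)%nat with (S (S n)) by lia.
  unfold extremal_coef, log_coef. simpl id_coef. rewrite Cmult_0_r, Cplus_0_l, <- RtoC_mult.
  reflexivity.
Qed.

Lemma extremal_expansions (alpha : R) :
  power_expansions (extremal alpha) zero_fun (extremal_coef alpha) zero_coef.
Proof.
  intros z Hz. split.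
  - pose proof (PS_correct _ z (summable_extremal alpha) Hz) as H.
    apply (is_Cseries_tail _ _ 1) in H. rewrite Csum_Sn, sum_O in H.
    rewrite extremal_coef_0, extremal_coef_1, Cmult_0_l, Cpow_1_r, Cplus_0_l, Cmult_1_l in H.
    eapply is_series_ext; [|exact H]. intros n. cbv beta.
    now replace (n + 2)%nat with (2 + n)%nat by lia.
  - unfold is_series. apply filterlim_ext with (fun _ => RtoC 0); [|apply filterlim_const].
    intros n. symmetry. change (Csum (fun k => zero_coef (k + 1) * z ^ (k + 1))%C n = RtoC 0).
    induction n as [|n IH]; [rewrite sum_O; apply Cmult_0_l|].
    rewrite Csum_Sn, IH. unfold zero_coef. asC. ring.
Qed.

Lemma extremal_real (alpha r : R) : -1 < r < 1 ->
  extremal alpha (RtoC r) = RtoC (upper_growth alpha r).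
Proof.
  intros Hr. rewrite extremal_eq by (unfold in_disk; rewrite Cmod_R; apply Rabs_def1; lra).
  rewrite PS_log_real by exact Hr. rewrite <- !RtoC_mult, <- RtoC_plus.
  f_equal. unfold upper_growth, log_tail. ring.
Qed.

Lemma lower_growth_limit (alpha t : R) : 0 <= alpha < 1 -> 0 <= t < 1 ->
  0 <= covering_radius alpha - lower_growth alpha t <= 1 - t.
Proof.
  intros Ha Ht. pose proof (ln_two_le t ltac:(lra)) as H1.
  pose proof (ln_le_minus_one ((1 + t) / 2) ltac:(lra)) as H2.
  unfold Rdiv in H2 at 1. rewrite ln_mult, ln_Rinv in H2 by lra.
  unfold covering_radius, lower_growth. nra.
Qed.

Lemma extremal_neg (alpha t : R) : 0 <= t < 1 ->
  extremal alpha (RtoC (- t)) = RtoC (- lower_growth alpha t).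
Proof.
  intros Ht. rewrite extremal_real by lra. f_equal.
  unfold upper_growth, log_tail, lower_growth.
  replace (1 - - t) with (1 + t) by ring. ring.
Qed.

(** The limit of the extremal function [f] at [-1] is not one of its values: by growth along
    the segment from [- t] to [z], [|f z - f (- t)| >= c |z + t|] with [c > 0] independent
    of [t], and this survives the limit [t -> 1]. *)
Lemma extremal_omits (alpha : R) (z : C) : 0 <= alpha < 1 -> in_disk z ->
  extremal alpha z <> RtoC (- covering_radius alpha).
Proof.
  intros Ha Hz E. unfold in_disk in Hz.
  pose proof (Cmod_ge_0 z) as Hz0.
  set (beta := 2 * (1 - alpha)). set (eta := 1 - Cmod z).
  assert (Hbeta : 0 < beta) by (unfold beta; lra). assert (Heta : 0 < eta <= 1) by (unfold eta; lra).
  (* at [zeta = - t + s (z + t)] one has [|zeta| <= 1 - s eta] and [1 / (1 + |zeta|) >= 1 / 2 + s eta / 4];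
     [c] is the integral over [s] of the resulting bound [alpha + beta eta s / 4] of [Re f'] *)
  set (c := alpha + beta * eta / 8).
  assert (Hc : 0 < c) by (unfold c; nra).
  assert (H : forall t, Cmod z < t < 1 -> 0 <= (- (1 + c)) * t + (1 + c * Cmod z)).
  { intros t Ht.
    set (w := RtoC (- t)). set (d := (z - w)%C).
    assert (Hw : Cmod w = t) by (unfold w; rewrite Cmod_R, Rabs_left; lra).
    assert (Hseg : forall s, 0 <= s <= 1 -> Cmod (w + RtoC s * d) <= 1 - s * eta).
    { intros s Hs. replace (w + RtoC s * d)%C with (RtoC (1 - s) * w + RtoC s * z)%C
        by (unfold d; rewrite RtoC_minus; ring).
      eapply Rle_trans; [apply Cmod_triangle|].
      rewrite !Cmod_mult, !Cmod_R, !Rabs_pos_eq, Hw by lra. unfold eta. nra. }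
    assert (Hin : forall s, 0 <= s <= 1 -> in_disk (w + RtoC s * d)%C).
    { intros s Hs. unfold in_disk.
      apply Rle_lt_trans with (Rmax t (Cmod z)); [|apply Rmax_lub_lt; lra].
      apply in_disk_segment; [rewrite Hw; apply Rmax_l| |exact Hs].
      unfold d. replace (w + (z - w))%C with z by ring. apply Rmax_r. }
    pose proof (segment_growth (extremal_coef alpha) zero_coef w d
      (fun s => alpha * s + beta * eta * s ^ 2 / 8) (fun s => alpha + beta * eta * s / 4)
      (summable_extremal alpha)) as Hs.
    specialize (Hs summable_zero Hin).
    assert (Hgrow : Cmod d ^ 2 * c <= dot (extremal alpha z - extremal alpha w) d).
    { replace c with (alpha * 1 + beta * eta * 1 ^ 2 / 8 - (alpha * 0 + beta * eta * 0 ^ 2 / 8))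
        by (unfold c; field).
      replace (extremal alpha z - extremal alpha w)%C
        with (harm (extremal_coef alpha) zero_coef (w + d) - harm (extremal_coef alpha) zero_coef w)%C.
      - apply Hs.
        + intros s _. auto_derive; [trivial|]. field.
        + intros s Hs1. rewrite (PS_dps_zero _ (Hin s Hs1)). rewrite Cmod_0, Rminus_0_r.
          eapply Rle_trans; [|apply extremal_Re_deriv; [exact Ha|now apply Hin]].
          specialize (Hseg s Hs1). pose proof (Cmod_ge_0 (w + RtoC s * d)) as Hm.
          set (m := Cmod (w + RtoC s * d)) in *. fold beta.
          assert (Hi : / 2 + s * eta / 4 <= / (1 + m)).
          { apply Rmult_le_reg_r with (1 + m); [lra|]. rewrite Rinv_l by lra.
            assert (Hse : 0 <= s * eta <= 1) by nra.
            apply Rle_trans with ((/ 2 + s * eta / 4) * (2 - s * eta)); [|nra].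
            apply Rmult_le_compat_l; lra. }
          assert (alpha = 1 - beta / 2) by (unfold beta; field). nra.
      - unfold harm, harmonic_map, extremal.
        replace (w + d)%C with z by (unfold d; ring).
        rewrite (PS_zero z Hz), (PS_zero w) by (unfold in_disk; lra).
        ring. }
    pose proof (dot_le (extremal alpha z - extremal alpha w) d) as Hd.
    rewrite E in Hgrow, Hd. unfold w in Hgrow, Hd. rewrite extremal_neg in Hgrow, Hd by lra. fold w in Hgrow, Hd.
    rewrite <- RtoC_minus in Hgrow, Hd. rewrite Cmod_R in Hd.
    pose proof (lower_growth_limit alpha t Ha ltac:(lra)) as Hl.
    rewrite Rabs_left1 in Hd by lra.
    assert (Hdm : t - Cmod z <= Cmod d).
    { pose proof (Cmod_triangle z (- d)) as Htr. rewrite Cmod_opp in Htr.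
      replace (z + - d)%C with w in Htr by (unfold d; ring). lra. }
    assert (Hdc : Cmod d * c <= 1 - t).
    { apply Rmult_le_reg_l with (Cmod d); [lra|]. simpl in Hgrow.
      assert (Cmod d * (- (- covering_radius alpha - - lower_growth alpha t)) <= Cmod d * (1 - t))
        by (apply Rmult_le_compat_l; lra).
      lra. }
    nra. }
  apply affine_limit in H; [|exact Hz]. unfold eta in *. nra.
Qed.

Lemma extremal_distance (alpha : R) : 0 <= alpha < 1 ->
  Rbar_le (dist_to (RtoC 0) (boundary (image_of_disk (harmonic_map (extremal alpha) zero_fun))))
    (covering_radius alpha).
Proof.
  intros Ha. pose proof (covering_radius_bounds alpha Ha) as HL.
  assert (Ef : forall z, harmonic_map (extremal alpha) zero_fun z = extremal alpha z).
  { intros z. unfold harmonic_map, zero_fun. replace (Cconj (RtoC 0)) with (RtoC 0) by Ccomp. ring. }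
  unfold dist_to. apply Glb_Rbar_correct.
  exists (RtoC (- covering_radius alpha)). split.
  - intros eps Heps. split.
    + set (t := 1 - Rmin (1 / 2) (eps / 2)).
      pose proof (Rmin_l (1 / 2) (eps / 2)). pose proof (Rmin_r (1 / 2) (eps / 2)).
      assert (0 < Rmin (1 / 2) (eps / 2)) by (apply Rmin_pos; lra).
      assert (Ht : 0 <= t < 1) by (unfold t; lra).
      exists (RtoC (- lower_growth alpha t)). split.
      * exists (RtoC (- t)). split.
        -- unfold in_disk. rewrite Cmod_R, Rabs_Ropp, Rabs_pos_eq; lra.
        -- rewrite Ef, extremal_neg by exact Ht. reflexivity.
      * rewrite <- RtoC_minus, Cmod_R.
        pose proof (lower_growth_limit alpha t Ha Ht) as Hl.
        rewrite Rabs_pos_eq by lra. unfold t in *. lra.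
    + exists (RtoC (- covering_radius alpha)). split.
      * intros [z [Hz E]]. rewrite Ef in E. symmetry in E. now apply (extremal_omits alpha z Ha Hz).
      * replace (RtoC (- covering_radius alpha) - RtoC (- covering_radius alpha))%C with (RtoC 0) by ring.
        rewrite Cmod_0. exact Heps.
  - replace (RtoC (- covering_radius alpha) - 0)%C with (RtoC (- covering_radius alpha)) by ring.
    rewrite Cmod_R, Rabs_Ropp, Rabs_pos_eq; lra.
Qed.

Lemma area_series_zero (r : R) : area_series zero_coef r = 0.
Proof.
  unfold area_series. rewrite (Series_ext _ (fun n => 0 * 0)); [rewrite Series_scal_l; ring|].
  intros n. unfold zero_coef. rewrite Cmod_0. ring.
Qed.

Lemma extremal_area (alpha r : R) : 0 <= alpha < 1 -> 0 <= r < 1 ->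
  area_S (extremal alpha) zero_fun r / PI = M_fun alpha r.
Proof.
  intros Ha Hr.
  pose proof (summable_extremal alpha) as SA.
  destruct (area_formula (extremal alpha) zero_fun (extremal_coef alpha) zero_coef r SA summable_zero Hr) as [E _].
  - intros z Hz. split; apply is_C_derive_unique; [now apply extremal_is_derive|].
    apply PS_is_derive; [apply summable_zero| |exact Hz].
    intros w Hw. symmetry. now apply PS_zero.
  - intros z Hz. left. destruct (extremal_class alpha Ha) as [[_ [_ [_ [_ [_ Hj]]]]] _]. now apply Hj.
  - rewrite E, area_series_zero, (area_series_split _ r SA Hr (extremal_coef_1 alpha)).
    unfold M_fun. rewrite Rminus_0_r. f_equal. rewrite <- Series_scal_l.
    apply Series_ext. intros n. rewrite extremal_coef_tail, Cmod_R.
    assert (HI : 0 < INR (n + 2)) by (apply lt_0_INR; lia).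
    rewrite Rabs_pos_eq by (apply Rmult_le_pos; [lra|left; now apply Rinv_0_lt_compat]).
    field. lra.
Qed.

Lemma extremal_violates (alpha p : R) (mu : R -> R) (r : R) :
  0 <= alpha < 1 -> 1 <= p -> 0 < r < 1 -> 0 < J2 alpha p mu r ->
  ~ bohr_inequality p mu (extremal alpha) zero_fun (extremal_coef alpha) zero_coef (RtoC r).
Proof.
  intros Ha Hp Hr HJ H. unfold bohr_inequality in H.
  rewrite (harmonic_map_0 alpha _ _ (extremal_class alpha Ha)) in H.
  pose proof (Rbar_le_trans _ _ _ H (extremal_distance alpha Ha)) as H2. clear H. simpl in H2.
  assert (Em : Cmod (RtoC r) = r) by (rewrite Cmod_R, Rabs_pos_eq; lra).
  rewrite Em, extremal_area in H2 by lra.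
  assert (Ef : harmonic_map (extremal alpha) zero_fun (RtoC r) = RtoC (upper_growth alpha r)).
  { unfold harmonic_map, zero_fun. rewrite extremal_real by lra. Ccomp. }
  rewrite Ef, Cmod_R, Rabs_pos_eq in H2.
  - rewrite (Series_ext _ (fun n => 2 * (1 - alpha) * (r ^ (n + 2) / INR (n + 2)))) in H2.
    + rewrite Series_scal_l, log_tail_series in H2 by lra. rewrite J2_eq in HJ. lra.
    + intros n. rewrite extremal_coef_tail. unfold zero_coef. rewrite Cmod_0, Cmod_R.
      assert (HI : 0 < INR (n + 2)) by (apply lt_0_INR; lia).
      rewrite Rabs_pos_eq by (apply Rmult_le_pos; [lra|left; now apply Rinv_0_lt_compat]).
      field. lra.
  - pose proof (log_tail_nonneg r ltac:(lra)). unfold upper_growth. nra.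
Qed.

Theorem theorem2p2 (alpha p : R) (mu : R -> R)
  (halpha : 0 <= alpha < 1) (hp : 1 <= p)
  (mu_nonneg : forall x : R, 0 <= x -> 0 <= mu x)
  (mu_incr : forall x y : R, 0 <= x -> x <= y -> mu x <= mu y) :
  (* existence of the root *)
  ((forall x : R, 0 <= x ->
      filterlim mu (within (fun t : R => 0 <= t) (locally x)) (locally (mu x))) ->
   mu 0 < 1 + 2 * (1 - alpha) * (ln 2 - 1) ->
   exists Rf : R, 0 < Rf < 1 /\ J2 alpha p mu Rf = 0) /\
  (forall Rf : R, 0 < Rf < 1 -> J2 alpha p mu Rf = 0 ->
    (* uniqueness of the root *)
    (forall r : R, 0 < r < 1 -> J2 alpha p mu r = 0 -> r = Rf) /\
    (* the inequality *)
    (forall (h g : C -> C) (a b : nat -> C),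
       class_PH0 alpha h g -> power_expansions h g a b ->
       forall z : C, Cmod z <= Rf -> bohr_inequality p mu h g a b z) /\
    (* sharpness *)
    (forall R' : R, Rf < R' < 1 ->
       exists (h g : C -> C) (a b : nat -> C),
         class_PH0 alpha h g /\ power_expansions h g a b /\
         exists z : C, Cmod z <= R' /\ ~ bohr_inequality p mu h g a b z)).
Proof.
  split.
  - intros Hc H0. exact (root_exists alpha p mu halpha hp mu_nonneg Hc H0).
  - intros Rf HRf HJ.
    assert (Hlt : forall r s, 0 <= r < s -> s < 1 -> J2 alpha p mu r < J2 alpha p mu s)
      by (intros; now apply J2_lt).
    split; [|split].
    + intros r Hr Er.
      destruct (Rtotal_order r Rf) as [H|[H|H]]; [|exact H|].
      * pose proof (Hlt r Rf). lra.
      * pose proof (Hlt Rf r). lra.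
    + intros h g a b Hcl Hpe z Hz. now apply (bohr_inequality_below alpha p mu Rf).
    + intros R' HR'.
      exists (extremal alpha), zero_fun, (extremal_coef alpha), zero_coef.
      split; [now apply extremal_class|]. split; [apply extremal_expansions|].
      exists (RtoC R'). split; [rewrite Cmod_R, Rabs_pos_eq; lra|].
      apply extremal_violates; try assumption; [lra|].
      pose proof (Hlt Rf R'). lra.
Qed.
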